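(* Let $G=SU(2)$ and let $r\geq 1$ be an integer. The quotient space $F_{2r}/F_{2r-2}$ is $G$-equivariantly homeomorphic to the Thom space $\mathrm{Thom}(\tau^{2r-1})$.
   Context: Let $\mathcal K=L^2(S^1)\otimes\mathbb C^2$, let $z$ be the coordinate on $S^1$ (also denoting multiplication by $z$ on $\mathcal K$), and let $\mathcal K_+\subset\mathcal K$ be the closed subspace spanned by $z^k\otimes\mathbb C^2$, $k\ge 0$. For a closed subspace $W\subset\mathcal K$ let $P_+^W:W\to\mathcal K_+$ be the orthogonal projection, and (when kernel and cokernel are finite-dimensional) $\mathrm{Ind}(W)=\dim\mathrm{Ker}(P_+^W)-\dim\mathrm{Coker}(P_+^W)$. For $r\ge 0$, $$F_{2r}=\{W\subset\mathcal K \text{ closed subspace} : zW\subset W,\ z^r\mathcal K_+\subset W\subset z^{-r}\mathcal K_+,\ \mathrm{Ind}(W)=0\},$$ topologized via $W\mapsto W/z^r\mathcal K_+$ as a subspace of the Grassmannian of the finite-dimensional space $z^{-r}\mathcal K_+/z^r\mathcal K_+$. $G$ acts on $\mathcal K$ through its standard action on the factor $\mathbb C^2$, hence on $F_{2r}$. $\tau$ is the $G$-equivariant complex line bundle over $\mathbb P^1$ with total space $\{(u,v) : u\in S^3\subset\mathbb C^2,\ v\in u^\perp\}/\sim$, where $u^\perp$ is the orthogonal complement of $u$ for the standard hermitian metric on $\mathbb{C}^2$, $(u,v)\sim(\zeta u,\zeta v)$ for $\zeta\in S^1$, projection $[(u,v)]\mapsto[u]$, and $G$-action $g\cdot[(u,v)]=[(gu,gv)]$.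 $\tau^{2r-1}$ is the Whitney sum of $2r-1$ copies of $\tau$. *)

(* Defs.v *)
From HB Require Import structures.
From mathcomp Require Import all_boot all_order all_algebra.
From mathcomp Require Import all_classical all_reals all_analysis.
From mathcomp Require Import measurable_realfun complex.

Set Implicit Arguments.
Unset Strict Implicit.
Unset Printing Implicit Defensive.

Import Order.TTheory GRing.Theory Num.Theory numFieldNormedType.Exports.

Local Open Scope classical_set_scope.
Local Open Scope ring_scope.

Section LinearSubspaces.
Variables (C : numFieldType) (V : lmodType C).

Definition linear_set (W : set V) : Prop :=
  W 0 /\ forall (a : C) (u v : V), W u -> W v -> W (a *: u + v).

Record linsub := LinSub { linset :> V -> Prop; linsetP : linear_set linset }.

HB.instance Definition _ := gen_eqMixin linsub.
HB.instance Definition _ := gen_choiceMixin linsub.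

Lemma linsub_eq (W W' : linsub) : (W : set V) = W' -> W = W'.
Proof. by case: W W' => [W hW] [W' hW'] /= e; subst W'; congr LinSub. Qed.

Section LinsubTheory.
Variable W : linsub.

Lemma linsub0 : W 0. Proof. by case: (linsetP W). Qed.
Lemma linsubZD a u v : W u -> W v -> W (a *: u + v).
Proof. by case: (linsetP W) => _; apply. Qed.
Lemma linsubD u v : W u -> W v -> W (u + v).
Proof. by move=> Wu Wv; rewrite -[u]scale1r; apply: linsubZD. Qed.
Lemma linsubZ a u : W u -> W (a *: u).
Proof. by move=> Wu; rewrite -[_ *: u]addr0; apply: linsubZD => //; apply: linsub0. Qed.
Lemma linsubN u : W u -> W (- u).
Proof. by move=> Wu; rewrite -scaleN1r; apply: linsubZ. Qed.
Lemma linsubB u v : W u -> W v -> W (u - v).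
Proof. by move=> Wu Wv; apply: linsubD => //; apply: linsubN. Qed.
Lemma linsub_sum (I : finType) (w : I -> V) (c : I -> C) :
  (forall i, W (w i)) -> W (\sum_i c i *: w i).
Proof.
move=> Ww; elim/big_ind: _ => [|u v|i _]; first exact: linsub0.
  exact: linsubD.
by apply: linsubZ.
Qed.
End LinsubTheory.

Definition lin_span (k : nat) (w : 'I_k -> V) : set V :=
  [set v | exists c : 'I_k -> C, v = \sum_i c i *: w i].

Lemma lin_span_linear k (w : 'I_k -> V) : linear_set (lin_span w).
Proof.
split=> [|a u v [c ->] [d ->]].
  by exists (fun=> 0); rewrite big1 // => i _; rewrite scale0r.
exists (fun i => a * c i + d i); rewrite scaler_sumr -big_split /=.
by apply: eq_bigr => i _; rewrite scalerDl scalerA.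
Qed.

Definition span_sub k (w : 'I_k -> V) : linsub := LinSub (lin_span_linear w).

Definition lin_indep (k : nat) (w : 'I_k -> V) : Prop :=
  forall c : 'I_k -> C, \sum_i c i *: w i = 0 -> forall i, c i = 0.

Definition lin_basis (k : nat) (w : 'I_k -> V) : Prop :=
  lin_indep w /\ lin_span w = setT.

(* dim (Y / X) = n, for a subspace X of Y *)
Definition has_codim (X Y : set V) (n : nat) : Prop :=
  exists w : 'I_n -> V,
    [/\ forall i, Y (w i),
        forall c : 'I_n -> C, X (\sum_i c i *: w i) -> forall i, c i = 0 &
        forall y, Y y -> exists c : 'I_n -> C, X (y - \sum_i c i *: w i)].

Definition has_dim (Y : set V) (n : nat) : Prop := has_codim [set 0] Y n.

End LinearSubspaces.

(* Y / X as the space of cosets y + X, y in Y *)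
Section Quotient.
Variables (C : numFieldType) (V : lmodType C) (Y X : linsub V).

Record quotmod := QuotMod {
  qset : set V;
  qsetP : exists2 y, Y y & qset = [set x | X (x - y)] }.

HB.instance Definition _ := gen_eqMixin quotmod.
HB.instance Definition _ := gen_choiceMixin quotmod.

Definition qclass (y : V) (Yy : Y y) : quotmod :=
  @QuotMod [set x | X (x - y)] (ex_intro2 _ _ y Yy erefl).

Definition qrep (q : quotmod) : V := s2val (cid2 (qsetP q)).

Lemma qrepP (q : quotmod) : Y (qrep q).
Proof. by rewrite /qrep; case: (cid2 (qsetP q)). Qed.

Lemma quotmod_eq (p q : quotmod) : qset p = qset q -> p = q.
Proof. by case: p q => [p hp] [q hq] /= e; subst q; congr QuotMod. Qed.

Lemma qclass_eq y y' (Yy : Y y) (Yy' : Y y') :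
  X (y - y') -> qclass Yy = qclass Yy'.
Proof.
move=> Xyy'; apply: quotmod_eq; apply/seteqP; split=> x /= Xx.
  by rewrite -(subrK y x) -addrA; apply: linsubD.
by rewrite -(subrK y' x) -addrA; apply: linsubD => //; rewrite -opprB; apply: linsubN.
Qed.

Lemma qclass_inj y y' (Yy : Y y) (Yy' : Y y') :
  qclass Yy = qclass Yy' -> X (y - y').
Proof.
move=> /(congr1 qset) /= e; have : [set x | X (x - y)] y.
  by rewrite /= subrr; apply: linsub0.
by rewrite e.
Qed.

Lemma qrepK q : qclass (qrepP q) = q.
Proof.
apply: quotmod_eq; rewrite /qclass /= /qrep.
by case: (cid2 (qsetP q)) => y Yy /= ->.
Qed.

Lemma qrep_class y (Yy : Y y) : X (qrep (qclass Yy) - y).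
Proof. by apply: (qclass_inj (Yy := qrepP _) (Yy' := Yy)); rewrite qrepK. Qed.

(* The operations are locked because conversion otherwise unfolds them down to
   representatives of cosets and does not terminate in practice. *)
Fact quot_key : unit. Proof. exact: tt. Qed.
Definition qzero : quotmod := qclass (linsub0 Y).
Definition qopp : quotmod -> quotmod :=
  locked_with quot_key (fun p => qclass (linsubN (qrepP p))).
Definition qadd : quotmod -> quotmod -> quotmod :=
  locked_with quot_key (fun p q => qclass (linsubD (qrepP p) (qrepP q))).
Definition qscale : C -> quotmod -> quotmod :=
  locked_with quot_key (fun a p => qclass (linsubZ a (qrepP p))).

Lemma qoppE' p : qopp p = qclass (linsubN (qrepP p)).
Proof. by rewrite /qopp unlock. Qed.
Lemma qaddE' p q : qadd p q = qclass (linsubD (qrepP p) (qrepP q)).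
Proof. by rewrite /qadd unlock. Qed.
Lemma qscaleE' a p : qscale a p = qclass (linsubZ a (qrepP p)).
Proof. by rewrite /qscale unlock. Qed.

Lemma qaddE x y (Yx : Y x) (Yy : Y y) (Yxy : Y (x + y)) :
  qadd (qclass Yx) (qclass Yy) = qclass Yxy.
Proof.
rewrite qaddE'; apply: qclass_eq; rewrite opprD addrACA.
by apply: linsubD; apply: qrep_class.
Qed.

Lemma qoppE x (Yx : Y x) (Ynx : Y (- x)) : qopp (qclass Yx) = qclass Ynx.
Proof.
by rewrite qoppE'; apply: qclass_eq; rewrite -opprD; apply: linsubN; apply: qrep_class.
Qed.

Lemma qscaleE a x (Yx : Y x) (Yax : Y (a *: x)) : qscale a (qclass Yx) = qclass Yax.
Proof. by rewrite qscaleE'; apply: qclass_eq; rewrite -scalerBr; apply: linsubZ; apply: qrep_class. Qed.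

Lemma qclass_congr x y (Yx : Y x) (Yy : Y y) : x = y -> qclass Yx = qclass Yy.
Proof. by move=> e; apply: qclass_eq; rewrite e subrr; apply: linsub0. Qed.

Lemma qaddA : associative qadd.
Proof.
move=> p q r; rewrite -(qrepK p) -(qrepK q) -(qrepK r).
move: (qrepP p) (qrepP q) (qrepP r) => Yp Yq Yr.
rewrite (qaddE Yq Yr (linsubD Yq Yr)) (qaddE Yp Yq (linsubD Yp Yq)).
rewrite (qaddE _ _ (linsubD Yp (linsubD Yq Yr))).
rewrite (qaddE _ _ (linsubD (linsubD Yp Yq) Yr)).
by apply: qclass_congr; rewrite addrA.
Qed.

Lemma qaddC : commutative qadd.
Proof. by move=> p q; rewrite !qaddE'; apply: qclass_congr; rewrite addrC. Qed.

Lemma qadd0 : left_id qzero qadd.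
Proof.
move=> p; rewrite -(qrepK p).
rewrite (qaddE _ _ (linsubD (linsub0 Y) (qrepP p))).
by apply: qclass_congr; rewrite add0r.
Qed.

Lemma qaddN : left_inverse qzero qopp qadd.
Proof.
move=> p; rewrite -{2}(qrepK p) qoppE'.
rewrite (qaddE _ _ (linsubD (linsubN (qrepP p)) (qrepP p))).
by apply: qclass_congr; rewrite addNr.
Qed.

HB.instance Definition _ := GRing.isZmodule.Build quotmod qaddA qaddC qadd0 qaddN.

Lemma qscaleA a b p : qscale a (qscale b p) = qscale (a * b) p.
Proof.
rewrite (qscaleE' b) (qscaleE' (a * b)) (qscaleE _ (linsubZ a (linsubZ b (qrepP p)))).
by apply: qclass_congr; rewrite scalerA.
Qed.

Lemma qscale1 : left_id 1 qscale.
Proof.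
by move=> p; rewrite -[RHS]qrepK qscaleE'; apply: qclass_congr; rewrite scale1r.
Qed.

Lemma qscaleDr : right_distributive qscale +%R.
Proof.
move=> a p q; rewrite -[p + q]/(qadd p q) qaddE'.
rewrite (qscaleE _ (linsubZ a (linsubD (qrepP p) (qrepP q)))).
rewrite -[RHS]/(qadd (qscale _ _) (qscale _ _)) !qscaleE'.
rewrite (qaddE _ _ (linsubD (linsubZ a (qrepP p)) (linsubZ a (qrepP q)))).
by apply: qclass_congr; rewrite scalerDr.
Qed.

Lemma qscaleDl p : {morph qscale^~ p : a b / a + b}.
Proof.
move=> a b; rewrite -[RHS]/(qadd (qscale _ _) (qscale _ _)) !qscaleE'.
rewrite (qaddE _ _ (linsubD (linsubZ a (qrepP p)) (linsubZ b (qrepP p)))).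
by apply: qclass_congr; rewrite scalerDl.
Qed.

HB.instance Definition _ := GRing.Zmodule_isLmodule.Build C quotmod
  qscaleA qscale1 qscaleDr qscaleDl.

Lemma qclassZD a x y (Yx : Y x) (Yy : Y y) (Yaxy : Y (a *: x + y)) :
  qclass Yaxy = a *: qclass Yx + qclass Yy.
Proof.
rewrite -[RHS]/(qadd (qscale _ _) _) (qscaleE _ (linsubZ a Yx)).
by rewrite (qaddE _ _ (linsubD (linsubZ a Yx) Yy)); apply: qclass_congr.
Qed.

(* W / X: the cosets that have a representative in W *)
Definition quot_image (W : linsub V) : set quotmod :=
  [set q | exists2 w, W w & qset q w].

Lemma qset_rep (q : quotmod) w : qset q w -> X (w - qrep q).
Proof. by rewrite -{1}(qrepK q). Qed.

Lemma rep_qset (q : quotmod) w : X (w - qrep q) -> qset q w.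
Proof. by rewrite -{2}(qrepK q). Qed.

Lemma quot_image_linear W : linear_set (quot_image W).
Proof.
split=> [|a p q [u Wu pu] [v Wv qv]].
  by exists 0; [exact: linsub0 | rewrite /= subrr; exact: linsub0].
exists (a *: u + v); first exact: linsubZD.
rewrite -(qrepK p) -(qrepK q) -(qclassZD _ _ (linsubZD a (qrepP p) (qrepP q))) /=.
rewrite opprD addrACA -scalerBr.
by apply: linsubZD; apply: qset_rep.
Qed.

Definition quot_sub (W : linsub V) : linsub quotmod := LinSub (quot_image_linear W).

End Quotient.

(* The Grassmannian of a finite-dimensional complex vector space V: the set of
   linear subspaces of V with the final topology for the maps sending a
   linearly independent k-frame to its span (k arbitrary).  Frames are
   k x n matrices of coordinates in a basis of V. *)
Section Grassmannian.
Variables (C : numFieldType) (V : lmodType C).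

Definition frame (n k : nat) (b : 'I_n -> V) (A : 'M[C]_(k, n)) : 'I_k -> V :=
  fun i => \sum_j A i j *: b j.

Definition stiefel (n k : nat) (b : 'I_n -> V) : Type :=
  [set A : 'M[C]_(k, n) | lin_indep (frame b A)].

HB.instance Definition _ n k b := Topological.on (@stiefel n k b).

Definition stiefel_span n k (b : 'I_n -> V) (A : stiefel k b) : linsub V :=
  span_sub (frame b (set_val A)).

Definition grass : Type := linsub V.
HB.instance Definition _ := Choice.on grass.

Definition grass_open (U : set grass) : Prop :=
  forall (n : nat) (b : 'I_n -> V), lin_basis b ->
  forall k : nat, open (@stiefel_span n k b @^-1` U).

Lemma grass_openT : grass_open setT.
Proof. by move=> n b _ k; rewrite preimage_setT; apply: openT. Qed.
Lemma grass_openI U U' : grass_open U -> grass_open U' -> grass_open (U `&` U').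
Proof.
by move=> oU oU' n b bb k; rewrite preimage_setI; apply: openI; [apply: oU | apply: oU'].
Qed.
Lemma grass_open_bigcup (I : Type) (U : I -> set grass) :
  (forall i, grass_open (U i)) -> grass_open (\bigcup_i U i).
Proof.
move=> oU n b bb k; rewrite preimage_bigcup; apply: bigcup_open => i _; exact: oU.
Qed.

HB.instance Definition _ := isOpenTopological.Build grass
  grass_openT grass_openI grass_open_bigcup.

End Grassmannian.

Section QuotientMap.
Variables (C : numFieldType) (V V' : lmodType C).
Variables (Y X : linsub V) (Y' X' : linsub V') (phi : V -> V').
Hypothesis phiZD : forall a u v, phi (a *: u + v) = a *: phi u + phi v.
Hypothesis phiY : forall y, Y y -> Y' (phi y).
Hypothesis phiX : forall x, X x -> X' (phi x).

Definition qmap (q : quotmod Y X) : quotmod Y' X' := qclass X' (phiY (qrepP q)).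

Lemma qmapE y (Yy : Y y) (Yy' : Y' (phi y)) :
  qmap (qclass X Yy) = qclass X' Yy'.
Proof.
apply: qclass_eq; have := phiX (qrep_class X Yy).
by rewrite -{1}scaleN1r addrC phiZD scaleN1r addrC.
Qed.

Lemma qmapZD a p q : qmap (a *: p + q) = a *: qmap p + qmap q.
Proof.
rewrite -{1}(qrepK p) -{1}(qrepK q).
rewrite -(qclassZD _ _ _ (linsubZD a (qrepP p) (qrepP q))).
rewrite (qmapE _ (phiY (linsubZD a (qrepP p) (qrepP q)))) /qmap.
rewrite -(qclassZD _ _ _ (linsubZD a (phiY (qrepP p)) (phiY (qrepP q)))).
by apply: qclass_congr.
Qed.
End QuotientMap.

Definition linear_op (C : numFieldType) (V V' : lmodType C) (phi : V -> V') : Prop :=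
  forall a u v, phi (a *: u + v) = a *: phi u + phi v.

Lemma linear_op0 (C : numFieldType) (V V' : lmodType C) (phi : V -> V') :
  linear_op phi -> phi 0 = 0.
Proof. by move=> l; have := l (-1) 0 0; rewrite addr0 !scaleN1r oppr0 addNr. Qed.

Lemma linear_opB (C : numFieldType) (V V' : lmodType C) (phi : V -> V') u v :
  linear_op phi -> phi (u - v) = phi u - phi v.
Proof. by move=> l; rewrite addrC -scaleN1r l scaleN1r addrC. Qed.

Lemma linear_op_sum (C : numFieldType) (V V' : lmodType C) (phi : V -> V')
    (I : finType) (c : I -> C) (w : I -> V) :
  linear_op phi -> phi (\sum_i c i *: w i) = \sum_i c i *: phi (w i).
Proof.
move=> l; apply: (big_ind2 (fun x y => phi x = y)) => [|x _ y _ <- <-|i _].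
- exact: linear_op0.
- by rewrite -[x]scale1r l !scale1r.
- by rewrite -[_ *: w i]addr0 l (linear_op0 l) addr0.
Qed.

Section ImageSub.
Variables (C : numFieldType) (V V' : lmodType C) (phi : V -> V').
Hypothesis lphi : linear_op phi.

Lemma image_linear (W : linsub V) : linear_set (phi @` W).
Proof.
split=> [|a _ _ [u Wu <-] [v Wv <-]].
  by exists 0; [exact: linsub0 | exact: linear_op0].
by exists (a *: u + v); [exact: linsubZD | exact: lphi].
Qed.

Definition linsub_image (W : linsub V) : linsub V' := LinSub (image_linear W).
End ImageSub.

Section Circle.
Variable R : realType.
Local Notation C := R[i].

Definition circle : Type := {z : C | `|z| == 1}.

Lemma cis_subproof (x : R) : `|Complex (cos x) (sin x)| == 1.
Proof.
by rewrite normc_def /= cos2Dsin2 sqrtr1.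
Qed.

Definition cis (x : R) : circle := @exist C (fun z => `|z| == 1) _ (cis_subproof x).

(* Functions on the circle are integrated along t |-> exp (2 i pi t), t in
   [0, 1], that is, against the normalised arc length. *)
Definition angle (t : R) : circle := cis (2 * pi * t).

Definition mu01 : {measure set (measurableTypeR R) -> \bar R} :=
  mrestr (@lebesgue_measure R) (measurable_itv `[(0 : R), 1]).

Definition sqint (f : circle -> C) : Prop :=
  (fun t => complex.Re (f (angle t))) \in Lfun mu01 2%:E /\
  (fun t => complex.Im (f (angle t))) \in Lfun mu01 2%:E.

Definition ae_null (f : circle -> C) : Prop :=
  {ae mu01, forall t, f (angle t) = 0}.

Let le12 : (1 <= 2%:E :> \bar R)%E. Proof. by rewrite lee_fin ler1n. Qed.

Lemma Lfun2ZD a (f g : R -> R) : f \in Lfun mu01 2%:E -> g \in Lfun mu01 2%:E ->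
  (fun t => a * f t + g t) \in Lfun mu01 2%:E.
Proof. by move=> hf hg; have [_ h] := Lfun_submod_closed mu01 le12; exact: (h a f g hf hg). Qed.

Lemma Lfun2_0 : (fun=> 0) \in Lfun mu01 2%:E.
Proof. by have [h _] := Lfun_submod_closed mu01 le12. Qed.

Lemma Lfun2_eq (f g : R -> R) : f \in Lfun mu01 2%:E -> f =1 g ->
  g \in Lfun mu01 2%:E.
Proof. by move=> hf /funext <-. Qed.

Lemma Lfun2D (f g : R -> R) : f \in Lfun mu01 2%:E -> g \in Lfun mu01 2%:E ->
  (fun t => f t + g t) \in Lfun mu01 2%:E.
Proof.
move=> hf hg; apply: Lfun2_eq (Lfun2ZD 1 hf hg) _ => t.
by rewrite mul1r.
Qed.

Lemma Lfun2Z a (f : R -> R) : f \in Lfun mu01 2%:E ->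
  (fun t => a * f t) \in Lfun mu01 2%:E.
Proof.
move=> hf; apply: Lfun2_eq (Lfun2ZD a hf Lfun2_0) _ => t.
by rewrite addr0.
Qed.

Lemma Lfun2B (f g : R -> R) : f \in Lfun mu01 2%:E -> g \in Lfun mu01 2%:E ->
  (fun t => f t - g t) \in Lfun mu01 2%:E.
Proof.
move=> hf hg; apply: Lfun2_eq (Lfun2ZD (-1) hg hf) _ => t.
by rewrite mulN1r addrC.
Qed.

Lemma sqint_linear : linear_set (sqint : set (circle -> C)).
Proof.
split=> [|a f g [f1 f2] [g1 g2]]; first by split; exact: Lfun2_0.
split.
- apply: Lfun2_eq (Lfun2D (Lfun2B (Lfun2Z (complex.Re a) f1) (Lfun2Z (complex.Im a) f2)) g1) _ => t.
  rewrite /GRing.scale /= /GRing.add /=.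
  by case: a (f _) (g _) => [a b] [c d] [u v].
- apply: Lfun2_eq (Lfun2D (Lfun2D (Lfun2Z (complex.Re a) f2) (Lfun2Z (complex.Im a) f1)) g2) _ => t.
  rewrite /GRing.scale /= /GRing.add /=.
  by case: a (f _) (g _) => [a b] [c d] [u v].
Qed.

Lemma ae_null_linear : linear_set (ae_null : set (circle -> C)).
Proof.
split=> [|a f g]; first by apply: aeW.
have FF := ae_filter_ringOfSetsType mu01.
move=> f0 g0; apply: (filterS2 _ _ f0 g0) => t /= {}f0 {}g0.
rewrite -[LHS]/(a * f (angle t) + g (angle t)).
by rewrite f0 g0 mulr0 addr0.
Qed.

Definition sqint_sub : linsub (circle -> C) := LinSub sqint_linear.
Definition null_sub : linsub (circle -> C) := LinSub ae_null_linear.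
Definition L2 : Type := quotmod sqint_sub null_sub.
HB.instance Definition _ := GRing.Lmodule.on L2.

Lemma val_cis_exp (x : R) (m : int) :
  (sval (cis x)) ^ m = Complex (cos (x *~ m)) (sin (x *~ m)).
Proof.
have cisD (u v : R) : Complex (cos u) (sin u) * Complex (cos v) (sin v) =
    Complex (cos (u + v)) (sin (u + v)).
  by rewrite cosD sinD; congr Complex; rewrite addrC.
have pown (n : nat) : (Complex (cos x) (sin x)) ^+ n =
    Complex (cos (x *+ n)) (sin (x *+ n)).
  elim: n => [|n IHn]; first by rewrite expr0 mulr0n cos0 sin0.
  by rewrite exprS IHn cisD mulrS.
case: m => n; first exact: pown.
rewrite NegzE -exprnN -/(_ *- n.+1) [sval _]/= pown.
have nz (u : R) : Complex (cos u) (sin u) != 0.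
  by rewrite -normr_gt0 (eqP (cis_subproof u)).
apply: (mulfI (nz (x *+ n.+1))); rewrite mulfV //.
rewrite mulrNz cisD.
by rewrite -pmulrn subrr cos0 sin0.
Qed.

Lemma Lfun2_bounded (b f : R -> R) : measurable_fun [set: R] b ->
  (forall t, `|b t| <= 1) -> f \in Lfun mu01 2%:E ->
  (fun t => b t * f t) \in Lfun mu01 2%:E.
Proof.
move=> mb b1; rewrite inE => /andP[/[!inE]/= mf ff].
apply/andP; split; rewrite inE /=; first exact: measurable_funM.
apply: le_lt_trans ff; rewrite unlock gt0_ler_poweR//.
- by rewrite in_itv/= leey integral_ge0.
- by rewrite in_itv/= leey integral_ge0.
- apply: ge0_le_integral => //=.
  + apply/measurable_EFinP.
    apply/(@measurableT_comp _ _ _ _ _ _ (fun x : R => x `^ 2)%R) => //.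
    apply/measurableT_comp => //; exact: measurable_funM.
  + apply/measurable_EFinP.
    apply/(@measurableT_comp _ _ _ _ _ _ (fun x : R => x `^ 2)%R) => //.
    exact/measurableT_comp.
  + move=> t _ /=; rewrite lee_fin ge0_ler_powR ?nnegrE ?normr_ge0//.
    by rewrite normrM ler_piMl.
Qed.





Lemma angle_exp (t : R) (m : int) :
  (sval (angle t)) ^ m = Complex (cos (2 * pi * m%:~R * t)) (sin (2 * pi * m%:~R * t)).
Proof. by rewrite val_cis_exp -mulrzr mulrAC. Qed.

Lemma cos_measurable (a : R) : measurable_fun [set: R] (fun t => cos (a * t)).
Proof.
apply: continuous_measurable_fun => t; apply: continuous_comp; last exact: continuous_cos.
exact: mulrl_continuous.
Qed.

Lemma sin_measurable (a : R) : measurable_fun [set: R] (fun t => sin (a * t)).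
Proof.
apply: continuous_measurable_fun => t; apply: continuous_comp; last exact: continuous_sin.
exact: mulrl_continuous.
Qed.

Definition zfun (m : int) (f : circle -> C) : circle -> C :=
  fun x => (sval x) ^ m * f x.

Lemma zfunZD m a f g : zfun m (a *: f + g) = a *: zfun m f + zfun m g.
Proof.
apply/funext => x.
rewrite -[LHS]/(_ * (a * f x + g x)) -[RHS]/(a * (_ * f x) + (_ * g x)).
by rewrite mulrDr mulrCA.
Qed.

Lemma zfun_sqint m f : sqint_sub f -> sqint_sub (zfun m f).
Proof.
move=> [f1 f2]; pose a : R := 2 * pi * m%:~R.
have hc g : g \in Lfun mu01 2%:E -> (fun t => cos (a * t) * g t) \in Lfun mu01 2%:E.
  by apply: Lfun2_bounded => [|t]; [exact: cos_measurable | exact: cos_max].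
have hs g : g \in Lfun mu01 2%:E -> (fun t => sin (a * t) * g t) \in Lfun mu01 2%:E.
  by apply: Lfun2_bounded => [|t]; [exact: sin_measurable | exact: sin_max].
split.
- apply: Lfun2_eq (Lfun2B (hc _ f1) (hs _ f2)) _ => t.
  by rewrite /zfun angle_exp; case: (f _).
- apply: Lfun2_eq (Lfun2D (hc _ f2) (hs _ f1)) _ => t.
  by rewrite /zfun angle_exp; case: (f _).
Qed.

Lemma zfun_null m f : null_sub f -> null_sub (zfun m f).
Proof.
have FF := ae_filter_ringOfSetsType mu01.
by apply: filterS => t /= f0; rewrite /zfun f0 mulr0.
Qed.

Definition zL2 (m : int) : L2 -> L2 := qmap null_sub (@zfun_sqint m).

Lemma zL2_linear m : linear_op (zL2 m).
Proof. exact: qmapZD (zfunZD m) _ (@zfun_null m). Qed.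

Lemma mu01_setT : mu01 [set: R] = 1%E.
Proof.
rewrite /mu01 /= /mrestr setTI.
by have := @lebesgue_measure_itv R `[0, 1]; rewrite /= lte_fin ltr01 sube0 => ->.
Qed.

Lemma sqint1 : sqint_sub (fun=> 1).
Proof.
split; last exact: Lfun2_0.
apply/andP; split; rewrite inE //=.
rewrite /finite_norm unlock poweR_lty //.
under eq_integral => x _ do rewrite /= normr1 powR1.
by rewrite integral_cst // mul1e mu01_setT ltry.
Qed.


Definition zpow (k : int) : L2 := zL2 k (qclass null_sub sqint1).

Definition cint (h : circle -> C) : C :=
  Complex (\int[mu01]_t complex.Re (h (angle t))) (\int[mu01]_t complex.Im (h (angle t))).

Definition L2dot (f g : L2) : C := cint (fun x => qrep f x * (qrep g x)^*%R).


Definition cintegrable (h : circle -> C) : Prop :=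
  mu01.-integrable [set: R] (EFin \o (fun t => complex.Re (h (angle t)))) /\
  mu01.-integrable [set: R] (EFin \o (fun t => complex.Im (h (angle t)))).

Lemma integrableZDR a (f g : R -> R) :
  mu01.-integrable [set: R] (EFin \o f) -> mu01.-integrable [set: R] (EFin \o g) ->
  mu01.-integrable [set: R] (EFin \o (fun t => a * f t + g t)).
Proof.
move=> hf hg; have := integrableD measurableT (integrableZl measurableT a hf) hg.
exact.
Qed.

Lemma RintegralZD a (f g : R -> R) :
  mu01.-integrable [set: R] (EFin \o f) -> mu01.-integrable [set: R] (EFin \o g) ->
  \int[mu01]_t (a * f t + g t) = a * \int[mu01]_t f t + \int[mu01]_t g t.
Proof.
move=> hf hg; rewrite RintegralD //; last first.
  exact: (integrableZl measurableT a hf).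
by rewrite RintegralZl.
Qed.

Lemma complexEta (z : C) : z = Complex (complex.Re z) (complex.Im z).
Proof. by case: z. Qed.

Lemma ReZD (a x y : C) : complex.Re (a * x + y) =
  complex.Re a * complex.Re x + (- complex.Im a * complex.Im x + complex.Re y).
Proof. by case: a x y => [a1 a2] [x1 x2] [y1 y2] /=; rewrite mulNr addrA. Qed.

Lemma ImZD (a x y : C) : complex.Im (a * x + y) =
  complex.Re a * complex.Im x + (complex.Im a * complex.Re x + complex.Im y).
Proof. by case: a x y => [a1 a2] [x1 x2] [y1 y2] /=; rewrite addrA. Qed.

Lemma cintegrableZD a h k : cintegrable h -> cintegrable k ->
  cintegrable (fun x => a * h x + k x).
Proof.
move=> [h1 h2] [k1 k2]; split.
- have := integrableZDR (complex.Re a) h1 (integrableZDR (- complex.Im a) h2 k1).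
  by under [X in _.-integrable _ (EFin \o X) -> _]eq_fun => t do rewrite -ReZD.
- have := integrableZDR (complex.Re a) h2 (integrableZDR (complex.Im a) h1 k2).
  by under [X in _.-integrable _ (EFin \o X) -> _]eq_fun => t do rewrite -ImZD.
Qed.

Lemma cintZD a h k : cintegrable h -> cintegrable k ->
  cint (fun x => a * h x + k x) = a * cint h + cint k.
Proof.
move=> [h1 h2] [k1 k2]; rewrite /cint.
under [X in Complex X _]eq_Rintegral => t _ do rewrite ReZD.
under [X in Complex _ X]eq_Rintegral => t _ do rewrite ImZD.
rewrite !RintegralZD //; try exact: integrableZDR.
by rewrite [RHS](complexEta) ReZD ImZD.
Qed.

Lemma cint_conj h : cintegrable h ->
  cint (fun x => (h x)^*%R) = (cint h)^*%R.
Proof.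
move=> [h1 h2]; rewrite /cint.
have reC (z : C) : complex.Re (z^*%R) = complex.Re z by case: z.
have imC (z : C) : complex.Im (z^*%R) = -1 * complex.Im z by case: z => z1 z2; rewrite mulN1r.
under [X in Complex X _]eq_Rintegral => t _ do rewrite reC.
under [X in Complex _ X]eq_Rintegral => t _ do rewrite imC.
by rewrite RintegralZl // mulN1r.
Qed.

Lemma cint_ae h k : cintegrable h -> cintegrable k ->
  {ae mu01, forall t, h (angle t) = k (angle t)} -> cint h = cint k.
Proof.
move=> [h1 h2] [k1 k2] hk; rewrite /cint.
have FF := ae_filter_ringOfSetsType mu01.
congr Complex; rewrite /Rintegral; congr fine; apply: ae_eq_integral => //=.
- exact: (measurable_int _ h1).
- exact: (measurable_int _ k1).
- by apply: filterS hk => t /= ->.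
- exact: (measurable_int _ h2).
- exact: (measurable_int _ k2).
- by apply: filterS hk => t /= ->.
Qed.

Lemma cintegrable_mul f g : sqint_sub f -> sqint_sub g ->
  cintegrable (fun x => f x * (g x)^*%R).
Proof.
move=> [f1 f2] [g1 g2].
have := Lfun2_mul_Lfun1 f1 g1; have := Lfun2_mul_Lfun1 f2 g2.
have := Lfun2_mul_Lfun1 f2 g1; have := Lfun2_mul_Lfun1 f1 g2.
move=> /Lfun1_integrable f1g2 /Lfun1_integrable f2g1 /Lfun1_integrable f2g2 /Lfun1_integrable f1g1.
split.
- have := integrableZDR 1 f1g1 f2g2; apply: eq_ind; congr (_ \o _).
  by apply/funext => t /=; rewrite mul1r; case: (f _) (g _) => [a b] [c d]; rewrite /= mulrN opprK.
- have := integrableZDR (-1) f1g2 f2g1; apply: eq_ind; congr (_ \o _).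
  by apply/funext => t /=; rewrite mulN1r; case: (f _) (g _) => [a b] [c d]; rewrite /= mulrN.
Qed.

Lemma qrep_ae (f : circle -> C) (sf : sqint_sub f) :
  {ae mu01, forall t, qrep (qclass null_sub sf) (angle t) = f (angle t)}.
Proof.
have FF := ae_filter_ringOfSetsType mu01.
have := qrep_class null_sub sf; apply: filterS => t.
by move=> /eqP; rewrite -[X in X == _]/(qrep _ _ - f _) subr_eq0 => /eqP.
Qed.

Lemma L2dotE f g (sf : sqint_sub f) (sg : sqint_sub g) :
  L2dot (qclass null_sub sf) (qclass null_sub sg) = cint (fun x => f x * (g x)^*%R).
Proof.
have FF := ae_filter_ringOfSetsType mu01.
apply: cint_ae; try by apply: cintegrable_mul => //; exact: qrepP.
by apply: filterS2 (qrep_ae sf) (qrep_ae sg) => t /= -> ->.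
Qed.

Lemma L2dotZDl a f g h : L2dot (a *: f + g) h = a * L2dot f h + L2dot g h.
Proof.
rewrite -{1}(qrepK f) -{1}(qrepK g) -{1}(qrepK h).
rewrite -(qclassZD _ _ _ (linsubZD a (qrepP f) (qrepP g))) L2dotE.
rewrite /L2dot -cintZD; try by apply: cintegrable_mul; exact: qrepP.
by congr cint; apply/funext => x; rewrite mulrA -mulrDl.
Qed.

Lemma L2dotC f g : L2dot f g = (L2dot g f)^*%R.
Proof.
rewrite /L2dot -cint_conj; last by apply: cintegrable_mul; exact: qrepP.
by congr cint; apply/funext => x; rewrite rmorphM /= conjCK mulrC.
Qed.

Lemma L2dotZDr a f g h : L2dot h (a *: f + g) = a^*%R * L2dot h f + L2dot h g.
Proof. by rewrite L2dotC L2dotZDl rmorphD rmorphM /= -!L2dotC. Qed.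

End Circle.

Section SpecialUnitary.
Variable C : numClosedFieldType.

Definition SU2_set : set 'M[C]_2 := [set g | g \is unitarymx /\ \det g = 1].
Definition SU2 : Type := SU2_set.

Definition adj (g : 'M[C]_2) : 'M[C]_2 := map_mx Num.conj g^T.

Lemma unitary_adjr (g : 'M[C]_2) : g \is unitarymx -> g *m adj g = 1%:M.
Proof. by move/unitarymxP. Qed.

Lemma unitary_adjl (g : 'M[C]_2) : g \is unitarymx -> adj g *m g = 1%:M.
Proof. by move=> /unitary_adjr /mulmx1C. Qed.

Lemma adj_unitary (g : 'M[C]_2) : g \is unitarymx -> adj g \is unitarymx.
Proof. by rewrite trmxC_unitary. Qed.

Lemma SU2_unitary (g : SU2) : val g \is unitarymx.
Proof. by have /= := set_valP g => -[]. Qed.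

End SpecialUnitary.

(* V (x) C^2 is encoded as the space of pairs of elements of V. *)
Section TensorC2.
Variables (C : numFieldType) (V : lmodType C).
Local Notation K := {ffun 'I_2 -> V}.

Definition tens (f : V) (v : 'cV[C]_2) : K := [ffun i => v i 0 *: f].

Definition comp_op (phi : V -> V) (f : K) : K := [ffun i => phi (f i)].

Definition mx_op (g : 'M[C]_2) (f : K) : K := [ffun i => \sum_j g i j *: f j].

Lemma comp_op_linear phi : linear_op phi -> linear_op (comp_op phi).
Proof. by move=> l a f g; apply/ffunP => i; rewrite !ffunE l. Qed.

Lemma mx_op_linear g : linear_op (mx_op g).
Proof.
move=> a u v; apply/ffunP => i; rewrite !ffunE scaler_sumr -big_split /=.
by apply: eq_bigr => j _; rewrite !ffunE scalerDr !scalerA (mulrC a).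
Qed.

Lemma mx_op_mul g h f : mx_op g (mx_op h f) = mx_op (g *m h) f.
Proof.
apply/ffunP => i; rewrite !ffunE.
under eq_bigr => j _ do rewrite ffunE scaler_sumr.
rewrite exchange_big /=; apply: eq_bigr => k _; rewrite mxE scaler_suml.
by apply: eq_bigr => j _; rewrite scalerA.
Qed.

Lemma mx_op1 f : mx_op 1%:M f = f.
Proof.
apply/ffunP => i; rewrite !ffunE (bigD1 i) //= mxE eqxx scale1r big1 ?addr0 //.
by move=> j ji; rewrite mxE eq_sym (negbTE ji) scale0r.
Qed.

Lemma mx_op_comp g phi f : linear_op phi ->
  mx_op g (comp_op phi f) = comp_op phi (mx_op g f).
Proof.
move=> lphi; apply/ffunP => i; rewrite !ffunE (linear_op_sum _ _ lphi).
by apply: eq_bigr => j _; rewrite ffunE.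
Qed.

Lemma mx_op_tens g p v : mx_op g (tens p v) = tens p (g *m v).
Proof.
apply/ffunP => i; rewrite !ffunE mxE scaler_suml.
by apply: eq_bigr => j _; rewrite ffunE scalerA.
Qed.

End TensorC2.

Section HermitianForm.
Variables (C : numClosedFieldType) (V : lmodType C) (b : V -> V -> C).
Local Notation K := {ffun 'I_2 -> V}.

Definition form2 (f g : K) : C := \sum_i b (f i) (g i).

Hypothesis bl : forall a u v w, b (a *: u + v) w = a * b u w + b v w.
Hypothesis bC : forall u v, b u v = (b v u)^*.

Lemma form_suml (c : 'I_2 -> C) (u : 'I_2 -> V) w :
  b (\sum_j c j *: u j) w = \sum_j c j * b (u j) w.
Proof.
have lw : linear_op (fun u : V => b u w : C^o) by move=> a p q; exact: bl.
by rewrite (linear_op_sum c u lw).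
Qed.

Lemma form_sumr (c : 'I_2 -> C) (u : 'I_2 -> V) w :
  b w (\sum_j c j *: u j) = \sum_j (c j)^* * b w (u j).
Proof.
rewrite bC form_suml rmorph_sum; apply: eq_bigr => j _.
by rewrite rmorphM /= -bC.
Qed.

Lemma form2_unitary (g : 'M[C]_2) (f h : K) : g \is unitarymx ->
  form2 (mx_op g f) (mx_op g h) = form2 f h.
Proof.
move=> Ug; rewrite /form2.
have gg k j : \sum_i g i j * (g i k)^* = (k == j)%:R.
  have := congr1 (fun A : 'M[C]_2 => A k j) (unitary_adjl Ug); rewrite !mxE => <-.
  by apply: eq_bigr => i _; rewrite !mxE mulrC.
transitivity (\sum_i \sum_j \sum_k g i j * (g i k)^* * b (f j) (h k)).
  apply: eq_bigr => i _; rewrite !ffunE form_suml; apply: eq_bigr => j _.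
  by rewrite form_sumr mulr_sumr; apply: eq_bigr => k _; rewrite mulrA.
rewrite exchange_big /=; apply: eq_bigr => j _.
rewrite exchange_big /= (bigD1 j) //= -mulr_suml gg eqxx mul1r big1 ?addr0 // => k /negbTE kj.
by rewrite -mulr_suml gg kj mul0r.
Qed.

End HermitianForm.

Section LoopSpace.
Variable R : realType.
Local Notation C := R[i].
Local Notation L2 := (L2 R).
Local Notation K := {ffun 'I_2 -> L2}.

Definition zK (m : int) : K -> K := comp_op (zL2 m).

Lemma zK_linear m : linear_op (zK m).
Proof. exact: comp_op_linear (zL2_linear m). Qed.

Definition Kdot : K -> K -> C := form2 (@L2dot R).

Definition Knorm (f : K) : R := Num.sqrt (complex.Re (Kdot f f)).

Definition Kclosed (W : set K) : Prop :=
  forall f, (forall e : R, 0 < e -> exists2 g, W g & Knorm (f - g) < e) -> W f.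

Definition closed_span_set (S : set K) : set K :=
  [set f | forall W : linsub K, Kclosed W -> S `<=` W -> W f].

Lemma closed_span_linear S : linear_set (closed_span_set S).
Proof.
split=> [W _ _|a f g Sf Sg W cW SW]; first exact: linsub0.
by apply: linsubZD; [apply: Sf | apply: Sg].
Qed.

Definition closed_span (S : set K) : linsub K := LinSub (closed_span_linear S).

Definition Kplus : linsub K :=
  closed_span [set f | exists (k : nat) (v : 'cV[C]_2), f = tens (zpow R k) v].

Definition zKplus (m : int) : linsub K := linsub_image (zK_linear m) Kplus.

(* g is the orthogonal projection of f on M; as a relation, this needs no
   existence proof. *)
Definition orth_proj (M : set K) (f g : K) : Prop :=
  M g /\ forall h, M h -> Kdot (f - g) h = 0.

Definition proj_ker (W : set K) : set K := [set f | W f /\ orth_proj Kplus f 0].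
Definition proj_im (W : set K) : set K := [set g | exists2 f, W f & orth_proj Kplus f g].

Definition has_index (W : set K) (i : int) : Prop :=
  exists m n : nat, [/\ has_dim (proj_ker W) m, has_codim (proj_im W) Kplus n &
                        i = m%:Z - n%:Z].

(* F_set r, F r are the space written F_{2r} in the literature. *)
Definition F_set (r : nat) : set (linsub K) :=
  [set W | [/\ Kclosed W, zK 1 @` W `<=` W, zKplus r `<=` W,
               W `<=` zKplus (- r%:Z) & has_index W 0]].

Definition F_quot (r : nat) : lmodType C := quotmod (zKplus (- r%:Z)) (zKplus r).

Definition F_to_grass (r : nat) (W : F_set r) : grass (F_quot r) :=
  quot_sub (zKplus (- r%:Z)) (zKplus r) (set_val W).

Definition F (r : nat) : Type := initial_topology (@F_to_grass r).
HB.instance Definition _ r := Topological.on (F r).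

Definition gK (g : 'M[C]_2) : K -> K := mx_op g.

Lemma gK_linear g : linear_op (gK g).
Proof. exact: mx_op_linear. Qed.

Lemma gK_mul g h f : gK g (gK h f) = gK (g *m h) f.
Proof. exact: mx_op_mul. Qed.

Lemma gK1 f : gK 1%:M f = f.
Proof. exact: mx_op1. Qed.

Lemma gK_zK g m f : gK g (zK m f) = zK m (gK g f).
Proof. exact: mx_op_comp (zL2_linear m). Qed.

Lemma gK_tens g p v : gK g (tens p v) = tens p (g *m v).
Proof. exact: mx_op_tens. Qed.

Lemma gKB g u v : gK g (u - v) = gK g u - gK g v.
Proof. exact: linear_opB (gK_linear g). Qed.

Lemma gK0 g : gK g 0 = 0.
Proof. exact: linear_op0 (gK_linear g). Qed.

Lemma gK_sum g n (c : 'I_n -> C) (w : 'I_n -> K) :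
  gK g (\sum_i c i *: w i) = \sum_i c i *: gK g (w i).
Proof. exact: linear_op_sum (gK_linear g). Qed.

Section Unitary.
Variable g : 'M[C]_2.
Hypothesis Ug : g \is unitarymx.

Lemma gKK : cancel (gK g) (gK (adj g)).
Proof. by move=> f; rewrite gK_mul unitary_adjl // gK1. Qed.
Lemma gKVK : cancel (gK (adj g)) (gK g).
Proof. by move=> f; rewrite gK_mul unitary_adjr // gK1. Qed.

Lemma Kdot_gK f h : Kdot (gK g f) (gK g h) = Kdot f h.
Proof. exact: (@form2_unitary _ _ _ (@L2dotZDl R) (@L2dotC R) g f h Ug). Qed.

Lemma Knorm_gK f : Knorm (gK g f) = Knorm f.
Proof. by rewrite /Knorm Kdot_gK. Qed.

End Unitary.

Definition gsub (g : 'M[C]_2) : linsub K -> linsub K := linsub_image (gK_linear g).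

Lemma gsub_mem g (W : linsub K) f : g \is unitarymx -> gsub g W f <-> W (gK (adj g) f).
Proof.
move=> Ug; split=> [[h Wh <-]|Wf]; first by rewrite gKK.
by exists (gK (adj g) f) => //; rewrite gKVK.
Qed.

Lemma adjK (g : 'M[C]_2) : adj (adj g) = g.
Proof. by apply/matrixP => i j; rewrite !mxE conjCK. Qed.

Lemma gsub_closed g (W : linsub K) : g \is unitarymx -> Kclosed W -> Kclosed (gsub g W).
Proof.
move=> Ug cW f cf; apply/(gsub_mem _ _ Ug); apply: cW => e /cf [h /(gsub_mem _ _ Ug) Wh fh].
exists (gK (adj g) h); first exact: Wh.
by rewrite -(gKB (adj g) f h) (Knorm_gK (adj_unitary Ug)).
Qed.

Lemma gKplus1 g f : g \is unitarymx -> Kplus f -> Kplus (gK g f).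
Proof.
move=> Ug Kf W cW SW.
suff : gsub (adj g) W f by move/(gsub_mem _ _ (adj_unitary Ug)); rewrite adjK.
apply: Kf; first exact: gsub_closed (adj_unitary Ug) cW.
move=> _ [k [v ->]]; apply/gsub_mem; first exact: adj_unitary.
by rewrite adjK gK_tens; apply: SW; exists k, (g *m v).
Qed.

Lemma gKplus g f : g \is unitarymx -> Kplus (gK g f) <-> Kplus f.
Proof.
move=> Ug; split; last exact: gKplus1.
by move/(gKplus1 (adj_unitary Ug)); rewrite gKK.
Qed.

Lemma gzKplus m g f : g \is unitarymx -> zKplus m f -> zKplus m (gK g f).
Proof.
move=> Ug [h Kh <-]; exists (gK g h); first exact/gKplus.
by rewrite gK_zK.
Qed.

Lemma gorth_proj g f h : g \is unitarymx ->
  orth_proj Kplus f h -> orth_proj Kplus (gK g f) (gK g h).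
Proof.
move=> Ug [Kh fh]; split; first exact/gKplus.
move=> k Kk; rewrite -(gKVK Ug k) -(gKB g f h) (Kdot_gK Ug).
by apply: fh; apply/(gKplus _ Ug); rewrite gKVK.
Qed.

Lemma has_codim_image (g : 'M[C]_2) (X Y X' Y' : set K) n : g \is unitarymx ->
  (forall f, X f <-> X' (gK g f)) -> (forall f, Y f <-> Y' (gK g f)) ->
  has_codim X Y n -> has_codim X' Y' n.
Proof.
move=> Ug XX' YY' [w [wY wi ws]]; exists (fun i => gK g (w i)); split.
- by move=> i; apply/YY'.
- by move=> c; rewrite -(gK_sum g c w) => /XX'; exact: wi.
- move=> y; rewrite -(gKVK Ug y) => /YY' /ws [c Xc]; exists c.
  by rewrite -(gK_sum g c w) -(gKB g (gK (adj g) y)); apply/XX'.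
Qed.

Lemma gsub_F r (g : 'M[C]_2) (W : linsub K) : g \is unitarymx ->
  F_set r W -> F_set r (gsub g W).
Proof.
move=> Ug [cW zW rW Wr [m [n [dker dim mn]]]].
have Wg f : gsub g W (gK g f) <-> W f by rewrite gsub_mem // gKK.
have Ug' := adj_unitary Ug.
have orthg f h : orth_proj Kplus (gK g f) (gK g h) <-> orth_proj Kplus f h.
  split; last exact: (@gorth_proj g f h Ug).
  move=> o; have := @gorth_proj (adj g) (gK g f) (gK g h) Ug' o.
  rewrite (gKK Ug f).
  rewrite (gKK Ug h).
  exact.
split.
- exact: (gsub_closed Ug cW).
- move=> _ [_ [f Wf <-] <-]; exists (zK 1 f); first by apply: zW; exists f.
  exact: gK_zK.
- move=> f Kf; apply/(gsub_mem W f Ug); apply: rW.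
  exact: (@gzKplus r (adj g) f Ug' Kf).
- by move=> _ [f Wf <-]; exact: (@gzKplus _ g f Ug (Wr f Wf)).
exists m, n; split=> //.
- apply: (has_codim_image Ug _ _ dker) => f.
    split=> [/= ->|/= gf0]; first exact: gK0.
    by rewrite -(gKK Ug f) gf0 gK0.
  have := orthg f 0; rewrite (gK0 g) => o0.
  by split=> -[Wf of0]; split; [apply/Wg | apply/o0 | apply/Wg | apply/o0].
- apply: (has_codim_image Ug _ _ dim) => f; last exact: (iff_sym (gKplus f Ug)).
  split=> [[h Wh oh]|[h Wh oh]].
    by exists (gK g h); [exact/Wg | exact/orthg].
  exists (gK (adj g) h); first exact/(gsub_mem W h Ug).
  by apply/orthg; rewrite (gKVK Ug h).
Qed.

Definition actF r (g : SU2 C) (W : F r) : F r :=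
  exist _ (gsub (val g) (val W))
    (mem_set (gsub_F (SU2_unitary g) (set_valP W))).

End LoopSpace.

Definition homeomorphism (S T : topologicalType) (h : S -> T) : Prop :=
  continuous h /\ exists k : T -> S, [/\ cancel h k, cancel k h & continuous k].

(* T / A; for empty A no base point is added. *)
Section Collapse.
Local Open Scope quotient_scope.
Variables (T : topologicalType) (A : set T).

Definition collapse_rel (x y : T) : bool := (x == y) || ((x \in A) && (y \in A)).

Lemma collapse_rel_refl : reflexive collapse_rel.
Proof. by move=> x; rewrite /collapse_rel eqxx. Qed.
Lemma collapse_rel_sym : symmetric collapse_rel.
Proof. by move=> x y; rewrite /collapse_rel eq_sym andbC. Qed.
Lemma collapse_rel_trans : transitive collapse_rel.
Proof.
move=> y x z /orP[/eqP ->//|/andP[xA yA]] /orP[/eqP <-|/andP[_ zA]].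
  by rewrite /collapse_rel xA yA orbT.
by rewrite /collapse_rel xA zA orbT.
Qed.

Canonical collapse_equiv :=
  EquivRel collapse_rel collapse_rel_refl collapse_rel_sym collapse_rel_trans.

Definition collapse : Type := quotient_topology {eq_quot collapse_rel}.
HB.instance Definition _ := Topological.on collapse.

Definition collapse_pi (x : T) : collapse := \pi_{eq_quot collapse_rel} x.

(* The map induced by a map f such that f @` A `<=` A *)
Definition collapse_map (f : T -> T) (q : collapse) : collapse :=
  collapse_pi (f (repr (q : {eq_quot collapse_rel}))).
End Collapse.

(* The Thom space D / S of a vector bundle with total space E, where q is the
   square of a fibrewise norm *)
Section Thom.
Variables (C : numFieldType) (E : topologicalType) (q : E -> C).

Definition disc : Type := [set x : E | q x <= 1].
HB.instance Definition _ := Topological.on disc.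

Definition sphere : set disc := [set x | q (val x) = 1].

Definition thom : Type := collapse sphere.
HB.instance Definition _ := Topological.on thom.

Lemma disc_map_subproof (f : E -> E) (qf : forall x, q (f x) = q x) (x : disc) :
  f (val x) \in [set x : E | q x <= 1].
Proof. by apply: mem_set => /=; rewrite qf; exact: set_valP x. Qed.

Definition disc_map (f : E -> E) (qf : forall x, q (f x) = q x) (x : disc) : disc :=
  exist _ (f (val x)) (disc_map_subproof qf x).

Definition thom_map (f : E -> E) (qf : forall x, q (f x) = q x) : thom -> thom :=
  collapse_map (disc_map qf).
End Thom.

Section Tau.
Local Open Scope quotient_scope.
Variable C : numClosedFieldType.

Definition hdot (u v : 'cV[C]_2) : C := \sum_i u i 0 * (v i 0)^*.

Lemma hdotE u v : hdot u v = (u^T *m map_mx Num.conj v) 0 0.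
Proof. by rewrite mxE; apply: eq_bigr => i _; rewrite !mxE. Qed.

Lemma hdotZ (z w : C) u v : hdot (z *: u) (w *: v) = z * w^* * hdot u v.
Proof.
rewrite /hdot mulr_sumr; apply: eq_bigr => i _.
by rewrite !mxE rmorphM mulrACA.
Qed.

Lemma hdot_phase (z : C) u v : `|z| = 1 -> hdot (z *: u) (z *: v) = hdot u v.
Proof. by move=> z1; rewrite hdotZ -normCK z1 expr1n mul1r. Qed.

Lemma hdot_unitary (g : 'M[C]_2) u v : g \is unitarymx ->
  hdot (g *m u) (g *m v) = hdot u v.
Proof.
move=> Ug; rewrite !hdotE map_mxM trmx_mul -mulmxA (mulmxA g^T).
have -> : g^T *m map_mx Num.conj g = 1%:M.
  have := unitary_adjl Ug => /(congr1 (@trmx _ _ _)).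
  by rewrite trmx_mul trmx1 /adj map_trmx trmxK.
by rewrite mul1mx.
Qed.

Definition S3_set : set 'cV[C]_2 := [set u | hdot u u = 1].
Definition S3 : Type := S3_set.
HB.instance Definition _ := Topological.on S3.

Definition tau_pair_set : set ('cV[C]_2 * 'cV[C]_2) :=
  [set p | hdot p.1 p.1 = 1 /\ hdot p.2 p.1 = 0].
Definition tau_pair : Type := tau_pair_set.
HB.instance Definition _ := Topological.on tau_pair.

Definition phase_rel (u v : S3) : bool :=
  `[< exists2 z : C, `|z| = 1 & val v = z *: val u >].

Definition tau_rel (p q : tau_pair) : bool :=
  `[< exists2 z : C, `|z| = 1 & val q = (z *: (val p).1, z *: (val p).2) >].

Lemma phase_neq0 (z : C) : `|z| = 1 -> z != 0.
Proof. by move=> z1; rewrite -normr_gt0 z1. Qed.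

Lemma phase_rel_refl : reflexive phase_rel.
Proof. by move=> u; apply/asboolP; exists 1; rewrite ?normr1 ?scale1r. Qed.
Lemma phase_rel_sym : symmetric phase_rel.
Proof.
have H u v : phase_rel u v -> phase_rel v u.
  move=> /asboolP[z z1 e]; apply/asboolP; exists z^-1; first by rewrite normfV z1 invr1.
  by rewrite e scalerA mulVf ?phase_neq0 // scale1r.
by move=> u v; apply/idP/idP; exact: H.
Qed.
Lemma phase_rel_trans : transitive phase_rel.
Proof.
move=> v u w /asboolP[z z1 e1] /asboolP[y y1 e2]; apply/asboolP.
by exists (y * z); rewrite ?normrM ?z1 ?y1 ?mulr1 // e2 e1 scalerA.
Qed.
Canonical phase_equiv := EquivRel phase_rel phase_rel_refl phase_rel_sym phase_rel_trans.

Lemma tau_rel_refl : reflexive tau_rel.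
Proof.
by move=> p; apply/asboolP; exists 1; rewrite ?normr1 ?scale1r -?surjective_pairing.
Qed.
Lemma tau_rel_sym : symmetric tau_rel.
Proof.
have H u v : tau_rel u v -> tau_rel v u.
  move=> /asboolP[z z1 e]; apply/asboolP; exists z^-1; first by rewrite normfV z1 invr1.
  by rewrite e /= !scalerA mulVf ?phase_neq0 // !scale1r -surjective_pairing.
by move=> u v; apply/idP/idP; exact: H.
Qed.
Lemma tau_rel_trans : transitive tau_rel.
Proof.
move=> v u w /asboolP[z z1 e1] /asboolP[y y1 e2]; apply/asboolP.
by exists (y * z); rewrite ?normrM ?z1 ?y1 ?mulr1 // e2 e1 /= !scalerA.
Qed.
Canonical tau_equiv := EquivRel tau_rel tau_rel_refl tau_rel_sym tau_rel_trans.

Definition P1 : Type := quotient_topology {eq_quot phase_rel}.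
HB.instance Definition _ := Topological.on P1.

Definition tau : Type := quotient_topology {eq_quot tau_rel}.
HB.instance Definition _ := Topological.on tau.

Definition P1_pi (u : S3) : P1 := \pi_{eq_quot phase_rel} u.
Definition tau_pi (p : tau_pair) : tau := \pi_{eq_quot tau_rel} p.
Definition tau_repr (e : tau) : tau_pair := repr (e : {eq_quot tau_rel}).

Lemma P1_piP u v : P1_pi u = P1_pi v <-> phase_rel u v.
Proof. by split=> [/eqmodP | H]; last exact/eqmodP. Qed.
Lemma tau_piP p q : tau_pi p = tau_pi q <-> tau_rel p q.
Proof. by split=> [/eqmodP | H]; last exact/eqmodP. Qed.
Lemma tau_reprK e : tau_pi (tau_repr e) = e.
Proof. exact: (@reprK _ {eq_quot tau_rel} e). Qed.

Lemma base_subproof (p : tau_pair) : (val p).1 \in S3_set.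
Proof. by apply: mem_set; have [] := set_valP p. Qed.
Definition base (p : tau_pair) : S3 := exist _ (val p).1 (base_subproof p).

Definition tau_proj (e : tau) : P1 := P1_pi (base (tau_repr e)).

Lemma tau_projE p : tau_proj (tau_pi p) = P1_pi (base p).
Proof.
apply/P1_piP; have /tau_piP/asboolP[z z1 e] := tau_reprK (tau_pi p).
by apply/asboolP; exists z; rewrite //= e.
Qed.

(* The metric on tau is the one induced by C^2. *)
Definition tau_normsq (e : tau) : C := hdot (val (tau_repr e)).2 (val (tau_repr e)).2.

Lemma tau_normsqE p : tau_normsq (tau_pi p) = hdot (val p).2 (val p).2.
Proof.
rewrite /tau_normsq; have /tau_piP/asboolP[z z1 e] := tau_reprK (tau_pi p).
by rewrite e /= hdot_phase.
Qed.

(* The Whitney sum is the fibre product over P^1; the base point component only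
   matters for n = 0. *)
Definition tau_sum_set (n : nat) : set (P1 * prod_topology (fun _ : 'I_n => tau)) :=
  [set x | forall i, tau_proj (x.2 i) = x.1].
Definition tau_sum (n : nat) : Type := @tau_sum_set n.
HB.instance Definition _ n := Topological.on (tau_sum n).

Definition tau_sum_normsq n (x : tau_sum n) : C := \sum_i tau_normsq ((val x).2 i).

Definition thom_tau (n : nat) : Type := thom (@tau_sum_normsq n).
HB.instance Definition _ n := Topological.on (thom_tau n).

Section Action.
Variable g : SU2 C.
Let Ug := SU2_unitary g.

Lemma actS3_subproof (u : S3) : val g *m val u \in S3_set.
Proof. by apply: mem_set; rewrite /S3_set /= hdot_unitary //; exact: set_valP u. Qed.
Definition actS3 (u : S3) : S3 := exist _ (val g *m val u) (actS3_subproof u).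

Lemma act_pair_subproof (p : tau_pair) : (val g *m (val p).1, val g *m (val p).2) \in tau_pair_set.
Proof. by apply: mem_set; rewrite /tau_pair_set /= !hdot_unitary //; exact: set_valP p. Qed.
Definition act_pair (p : tau_pair) : tau_pair :=
  exist _ (val g *m (val p).1, val g *m (val p).2) (act_pair_subproof p).

Definition actP1 (b : P1) : P1 := P1_pi (actS3 (repr (b : {eq_quot phase_rel}))).

Definition act_tau (e : tau) : tau := tau_pi (act_pair (tau_repr e)).

Lemma actP1E u : actP1 (P1_pi u) = P1_pi (actS3 u).
Proof.
apply/P1_piP; have /P1_piP/asboolP[z z1 e] : P1_pi (repr (P1_pi u : {eq_quot phase_rel})) = P1_pi u.
  exact: (@reprK _ {eq_quot phase_rel}).
by apply/asboolP; exists z; rewrite //= e scalemxAr.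
Qed.

Lemma act_tauE p : act_tau (tau_pi p) = tau_pi (act_pair p).
Proof.
apply/tau_piP; have /tau_piP/asboolP[z z1 e] := tau_reprK (tau_pi p).
by apply/asboolP; exists z; rewrite //= e /= !scalemxAr.
Qed.

Lemma tau_proj_act e : tau_proj (act_tau e) = actP1 (tau_proj e).
Proof.
rewrite -(tau_reprK e) act_tauE !tau_projE actP1E; congr P1_pi.
exact: val_inj.
Qed.

Lemma tau_normsq_act e : tau_normsq (act_tau e) = tau_normsq e.
Proof. by rewrite -(tau_reprK e) act_tauE !tau_normsqE /= hdot_unitary. Qed.

Definition act_sum_val n (x : tau_sum n) : P1 * prod_topology (fun _ : 'I_n => tau) :=
  (actP1 (val x).1, fun i => act_tau ((val x).2 i)).
Lemma act_sum_subproof n (x : tau_sum n) : act_sum_val x \in @tau_sum_set n.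
Proof.
by apply: mem_set => i /=; rewrite tau_proj_act; congr actP1; exact: (set_valP x i).
Qed.
Definition act_sum n (x : tau_sum n) : tau_sum n :=
  exist (fun y => y \in @tau_sum_set n) _ (act_sum_subproof x).

Lemma act_sum_normsq n (x : tau_sum n) : tau_sum_normsq (act_sum x) = tau_sum_normsq x.
Proof. by apply: eq_bigr => i _; exact: tau_normsq_act. Qed.

Definition act_thom n : thom_tau n -> thom_tau n := thom_map (@act_sum_normsq n).

End Action.
End Tau.

Section FQuotient.
Variable R : realType.

(* F_mod r s is F_{2r} / F_{2s}, for s <= r *)
Definition F_mod (r s : nat) : Type := collapse [set W : F R r | F_set s (val W)].
HB.instance Definition _ r s := Topological.on (F_mod r s).

Definition act_F_mod r s (g : SU2 R[i]) : F_mod r s -> F_mod r s :=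
  collapse_map (@actF R r g).
End FQuotient.

(* Main.v *)
From HB Require Import structures.
Require Import Defs.
From mathcomp Require Import all_boot all_order all_algebra.
From mathcomp Require Import all_classical all_reals all_analysis.
From mathcomp Require Import complex.
From mathcomp Require Import ring lra zify.

(** In the Fourier coefficients of z^-r K_+ / z^r K_+, a point W of F_{2r} is a
    z-stable subspace of dimension N = 2r of C^2[z]/z^N, and W lies in F_{2r-2}
    iff all its elements have zero constant coefficient.  Otherwise W is generated
    by a single element, which can be normalised to u + sum_k w_k z^k with |u| = 1
    and w_k orthogonal to u, uniquely up to a phase: a point of tau^(2r-1).

    For the topology, write s = 1 - |v|^2 on the disc bundle and match (u, v) with the
    module generated by w = s u + sum_k v_k z^k.  The relation x_0 /\ u = 0
    and x /\ w = 0 in C[z]/z^N for all x in W, between W and (u, v) is a closed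
    condition: for s <> 0 it says that W is generated by w, and for s = 0 it forces
    W to lie in F_{2r-2}.  Hence F_{2r} / F_{2r-2} and the Thom space are Hausdorff
    quotients, by the same equivalence relation, of one compact space: that of
    pairs of an orthonormal frame of W and a point (u, v) incident to W. *)

Set Implicit Arguments.
Unset Strict Implicit.
Unset Printing Implicit Defensive.

Import Order.TTheory GRing.Theory Num.Theory numFieldNormedType.Exports.

(** * Fourier modes on the circle *)

(** No inverse map is ever written down. A direct map from W to (u, v) would need a limit argument
    near F_{2r-2}, where the normalised generator is unbounded; a closed relation on a compact space
    replaces it. The price is that both quotients must be Hausdorff. This comes from continuous
    scalar functions that separate points: entries of the orthogonal projector of W on one side,
    entries of u u* and v_k u* on the other, each multiplied by a factor that vanishes on the
    collapsed set.

    The weight s keeps the generator bounded up to the sphere, and it makes the radial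
    correspondence between the open disc and the whole fibre a quadratic equation with exactly one
    positive root. Since the generator forgets u when s = 0, the condition on x_0 and u has to be
    imposed separately.

    Index 0 becomes dimension 2r by rank-nullity for the projection to K_+. The delicate half of the
    description of F_{2r-2} is that vanishing lowest coefficients force z^(r-1) K_+ into W; it
    follows by counting the dimension of the kernel of z on W. *)

Section CircleFourier.
Local Open Scope classical_set_scope.
Local Open Scope ring_scope.
Variable R : realType.
Local Notation C := R[i].
Local Notation mu01 := (mu01 R).

Lemma mulconjE (z : C) : z * z^*%R = Complex (complex.Re z ^+ 2 + complex.Im z ^+ 2) 0.
Proof. by case: z => a b; rewrite /GRing.mul /=; congr Complex; ring. Qed.

Lemma L2dot_ge0 (f : L2 R) : 0 <= L2dot f f.
Proof.
have -> : L2dot f f = cint (fun x => Complex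
    (complex.Re (qrep f x) ^+ 2 + complex.Im (qrep f x) ^+ 2) 0).
  by congr cint; apply/funext => x; rewrite mulconjE.
rewrite /cint lecE /= Rintegral_cst // mul0r eqxx /=.
by apply: Rintegral_ge0 => t _; rewrite addr_ge0 // sqr_ge0.
Qed.

Lemma L2dot_eq0 (f : L2 R) : L2dot f f = 0 -> f = 0.
Proof.
move=> f0; have sf := qrepP f.
have [i1 _] := cintegrable_mul sf sf.
pose h t := complex.Re (qrep f (angle t)) ^+ 2 + complex.Im (qrep f (angle t)) ^+ 2.
have hE : (fun t => complex.Re (qrep f (angle t) * (qrep f (angle t))^*%R)) = h.
  by apply/funext => t; rewrite mulconjE.
rewrite hE in i1.
have h_ge0 t : 0 <= h t by rewrite addr_ge0 // sqr_ge0.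
have h0 : \int[mu01]_t h t = 0.
  by rewrite -hE; exact: (congr1 (@complex.Re R) f0).
have : (\int[mu01]_t (h t)%:E = 0)%E.
  rewrite -[LHS]fineK; last exact: (integrable_fin_num measurableT i1).
  by congr EFin.
move=> ih.
(* A nonnegative integrable function with integral zero vanishes almost everywhere, and a class in
   [L2] is blind to null sets. *)
have : ae_eq mu01 setT (EFin \o h) (cst 0%E).
  apply/ae_eq_integral_abs => //; first exact: (measurable_int _ i1).
  by rewrite -[RHS]ih; apply: eq_integral => t _ /=; rewrite ger0_norm.
move=> ae0; rewrite -(qrepK f); apply: qclass_eq; rewrite subr0.
have FF := ae_filter_ringOfSetsType mu01.
apply: filterS ae0 => t /(_ I) /= [] /eqP.
rewrite paddr_eq0 ?sqr_ge0 // !sqrf_eq0 => /andP[/eqP r0 /eqP i0].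
by rewrite [LHS]complexEta r0 i0.
Qed.

Lemma circle_mulconj (x : circle R) : sval x * (sval x)^*%R = 1.
Proof. by rewrite -normCK (eqP (svalP x)) expr1n. Qed.

Lemma circle_neq0 (x : circle R) : sval x != 0.
Proof. by rewrite -normr_gt0 (eqP (svalP x)). Qed.

Lemma circle_exp_mulconj (x : circle R) (k l : int) :
  (sval x) ^ k * ((sval x) ^ l)^*%R = (sval x) ^ (k - l).
Proof.
rewrite expfzDr ?circle_neq0 //; congr (_ * _).
have := canRL (mulKf (circle_neq0 x)) (circle_mulconj x); rewrite mulr1 => conjE.
by rewrite rmorphXz ?unitfE ?circle_neq0 //= conjE exprz_inv.
Qed.

Lemma zL2E m (f : circle R -> C) (sf : sqint_sub R f) :
  zL2 m (qclass (null_sub R) sf) = qclass (null_sub R) (zfun_sqint m sf).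
Proof. exact: qmapE (zfunZD m) (@zfun_sqint _ m) (@zfun_null _ m) _ _ _. Qed.

Lemma L2dot_zL2 m (f g : L2 R) : L2dot (zL2 m f) (zL2 m g) = L2dot f g.
Proof.
rewrite -(qrepK f) -(qrepK g) !zL2E !L2dotE; congr cint; apply/funext => x.
by rewrite /zfun rmorphM mulrACA circle_exp_mulconj subrr mul1r.
Qed.

Lemma zL2D m n (f : L2 R) : zL2 m (zL2 n f) = zL2 (m + n) f.
Proof.
rewrite -(qrepK f) !zL2E; apply: qclass_congr; apply/funext => x.
by rewrite /zfun mulrA expfzDr // circle_neq0.
Qed.

Lemma zL20 (f : L2 R) : zL2 0 f = f.
Proof.
rewrite -[f in LHS]qrepK -[RHS]qrepK zL2E; apply: qclass_congr; apply/funext => x.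
by rewrite /zfun expr0z mul1r.
Qed.

Lemma zL2_zpow m k : zL2 m (zpow R k) = zpow R (m + k).
Proof. exact: zL2D. Qed.

(** [mu01] is a measure on the whole line, so the complement of the interval has to be discarded as
    negligible before the fundamental theorem of calculus can be used. *)
Lemma Rintegral_mu01 (f : R -> R) : mu01.-integrable [set: R] (EFin \o f) ->
  \int[mu01]_t f t = \int[lebesgue_measure]_(t in `[0, 1]) f t.
Proof.
move=> fi; rewrite /Rintegral; congr fine.
have mI : measurable (`[0, 1]%classic : set (measurableTypeR R)) by exact: measurable_itv.
rewrite (@negligible_integral _ _ _ mu01 setT (~` `[0, 1])) //.
- rewrite setDE setCK setTI; apply: eq_measure_integral => A mA AI.
  by rewrite /= /mrestr setIidl.
- exact: measurableC.
- by rewrite /= /mrestr setICl measure0.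
Qed.

Lemma Rintegral01_FTC (F f : R -> R) : continuous f ->
  (forall x : R, is_derive x (1 : R) F (f x)) ->
  \int[lebesgue_measure]_(t in `[0, 1]) f t = F 1 - F 0.
Proof.
move=> cf dF.
have cF : continuous F.
  by move=> x; apply/differentiable_continuous/derivable1_diffP; apply: ex_derive.
rewrite /Rintegral (@continuous_FTC2 _ f F) //.
- by apply: continuous_subspaceT.
- split=> [x _||]; first exact: ex_derive.
  + exact: cvg_at_right_filter (cF 0).
  + exact: cvg_at_left_filter (cF 1).
- by move=> x _; rewrite derive1E; apply: derive_val.
Qed.

Lemma cos2piM (m : int) : cos (2 * pi * m%:~R : R) = 1.
Proof.
have H (n : nat) : cos (2 * pi * n%:R : R) = 1.
  elim: n => [|n IH]; first by rewrite mulr0 cos0.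
  by rewrite -[n.+1%:R]natr1 mulrDr mulr1 [2 * pi]mulr_natl cosD2pi -[pi *+ 2]mulr_natl.
case: m => n; first exact: H.
by rewrite NegzE rmorphN mulrN cosN H.
Qed.

Lemma sin2piM (m : int) : sin (2 * pi * m%:~R : R) = 0.
Proof.
have H (n : nat) : sin (2 * pi * n%:R : R) = 0.
  elim: n => [|n IH]; first by rewrite mulr0 sin0.
  by rewrite -[n.+1%:R]natr1 mulrDr mulr1 [2 * pi]mulr_natl sinD2pi -[pi *+ 2]mulr_natl.
case: m => n; first exact: H.
by rewrite NegzE rmorphN mulrN sinN H oppr0.
Qed.

Lemma cint_zexp (m : int) : cint (fun x : circle R => (sval x) ^ m) = (m == 0)%:R.
Proof.
have [->|m0] := eqVneq m 0.
  rewrite /cint /= !Rintegral_cst //= mul0r mul1r.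
  by rewrite mu01_setT.
have fm := zfun_sqint m (sqint1 R).
(* Integrability of the cosine and of the sine is read off from z^m times the conjugate of 1, a
   product of two square-integrable functions. *)
have [i1 i2] := cintegrable_mul fm (sqint1 R).
pose a : R := 2 * pi * m%:~R.
have a0 : a != 0 by rewrite !mulf_neq0 ?intr_eq0 // gt_eqF // pi_gt0.
have E1 : (fun t : R => complex.Re (zfun m (fun=> 1) (angle t) * 1^*%R)) = fun t => cos (a * t).
  by apply/funext => t; rewrite conjC1 mulr1 /zfun mulr1 angle_exp.
have E2 : (fun t : R => complex.Im (zfun m (fun=> 1) (angle t) * 1^*%R)) = fun t => sin (a * t).
  by apply/funext => t; rewrite conjC1 mulr1 /zfun mulr1 angle_exp.
rewrite E1 in i1; rewrite E2 in i2.
have cat : continuous (fun t : R => a * t) by exact: mulrl_continuous.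
rewrite /cint.
under eq_Rintegral => t _ do rewrite angle_exp /= -/a.
rewrite [X in Complex _ X](_ : _ = \int[mu01]_t sin (a * t)); last first.
  by apply: eq_Rintegral => t _; rewrite angle_exp.
rewrite !Rintegral_mu01 //.
have -> : \int[lebesgue_measure]_(t in `[0, 1]) cos (a * t) =
    a^-1 * sin (a * 1) - a^-1 * sin (a * 0).
  apply: (@Rintegral01_FTC (fun t => a^-1 * sin (a * t)) (fun t => cos (a * t))) => x.
    by apply: continuous_comp (cat x) (@continuous_cos _ _).
  by apply: is_derive_eq; rewrite !scaler1 /GRing.scale /=; field; exact/a0.
have -> : \int[lebesgue_measure]_(t in `[0, 1]) sin (a * t) =
    - a^-1 * cos (a * 1) - - a^-1 * cos (a * 0).
  apply: (@Rintegral01_FTC (fun t => - a^-1 * cos (a * t)) (fun t => sin (a * t))) => x.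
    by apply: continuous_comp (cat x) (@continuous_sin _ _).
  by apply: is_derive_eq; rewrite !scaler1 /GRing.scale /=; field; exact/a0.
by rewrite !mulr1 !mulr0 sin0 cos0 sin2piM cos2piM !mulr0 !subrr.
Qed.

Lemma L2dot_zpow k l : L2dot (zpow R k) (zpow R l) = (k == l)%:R.
Proof.
rewrite /zpow !zL2E L2dotE -subr_eq0 -cint_zexp; congr cint; apply/funext => x.
by rewrite /zfun !mulr1 circle_exp_mulconj.
Qed.

End CircleFourier.

(** * The Hermitian form on K and the subspaces z^m K_+ *)

Section FourierK.
Local Open Scope classical_set_scope.
Local Open Scope ring_scope.
Variable R : realType.
Local Notation C := R[i].
Local Notation K := {ffun 'I_2 -> L2 R}.
Local Notation Kdot := (@Kdot R).
Local Notation Knorm := (@Knorm R).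

Lemma KdotZDl a (f g h : K) : Kdot (a *: f + g) h = a * Kdot f h + Kdot g h.
Proof.
rewrite /Defs.Kdot /form2 mulr_sumr -big_split /=; apply: eq_bigr => i _.
by rewrite !ffunE L2dotZDl.
Qed.

Lemma KdotC (f g : K) : Kdot f g = (Kdot g f)^*%R.
Proof. by rewrite /Defs.Kdot /form2 rmorph_sum; apply: eq_bigr => i _; exact: L2dotC. Qed.

Lemma KdotZDr a (f g h : K) : Kdot h (a *: f + g) = a^*%R * Kdot h f + Kdot h g.
Proof. by rewrite KdotC KdotZDl rmorphD rmorphM /= -!KdotC. Qed.

Lemma Kdot_linear (h : K) : linear_op (fun f => Kdot f h : C^o).
Proof. by move=> a f g; rewrite KdotZDl. Qed.

Lemma Kdot0l (h : K) : Kdot 0 h = 0.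
Proof. exact: linear_op0 (Kdot_linear h). Qed.

Lemma Kdot0r (h : K) : Kdot h 0 = 0.
Proof. by rewrite KdotC Kdot0l rmorph0. Qed.

Lemma KdotBl (f g h : K) : Kdot (f - g) h = Kdot f h - Kdot g h.
Proof. exact: linear_opB (Kdot_linear h). Qed.

Lemma KdotBr (f g h : K) : Kdot h (f - g) = Kdot h f - Kdot h g.
Proof. by rewrite KdotC KdotBl rmorphB /= -!KdotC. Qed.

Lemma KdotZl a (f h : K) : Kdot (a *: f) h = a * Kdot f h.
Proof. by rewrite -[a *: f]addr0 KdotZDl Kdot0l addr0. Qed.

Lemma KdotZr a (f h : K) : Kdot h (a *: f) = a^*%R * Kdot h f.
Proof. by rewrite -[a *: f]addr0 KdotZDr [Kdot h 0]KdotC Kdot0l rmorph0 addr0. Qed.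

Lemma Kdot_suml (I : finType) (c : I -> C) (u : I -> K) h :
  Kdot (\sum_i c i *: u i) h = \sum_i c i * Kdot (u i) h.
Proof. exact: linear_op_sum c u (Kdot_linear h). Qed.

Lemma Kdot_sumr (I : finType) (c : I -> C) (u : I -> K) h :
  Kdot h (\sum_i c i *: u i) = \sum_i (c i)^*%R * Kdot h (u i).
Proof.
rewrite KdotC Kdot_suml rmorph_sum; apply: eq_bigr => i _.
by rewrite rmorphM /= -KdotC.
Qed.

Lemma Kdot_ge0 (f : K) : 0 <= Kdot f f.
Proof. by apply: sumr_ge0 => i _; exact: L2dot_ge0. Qed.

Lemma Kdot_eq0 (f : K) : Kdot f f = 0 -> f = 0.
Proof.
move=> /eqP; rewrite psumr_eq0; last by move=> i _; exact: L2dot_ge0.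
move=> /allP f0; apply/ffunP => i; rewrite ffunE; apply: L2dot_eq0.
by apply/eqP/f0; rewrite mem_index_enum.
Qed.

Lemma ReK (z : C) : 0 <= z -> Complex (complex.Re z) 0 = z.
Proof. by case: z => a b; rewrite lecE /= => /andP[/eqP -> _]. Qed.

Lemma Re_ge0 (z : C) : 0 <= z -> 0 <= complex.Re z.
Proof. by rewrite lecE => /andP[]. Qed.

Lemma ler_Re (z w : C) : z <= w -> complex.Re z <= complex.Re w.
Proof. by rewrite lecE => /andP[]. Qed.

Lemma Knorm_sqr (f : K) : Knorm f ^+ 2 = complex.Re (Kdot f f).
Proof. by rewrite sqr_sqrtr // Re_ge0 // Kdot_ge0. Qed.

Lemma Knorm_le (f g : K) : Kdot f f <= Kdot g g -> Knorm f <= Knorm g.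
Proof. by move=> fg; rewrite ler_sqrt ?ler_Re // Re_ge0 // Kdot_ge0. Qed.

Lemma Kdot_CS (f b : K) : `|Kdot f b| ^+ 2 <= Kdot f f * Kdot b b.
Proof.
have [b0|b0] := eqVneq (Kdot b b) 0.
  by rewrite (Kdot_eq0 b0) !Kdot0r normr0 expr0n mulr0.
have bp : 0 < Kdot b b by rewrite lt_neqAle eq_sym b0 Kdot_ge0.
(* Positivity of the norm of f minus its projection on the line of b. *)
have := Kdot_ge0 (f - (Kdot f b / Kdot b b) *: b).
rewrite KdotBl !KdotBr !KdotZr !KdotZl rmorphM fmorphV /= -(KdotC b b) (KdotC b f).
have H : forall z N F : C, N != 0 ->
    F - z^*%R / N * z - (z / N * z^*%R - z^*%R / N * (z / N * N)) = F - z * z^*%R / N.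
  by move=> z N F N0; field.
by rewrite H // -normCK subr_ge0 ler_pdivrMr.
Qed.

Lemma Kclosed_perp (b : K) : Kclosed [set f | Kdot f b = 0].
Proof.
move=> f fW /=; apply/eqP/negPn/negP => fb0.
set c := complex.Re (`|Kdot f b| ^+ 2); set N := complex.Re (Kdot b b).
have cp : 0 < c.
  rewrite lt_neqAle Re_ge0 ?exprn_ge0 // andbT eq_sym; apply/eqP => c0.
  have := ReK (exprn_ge0 2 (normr_ge0 (Kdot f b))); rewrite -/c c0 => /esym/eqP.
  by rewrite expf_eq0 /= normr_eq0 (negbTE fb0).
have N0 : 0 <= N by rewrite Re_ge0 // Kdot_ge0.
have N1 : 0 < N + 1 by rewrite ltr_wpDl.
(* Here c = |<f, b>|^2 and N = |b|^2. A vector g orthogonal to b at this distance gives c <= N c /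
   (N + 1) by Cauchy-Schwarz, which is absurd; the added 1 keeps the denominator positive and the
   inequality strict. *)
have [|g /= gb fg] := fW (Num.sqrt (c / (N + 1))); first by rewrite sqrtr_gt0 divr_gt0.
have := Kdot_CS (f - g) b; rewrite KdotBl gb subr0 => /ler_Re; rewrite -/c.
rewrite -(ReK (Kdot_ge0 (f - g))) -(ReK (Kdot_ge0 b)) /= mulr0 subr0 -/N -Knorm_sqr.
apply/negP; rewrite -ltNge.
have n2 : Knorm (f - g) ^+ 2 <= c / (N + 1).
  rewrite -[leRHS]sqr_sqrtr; last by rewrite divr_ge0 ?ltW.
  by apply: lerXn2r; rewrite ?nnegrE ?sqrtr_ge0 // ltW.
apply: le_lt_trans (ler_wpM2r N0 n2) _.
by rewrite mulrAC ltr_pdivrMr // ltr_pM2l // ltrDl.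
Qed.

(** Serves for the powers of z and for [perp_part], the operators along which closed subspaces are
    pulled back. *)
Lemma Kclosed_contraction (W : set K) (T : K -> K) : linear_op T ->
  (forall f, Knorm (T f) <= Knorm f) -> Kclosed W -> Kclosed (T @^-1` W).
Proof.
move=> lT cT cW f fW; apply: (cW (T f)).
move=> e e0.
have [g Wg fg] := fW e e0.
exists (T g); first exact: Wg.
by rewrite -linear_opB //; exact: le_lt_trans (cT _) fg.
Qed.

Lemma preimage_linear (W : linsub K) (T : K -> K) : linear_op T -> linear_set (T @^-1` W).
Proof.
move=> lT; split=> [|a u v Wu Wv] /=; first by rewrite linear_op0 //; exact: linsub0.
by rewrite lT; exact: linsubZD.
Qed.

Section Bessel.
Variables (I : finType) (u : I -> K).
Hypothesis ou : forall i j, Kdot (u i) (u j) = (i == j)%:R.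

(** Orthogonal projection off the span of a finite orthonormal family, written as a finite sum so
    that no existence theorem for projections is involved. *)
Definition perp_part (f : K) : K := f - \sum_i Kdot f (u i) *: u i.

Lemma perp_part_linear : linear_op perp_part.
Proof.
move=> a f g; rewrite /perp_part scalerBr addrACA -opprD; congr (_ - _).
rewrite scaler_sumr -big_split /=; apply: eq_bigr => i _.
by rewrite KdotZDl scalerDl scalerA.
Qed.

Lemma Kdot_ortho_sum (c : I -> C) j : Kdot (\sum_i c i *: u i) (u j) = c j.
Proof.
rewrite Kdot_suml (bigD1 j) //= ou eqxx mulr1 big1 ?addr0 // => i /negbTE ij.
by rewrite ou ij mulr0.
Qed.

Lemma perp_part_ortho f j : Kdot (perp_part f) (u j) = 0.
Proof. by rewrite KdotBl Kdot_ortho_sum subrr. Qed.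

(** The squared norm drops by the sum of the |<f, u_i>|^2: Bessel's inequality. *)
Lemma Kdot_perp_part f : Kdot (perp_part f) (perp_part f) <= Kdot f f.
Proof.
rewrite [X in X <= _](_ : _ = Kdot (perp_part f) f); last first.
  rewrite KdotBr Kdot_sumr [X in _ - X]big1 ?subr0 // => i _.
  by rewrite perp_part_ortho mulr0.
rewrite KdotBl Kdot_suml gerBl; apply: sumr_ge0 => i _.
by rewrite [Kdot (u i) f]KdotC -normCK exprn_ge0.
Qed.

Lemma Knorm_perp_part f : Knorm (perp_part f) <= Knorm f.
Proof. exact: Knorm_le (Kdot_perp_part f). Qed.

End Bessel.

Definition zbasis (k : int) (i : 'I_2) : K := tens (zpow R k) (delta_mx i 0).

Lemma tens_zbasis k v : tens (zpow R k) v = \sum_i v i 0 *: zbasis k i.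
Proof.
apply/ffunP => j; rewrite ffunE sum_ffunE (bigD1 j) //= !ffunE mxE !eqxx scale1r.
rewrite big1 ?addr0 // => i /negbTE ij.
by rewrite !ffunE mxE eq_sym ij /= scale0r scaler0.
Qed.

Lemma L2dot0r (f : L2 R) : L2dot f 0 = 0.
Proof. by have := L2dotZDr (-1) 0 0 f; rewrite addr0 scaler0 rmorphN1 mulN1r addNr. Qed.

Lemma Kdot_zbasis f k i : Kdot f (zbasis k i) = L2dot (f i) (zpow R k).
Proof.
rewrite /Defs.Kdot /form2 (bigD1 i) //= ffunE mxE !eqxx scale1r big1 ?addr0 // => j /negbTE ji.
by rewrite ffunE mxE ji scale0r L2dot0r.
Qed.

Lemma zbasis_ortho k i l j : Kdot (zbasis k i) (zbasis l j) = ((k == l) && (i == j))%:R.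
Proof.
rewrite Kdot_zbasis ffunE mxE eqxx andbT [j == i]eq_sym.
case: eqP => _ /=; first by rewrite scale1r L2dot_zpow andbT.
by rewrite scale0r andbF L2dotC L2dot0r rmorph0.
Qed.

Lemma zK_tens m k v : zK m (tens (zpow R k) v) = tens (zpow R (m + k)) v.
Proof.
apply/ffunP => i; rewrite !ffunE -zL2_zpow.
by rewrite -[v i 0 *: _]addr0 zL2_linear (linear_op0 (@zL2_linear R m)) addr0.
Qed.

Lemma zK_zbasis m k i : zK m (zbasis k i) = zbasis (m + k) i.
Proof. exact: zK_tens. Qed.

Lemma Kdot_zK m (f g : K) : Kdot (zK m f) (zK m g) = Kdot f g.
Proof. by apply: eq_bigr => i _; rewrite !ffunE L2dot_zL2. Qed.

Lemma zKD m n (f : K) : zK m (zK n f) = zK (m + n) f.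
Proof. by apply/ffunP => i; rewrite !ffunE zL2D. Qed.

Lemma zK0 (f : K) : zK 0 f = f.
Proof. by apply/ffunP => i; rewrite !ffunE zL20. Qed.

Lemma zKK m : cancel (@zK R m) (zK (- m)).
Proof. by move=> f; rewrite zKD addNr zK0. Qed.

Lemma zKVK m : cancel (@zK R (- m)) (zK m).
Proof. by move=> f; rewrite zKD subrr zK0. Qed.

Lemma Knorm_zK m (f : K) : Knorm (zK m f) = Knorm f.
Proof. by rewrite /Defs.Knorm Kdot_zK. Qed.

Lemma zKplusE m (f : K) : zKplus R m f <-> Kplus R (zK (- m) f).
Proof.
split=> [[h Kh <-]|Kf]; first by rewrite zKK.
by exists (zK (- m) f) => //; rewrite zKVK.
Qed.

Lemma Kclosed_zpreim m (W : set K) : Kclosed W -> Kclosed (zK m @^-1` W).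
Proof.
apply: Kclosed_contraction; first exact: zK_linear.
by move=> f; rewrite Knorm_zK.
Qed.

Lemma Kplus_closed : Kclosed (Kplus R).
Proof. move=> f fK W cW SW; apply: (cW f) => e e0; have [g Kg fg] := fK e e0.
by exists g; first exact: Kg cW SW.
Qed.

Lemma zKplus_closed m : Kclosed (zKplus R m).
Proof. move=> f fK; apply/zKplusE; apply: (Kclosed_zpreim Kplus_closed) => e e0.
by have [g /zKplusE Kg fg] := fK e e0; exists g.
Qed.

Lemma zKplus_tens (m k : int) v : m <= k -> zKplus R m (tens (zpow R k) v).
Proof.
move=> mk; apply/zKplusE; rewrite zK_tens => W cW; apply.
by exists `|k - m|%N, v; rewrite gez0_abs ?subr_ge0 // addrC.
Qed.

Lemma zKplus_zbasis (m k : int) i : m <= k -> zKplus R m (zbasis k i).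
Proof. exact: zKplus_tens. Qed.

(** Acts as an induction principle. [Kplus] is an intersection of closed subspaces, so a property is
    proved on z^m K_+ by checking that it is closed, linear and true of the basis vectors. *)
Lemma zKplus_min m (W : linsub K) : Kclosed W ->
  (forall k i, m <= k -> W (zbasis k i)) -> zKplus R m `<=` W.
Proof.
move=> cW Wb _ [h Kh <-].
pose W' := LinSub (preimage_linear W (@zK_linear R m)).
apply: (Kh W'); first exact: Kclosed_zpreim.
move=> _ [k [v ->]] /=; rewrite zK_tens tens_zbasis.
by apply: linsub_sum => i; apply: Wb; rewrite lerDl.
Qed.

Lemma zKplus_sub (m n : int) : m <= n -> zKplus R n `<=` zKplus R m.
Proof.
move=> mn; apply: zKplus_min; first exact: zKplus_closed.
by move=> k i nk; apply: zKplus_zbasis; exact: le_trans nk.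
Qed.

Lemma perp_linear (b : K) : linear_set [set f | Kdot f b = 0].
Proof.
split=> [|a f g /= f0 g0]; first exact: Kdot0l.
by rewrite KdotZDl f0 g0 mulr0 addr0.
Qed.

Lemma zKplus_perp (m k : int) i f : zKplus R m f -> k < m -> Kdot f (zbasis k i) = 0.
Proof.
move=> fm km; pose W := LinSub (perp_linear (zbasis k i)).
apply: (@zKplus_min m W _ _ f fm); first exact: Kclosed_perp.
by move=> l j ml /=; rewrite zbasis_ortho gt_eqF //; exact: lt_le_trans ml.
Qed.

Section Split.
Variables (m : int) (d : nat).
Definition zblock (p : 'I_d * 'I_2) : K := zbasis (m + p.1%:Z) p.2.

Lemma zblock_ortho p q : Kdot (zblock p) (zblock q) = (p == q)%:R.
Proof.
rewrite zbasis_ortho (inj_eq (addrI m)) eqz_nat.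
by case: p q => [a b] [a' b'].
Qed.

(** Removing the d lowest modes is a linear contraction, so the set where the claim holds is closed
    and linear, and only basis vectors remain. This makes z^m K_+ / z^(m+d) K_+ finite-dimensional
    without any convergence of Fourier series. *)
Lemma zKplus_split f : zKplus R m f -> zKplus R (m + d%:Z) (perp_part zblock f).
Proof.
pose W := LinSub (preimage_linear (zKplus R (m + d%:Z)) (perp_part_linear zblock)).
move: f; apply: (@zKplus_min m W).
  exact: (Kclosed_contraction (perp_part_linear zblock) (Knorm_perp_part zblock_ortho)
    (@zKplus_closed _)).
move=> k i mk /=; have [kd|dk] := ltP k (m + d%:Z); last first.
  rewrite /perp_part big1 ?subr0; first exact: zKplus_zbasis.
  move=> p _; rewrite zbasis_ortho gt_eqF ?scale0r //.
  by apply: lt_le_trans dk; rewrite ltrD2l ltz_nat ltn_ord.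
have kmd : (`|k - m| < d)%N.
  by rewrite -ltz_nat gez0_abs ?subr_ge0 // ltrBlDl.
have -> : zbasis k i = zblock (Ordinal kmd, i).
  by rewrite /zblock /= gez0_abs ?subr_ge0 // subrKC.
set p := (_, _); rewrite /perp_part (bigD1 p) //= zblock_ortho eqxx scale1r.
rewrite big1 ?addr0 ?subrr; first exact: (linsub0 (zKplus R (m + d%:Z))).
by move=> q /negbTE qp; rewrite zblock_ortho eq_sym qp scale0r.
Qed.

Lemma zKplus_coefP f : zKplus R m f ->
  zKplus R (m + d%:Z) f <-> forall k : 'I_d, forall i, Kdot f (zbasis (m + k%:Z) i) = 0.
Proof.
move=> fm; split=> [fd k i|f0].
  by apply: (zKplus_perp _ fd); rewrite ltrD2l ltz_nat.
have := zKplus_split fm; rewrite /perp_part big1 ?subr0 // => p _.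
by rewrite f0 scale0r.
Qed.
End Split.

End FourierK.

(** * Submodules of C^2[z]/z^N *)

Section TruncatedModules.
Local Open Scope ring_scope.
Variables (C : fieldType) (n : nat).
Local Notation N := n.+1.

Definition zshift : 'M[C]_N := \matrix_(i, j) (i == j.+1 :> nat)%:R.

Lemma zshiftXE b i j : (zshift ^+ b) i j = (i == (j + b)%N :> nat)%:R.
Proof.
elim: b i j => [|b IH] i j; first by rewrite expr0 mxE addn0.
rewrite exprSr mxE; have [jN|jN] := ltnP j.+1 N; last first.
  rewrite big1 => [|k _].
    by rewrite ltn_eqF // (leq_trans (ltn_ord i)) // addnS -addSn (leq_trans jN) // leq_addr.
  by rewrite !mxE ltn_eqF ?mulr0 // (leq_trans (ltn_ord k)).
rewrite (bigD1 (Ordinal jN)) //= IH mxE eqxx mulr1 addSn addnS big1 ?addr0 //.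
move=> k kj; rewrite mxE; case: eqP => [e|]; last by rewrite mulr0.
by case/eqP: kj; apply: val_inj.
Qed.

(** Multiplication by the polynomial with coefficients c on C[z]/z^N: the ring is handled through
    these lower triangular Toeplitz matrices acting on coefficient columns. *)
Definition toep (c : 'cV[C]_N) : 'M[C]_N := \sum_(b < N) c b 0 *: zshift ^+ b.

Lemma toepE c i j : toep c i j = \sum_(b < N) c b 0 * (i == (j + b)%N :> nat)%:R.
Proof. by rewrite summxE; apply: eq_bigr => b _; rewrite mxE zshiftXE. Qed.

Local Notation e0 := (delta_mx 0 0 : 'cV[C]_N).

Lemma zshiftX_e0 b : zshift ^+ (b : 'I_N) *m e0 = delta_mx b 0.
Proof.
apply/matrixP => i j; rewrite -colE mxE zshiftXE mxE ord1 eqxx andbT.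
by rewrite -(inj_eq val_inj).
Qed.

Lemma toep_e0 c : toep c *m e0 = c.
Proof.
rewrite mulmx_suml [RHS]matrix_sum_delta; apply: eq_bigr => b _.
by rewrite -scalemxAl zshiftX_e0 big_ord1 -[ord0]/(0 : 'I_1).
Qed.

Lemma toep_comm_zshift c : toep c *m zshift = zshift *m toep c.
Proof.
rewrite mulmx_suml mulmx_sumr; apply: eq_bigr => b _.
rewrite -scalemxAl -scalemxAr; congr (_ *: _).
exact: etrans (esym (exprSr zshift b)) (exprS zshift b).
Qed.

Lemma comm_zshiftX (A : 'M[C]_N) b :
  A *m zshift = zshift *m A -> A *m zshift ^+ b = zshift ^+ b *m A.
Proof. exact: (@commrX _ A zshift b). Qed.

(** The constant 1, here [e0], generates C[z]/z^N as a module, so an endomorphism commuting with z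
    is known from its value there. *)
Lemma comm_zshift_eq (A B : 'M[C]_N) : A *m zshift = zshift *m A -> B *m zshift = zshift *m B ->
  A *m e0 = B *m e0 -> A = B.
Proof.
move=> cA cB AB; apply/matrixP => i j.
have H (D : 'M[C]_N) : D i j = (D *m delta_mx j 0 : 'cV_N) i 0.
  by rewrite -colE mxE.
by rewrite !H -zshiftX_e0 !mulmxA !comm_zshiftX // -!mulmxA AB.
Qed.

Lemma toep_comm c (A : 'M[C]_N) : A *m zshift = zshift *m A -> toep c *m A = A *m toep c.
Proof.
move=> As; rewrite mulmx_suml mulmx_sumr; apply: eq_bigr => b _.
by rewrite -scalemxAl -scalemxAr comm_zshiftX.
Qed.

Lemma toepC c d : toep c *m toep d = toep d *m toep c.
Proof. exact: toep_comm (toep_comm_zshift d). Qed.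

Lemma toep_mulC c d : toep c *m d = toep d *m c.
Proof. by rewrite -{1}(toep_e0 d) mulmxA toepC -mulmxA toep_e0. Qed.

Lemma toepM c d : toep (toep c *m d) = toep c *m toep d.
Proof.
apply: comm_zshift_eq; first exact: toep_comm_zshift.
  by rewrite -mulmxA toep_comm_zshift !mulmxA toep_comm_zshift.
by rewrite toep_e0 -mulmxA toep_e0.
Qed.

Lemma toepZD a c d : toep (a *: c + d) = a *: toep c + toep d.
Proof.
rewrite scaler_sumr -big_split; apply: eq_bigr => b _.
by rewrite !mxE scalerDl scalerA.
Qed.

Lemma toep0 : toep 0 = 0.
Proof. by rewrite /toep big1 // => b _; rewrite mxE scale0r. Qed.

Lemma toepZ a c : toep (a *: c) = a *: toep c.
Proof. by rewrite -[a *: c]addr0 toepZD toep0 addr0. Qed.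

Lemma toep_sum (I : finType) (a : I -> C) (c : I -> 'cV[C]_N) :
  toep (\sum_i a i *: c i) = \sum_i a i *: toep (c i).
Proof.
apply: (big_ind2 (fun x y => toep x = y)) => [|x _ y _ <- <-|i _].
- exact: toep0.
- by rewrite -[x]scale1r toepZD !scale1r.
- exact: toepZ.
Qed.

Lemma toep_e0id : toep e0 = 1%:M.
Proof. by apply: comm_zshift_eq; rewrite ?toep_comm_zshift ?mulmx1 ?mul1mx ?toep_e0. Qed.

Lemma toep_diag c i : toep c i i = c 0 0.
Proof.
rewrite toepE (bigD1 0) //= addn0 eqxx mulr1 big1 ?addr0 // => b b0.
have -> : (i == (i + b)%N :> nat) = false; last by rewrite mulr0.
by rewrite -{1}[val i]addn0 eqn_add2l eq_sym; exact: negbTE b0.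
Qed.

Lemma toep_trig c : is_trig_mx (toep c).
Proof.
apply/is_trig_mxP => i j ij; rewrite toepE big1 // => b _.
by rewrite ltn_eqF ?mulr0 // (leq_trans ij) // leq_addr.
Qed.

(** C[z]/z^N is a local ring: on the diagonal of the triangular matrix stands the constant
    coefficient. *)
Lemma toep_unit (c : 'cV[C]_N) : c 0 0 != 0 -> toep c \in unitmx.
Proof.
move=> c0; rewrite unitmxE det_trig ?toep_trig // unitfE.
by apply/prodf_neq0 => i _; rewrite toep_diag.
Qed.

Lemma toep_row0 (c : 'cV[C]_N) p (x : 'M[C]_(N, p)) j : (toep c *m x) 0 j = c 0 0 * x 0 j.
Proof.
rewrite mxE (bigD1 0) //= toep_diag big1 ?addr0 // => k k0.
by have /is_trig_mxP -> := toep_trig c; rewrite ?mul0r // lt0n.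
Qed.

(* [x] and [w] are elements of C^2[z]/z^N, one row per coefficient; [prl x w]
   says that their exterior product vanishes. *)
Definition prl (x w : 'M[C]_(N, 2)) : Prop :=
  forall i j, toep (col i w) *m col j x = toep (col j w) *m col i x.

Lemma col_mulmx p (A : 'M[C]_N) (x : 'M[C]_(N, p)) i : col i (A *m x) = A *m col i x.
Proof. by rewrite !colE mulmxA. Qed.

Lemma toep_prl c w : prl (toep c *m w) w.
Proof.
move=> i j; have H k l : toep (col k w) *m (toep c *m col l w) =
    toep c *m (toep (col k w) *m col l w) by rewrite mulmxA toepC -mulmxA.
by rewrite !col_mulmx !H [toep (col i w) *m _]toep_mulC.
Qed.

(** The component of w of index [i0] is invertible in C[z]/z^N, so c can only be the quotient of
    that component of x by it; the vanishing exterior product gives the other component. *)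
Lemma prl_toep i0 (x w : 'M[C]_(N, 2)) : w 0 i0 != 0 -> prl x w -> exists c, x = toep c *m w.
Proof.
move=> w0 xw; have Tu : toep (col i0 w) \in unitmx by apply: toep_unit; rewrite mxE.
have [c cE] : exists c, toep (col i0 w) *m c = col i0 x.
  by exists (invmx (toep (col i0 w)) *m col i0 x); rewrite mulKVmx.
exists c.
suff xE j : col j x = col j (toep c *m w).
  by apply/matrixP => k j; have := congr1 (fun (v : 'cV_N) => v k 0) (xE j); rewrite !mxE.
apply: (can_inj (mulKmx Tu)); rewrite xw -cE col_mulmx.
rewrite [toep c *m _]toep_mulC !mulmxA. by rewrite [toep (col i0 w) *m _]toepC.
Qed.

(** Submodules are row spaces of matrices whose rows are flattened elements, so z has to act from
    the right. *)
Definition zshiftV : 'M[C]_(N * 2) := lin_mulmx zshift.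

Lemma mxvec_zshift (x : 'M[C]_(N, 2)) : mxvec x *m zshiftV = mxvec (zshift *m x).
Proof. exact: mul_vec_lin. Qed.

Lemma stable_zshift p (A : 'M[C]_(p, N * 2)) x : stablemx A zshiftV ->
  (mxvec x <= A)%MS -> (mxvec (zshift *m x) <= A)%MS.
Proof.
by move=> sA xA; rewrite -mxvec_zshift; apply: submx_trans (submxMr _ xA) sA.
Qed.

Lemma stable_toep p (A : 'M[C]_(p, N * 2)) c x : stablemx A zshiftV ->
  (mxvec x <= A)%MS -> (mxvec (toep c *m x) <= A)%MS.
Proof.
move=> sA xA; rewrite mulmx_suml linear_sum /=; apply: summx_sub => b _.
rewrite -scalemxAl linearZ /=; apply: scalemx_sub.
elim: (val b) => [|k IH]; first by rewrite expr0 mul1mx.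
by rewrite exprS -mulmxA; exact: stable_zshift.
Qed.

(** Its row space is the submodule generated by w. *)
Definition cycmx (w : 'M[C]_(N, 2)) : 'M[C]_(N, N * 2) :=
  \matrix_b mxvec (zshift ^+ (b : 'I_N) *m w).

Lemma mxvec_cyc c w : mxvec (toep c *m w) = c^T *m cycmx w.
Proof.
rewrite mulmx_suml linear_sum /= mulmx_sum_row; apply: eq_bigr => b _.
by rewrite rowK mxE -scalemxAl linearZ.
Qed.

Lemma cycmxP w x : reflect (exists c, x = toep c *m w) (mxvec x <= cycmx w)%MS.
Proof.
apply: (iffP submxP) => [[D xE]|[c ->]]; last by exists c^T; rewrite mxvec_cyc.
by exists D^T; apply: (can_inj mxvecK); rewrite xE mxvec_cyc trmxK.
Qed.

Lemma cycmx_free i0 (w : 'M[C]_(N, 2)) : w 0 i0 != 0 -> row_free (cycmx w).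
Proof.
move=> w0; apply: inj_row_free => v v0.
have Tu : toep (col i0 w) \in unitmx by apply: toep_unit; rewrite mxE.
suff : v^T = 0 by move/(congr1 trmx); rewrite trmxK trmx0.
apply: (can_inj (mulKmx Tu)); rewrite mulmx0 toep_mulC -col_mulmx.
suff -> : toep v^T *m w = 0 by apply/matrixP => i j; rewrite !mxE.
by apply: (can_inj mxvecK); rewrite mxvec_cyc trmxK v0 linear0.
Qed.

Section Submodule.
Variables (p : nat) (A : 'M[C]_(p, N * 2)).

(** Being parallel to w puts the row space of A inside the cyclic module of w, and both have
    dimension N, so they coincide. *)
Lemma prl_mem i0 (w x : 'M[C]_(N, 2)) : \rank A = N -> w 0 i0 != 0 ->
  (forall x, (mxvec x <= A)%MS -> prl x w) -> (mxvec x <= A)%MS <-> prl x w.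
Proof.
move=> rA w0 Aw; split=> [|xw]; first exact: Aw.
have Ac : (A <= cycmx w)%MS.
  apply/row_subP => i; rewrite -[row i A]vec_mxK; apply/cycmxP.
  by apply: (prl_toep w0); apply: Aw; rewrite vec_mxK row_sub.
have /eqmxP AE : (A == cycmx w)%MS.
  by rewrite -mxrank_leqif_eq // rA eq_sym; exact: cycmx_free w0.
by rewrite AE; apply/cycmxP; exact: prl_toep w0 xw.
Qed.

(** The cyclic module of w is contained in the row space of A and already has its dimension N. *)
Lemma mem_prl i0 (w : 'M[C]_(N, 2)) : \rank A = N -> stablemx A zshiftV -> w 0 i0 != 0 ->
  (mxvec w <= A)%MS -> forall x, (mxvec x <= A)%MS -> prl x w.
Proof.
move=> rA sA w0 wA x xA.
have cA : (cycmx w <= A)%MS by apply/row_subP => b; rewrite rowK;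
  elim: (val b) => [|k IH]; [rewrite expr0 mul1mx | rewrite exprS -mulmxA; exact: stable_zshift].
have /eqmxP AE : (cycmx w == A)%MS.
  by rewrite -mxrank_leqif_eq // rA; exact: cycmx_free w0.
by move: xA; rewrite -AE => /cycmxP [c ->]; exact: toep_prl.
Qed.

Lemma zshiftVX b (x : 'M[C]_(N, 2)) : mxvec x *m zshiftV ^+ b = mxvec (zshift ^+ b *m x).
Proof.
elim: b x => [|b IH] x; first by rewrite !expr0 mulmx1 mul1mx.
by rewrite exprSr mulmxA IH mxvec_zshift exprS mulmxA.
Qed.

Lemma zshift_row0 (x : 'M[C]_(N, 2)) (k : 'I_n) j :
  (zshift *m x) (lift ord0 k) j = x (widen_ord (leqnSn n) k) j.
Proof.
rewrite mxE (bigD1 (widen_ord (leqnSn n) k)) //= mxE eqxx mul1r big1 ?addr0 //.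
move=> l lk; rewrite mxE /= /bump add1n; case: eqP => [[e]|]; last by rewrite mul0r.
by case/eqP: lk; apply: val_inj.
Qed.

(** An element killed by z has only a coefficient of degree N - 1, which is a vector of C^2. *)
Lemma rank_kershift : (\rank (kermx zshiftV) <= 2)%N.
Proof.
pose E : 'M[C]_(2, N * 2) := \matrix_(i < 2) mxvec (delta_mx ord_max i).
apply: leq_trans (rank_leq_row E); apply: mxrankS; apply/row_subP => r.
have : row r (kermx zshiftV) *m zshiftV = 0 by rewrite -row_mul mulmx_ker row0.
rewrite -[row r _]vec_mxK; move: (vec_mx _) => x.
rewrite mxvec_zshift => /(congr1 vec_mx); rewrite mxvecK linear0 => x0.
have -> : x = \sum_(j < 2) x ord_max j *: delta_mx ord_max j.
  apply/matrixP => k j; rewrite summxE (bigD1 j) //= !mxE eqxx andbT big1 => [|i ij]; last first.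
    by rewrite !mxE eq_sym [j == i]eq_sym (negbTE ij) andbF mulr0.
  rewrite addr0; case: (unliftP ord_max k) => [l ->|->]; last by rewrite eqxx mulr1.
  have -> : lift ord_max l = widen_ord (leqnSn n) l.
    by apply: val_inj => /=; rewrite /bump leqNgt ltn_ord.
  rewrite -zshift_row0 x0 mxE (_ : _ == _ = false) ?mulr0 //.
  by rewrite -(inj_eq val_inj) /= ltn_eqF.
rewrite linear_sum; apply: summx_sub => j _ /=; rewrite linearZ scalemx_sub //=.
by rewrite -[mxvec _](rowK (fun i => mxvec (delta_mx ord_max i) : 'rV_(N * 2))) row_sub.
Qed.

(** Let [rho] be the dimension of the kernel of z on the module. Each multiplication by z lowers the
    dimension by at most [rho], and z^(N-1) kills the module since no element has a constant
    coefficient. Hence N <= (N - 1) rho, so [rho] is at least 2 and the module contains the whole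
    kernel of z, whose dimension is at most 2. *)
Lemma top_mem x : \rank A = N -> stablemx A zshiftV ->
  (forall x, (mxvec x <= A)%MS -> row 0 x = 0) -> zshift *m x = 0 -> (mxvec x <= A)%MS.
Proof.
move=> rA sA A0 x0.
pose rho := \rank (A :&: kermx zshiftV)%MS.
have sAX k : (A *m zshiftV ^+ k <= A)%MS.
  elim: k => [|k IH]; first by rewrite expr0 mulmx1.
  by rewrite exprSr mulmxA; apply: submx_trans (submxMr _ IH) sA.
have chain k : (N <= \rank (A *m zshiftV ^+ k) + k * rho)%N.
  elim: k => [|k IH]; first by rewrite expr0 mulmx1 rA mul0n addn0.
  apply: leq_trans IH _; rewrite [(k.+1 * rho)%N]mulSn addnA leq_add2r.
  have <- := mxrank_mul_ker (A *m zshiftV ^+ k) zshiftV; rewrite exprSr mulmxA leq_add2l.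
  by apply: mxrankS; exact: capmxS.
have An : A *m zshiftV ^+ n = 0.
  apply/row_matrixP => i; rewrite row_mul row0 -[row i A]vec_mxK zshiftVX.
  rewrite (_ : _ *m _ = 0) ?linear0 //.
  have /rowP r0 := A0 (vec_mx (row i A)) (eq_ind_r (fun v => v <= A)%MS (row_sub i A) (vec_mxK _)).
  apply/matrixP => k j; rewrite !mxE big1 // => l _; rewrite zshiftXE.
  case: eqP => [e|]; last by rewrite mul0r.
  have -> : l = 0.
    apply: val_inj => /=; apply/eqP; rewrite -leqn0 -(leq_add2r n) add0n -e -ltnS.
    exact: ltn_ord.
  by have := r0 j; rewrite !mxE => ->; rewrite mulr0.
have := chain n; rewrite An mxrank0 add0n => rho2.
have rho_gt1 : (1 < rho)%N.
  rewrite ltnNge; apply/negP => r1; move: rho2.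
  by rewrite ltnNge -[X in (_ <= X)%N]muln1 leq_mul2l r1 orbT.
have /eqmxP kE : (A :&: kermx zshiftV == kermx zshiftV)%MS.
  rewrite -mxrank_leqif_eq ?capmxSr // eqn_leq mxrankS ?capmxSr //=.
  exact: leq_trans rank_kershift rho_gt1.
have : (mxvec x <= kermx zshiftV)%MS by apply/sub_kermxP; rewrite mxvec_zshift x0 linear0.
by rewrite -kE sub_capmx => /andP[].
Qed.
End Submodule.

End TruncatedModules.

(** * Matrix coordinates on the disc bundle and the generator attached to a point *)

Section ThomCoordinates.
Local Open Scope ring_scope.
Variables (C : numClosedFieldType) (n : nat).
Local Notation N := n.+1.
Implicit Types (x y w : 'M[C]_(N, 2)).

Definition rdot y (k l : 'I_N) : C := \sum_j y k j * (y l j)^*.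

Definition defect y : C := 1 - \sum_(k < N | k != 0) rdot y k k.

(* Rows [0] and [k] of [y] are the vectors [u] and [v_k] of a point of the disc
   bundle of [tau^n]. *)
Definition thom_coord y : Prop :=
  [/\ rdot y 0 0 = 1, forall k, k != 0 -> rdot y k 0 = 0 & 0 <= defect y].

Definition generator y : 'M[C]_(N, 2) :=
  \matrix_(k, j) if k == 0 then defect y * y 0 j else y k j.

(** For [defect y <> 0] this follows from [prl x (generator y)]. It is stated apart because on the
    sphere the generator no longer contains u. *)
Definition coeff0_prl x y : Prop := forall i j, y 0 i * x 0 j = y 0 j * x 0 i.

Lemma rdot_ge0 y k : 0 <= rdot y k k.
Proof. by apply: sumr_ge0 => j _; rewrite -normCK exprn_ge0. Qed.

Lemma rdot_eq0 y k : rdot y k k = 0 -> forall j, y k j = 0.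
Proof.
move=> /eqP; rewrite psumr_eq0 => [/allP H j|j _]; last by rewrite -normCK exprn_ge0.
by have := H j (mem_index_enum j); rewrite /= -normCK expf_eq0 /= normr_eq0 => /eqP.
Qed.

Lemma rdotZ a y k l : rdot (a *: y) k l = `|a| ^+ 2 * rdot y k l.
Proof.
rewrite /rdot mulr_sumr; apply: eq_bigr => j _.
by rewrite !mxE rmorphM /= normCK; ring.
Qed.

Lemma defectZ a y : `|a| = 1 -> defect (a *: y) = defect y.
Proof.
move=> a1; congr (_ - _); apply: eq_bigr => k _.
by rewrite rdotZ a1 expr1n mul1r.
Qed.

Lemma coeff0_prlE x y : rdot y 0 0 = 1 -> coeff0_prl x y ->
  forall j, x 0 j = (\sum_i x 0 i * (y 0 i)^*) * y 0 j.
Proof.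
move=> y1 xy j; rewrite -[LHS]mul1r -y1 !mulr_suml; apply: eq_bigr => i _.
by rewrite mulrAC xy; ring.
Qed.

(** In a product of truncated polynomials, the coefficient of degree k collects terms y_l x_(k-l);
    those with l < k vanish by hypothesis, which leaves l = k. *)
Lemma prl_lowest y x (k : 'I_N) i j :
  (forall l : 'I_N, (l < k)%N -> forall i, y l i = 0) ->
  (toep (col i y) *m col j x) k 0 = y k i * x 0 j.
Proof.
move=> yk; rewrite toep_mulC mxE (bigD1 k) //= toep_diag !mxE mulrC big1 ?addr0 //.
move=> l lk; rewrite mxE; have [ltlk|] := ltnP l k; first by rewrite yk // mulr0.
move=> lekl; have /is_trig_mxP -> := toep_trig (col j x); rewrite ?mul0r //.
by rewrite ltn_neqAle lekl eq_sym (inj_eq val_inj) lk.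
Qed.

Lemma generator0 y : defect y = 0 -> generator y = \matrix_(k, j) if k == 0 then 0 else y k j.
Proof. by move=> y0; apply/matrixP => k j; rewrite !mxE y0 mul0r. Qed.

(* At the boundary of the disc bundle the generator [w] degenerates to
   [sum v_k z^k], and the coefficient of lowest degree in [x /\ w = 0] shows that
   [x_0] is proportional to the first nonzero [v_k], which is orthogonal to [u]. *)
Lemma boundary_coeff0 y x : thom_coord y -> defect y = 0 -> coeff0_prl x y ->
  prl x (generator y) -> row 0 x = 0.
Proof.
move=> [y1 yo _] d0 xy xw; apply/rowP => j; rewrite !mxE (coeff0_prlE y1 xy).
set g := \sum_i _; suff -> : g = 0 by rewrite mul0r.
have xE := coeff0_prlE y1 xy; rewrite -/g in xE.
apply/eqP/negPn/negP => g0.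
(* If g were nonzero, every v_k would vanish by strong induction on k, while [defect y = 0] says
   that their squared norms add up to 1. *)
suff y0 k : k != 0 -> forall i, y k i = 0.
  move: d0; rewrite /defect big1 ?subr0 => [/eqP|k k0]; first by rewrite oner_eq0.
  by rewrite /rdot big1 // => i _; rewrite y0 ?mul0r.
have [m] := ubnP (val k); elim: m k => // m IH k km k0 i.
have low (l : 'I_N) : (l < k)%N -> forall i, generator y l i = 0.
  move=> lk i'; rewrite generator0 // mxE; case: eqVneq => // l0.
  by apply: IH l0 _; apply: leq_trans lk _.
have yg i' j' : y k i' * x 0 j' = y k j' * x 0 i'.
  have := congr1 (fun (v : 'cV_N) => v k 0) (xw i' j').
  by rewrite /= !(prl_lowest _ _ _ low) !mxE (negbTE k0).
have : y k i * g = 0.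
  transitivity (\sum_j y k i * x 0 j * (y 0 j)^*).
    by rewrite -[RHS](eq_bigr _ (fun j _ => mulrA _ _ _)) -mulr_sumr.
  transitivity (x 0 i * rdot y k 0); last by rewrite yo ?mulr0.
  rewrite mulr_sumr; apply: eq_bigr => j' _; rewrite yg; ring.
by move/eqP; rewrite mulf_eq0 (negbTE g0) orbF => /eqP.
Qed.

Lemma generator_coeff0 y : thom_coord y -> defect y != 0 ->
  exists i, generator y 0 i != 0.
Proof.
move=> [y1 _ _] d0; apply/existsP; rewrite -negb_forall; apply/negP => /forallP g0.
have y0 i : y 0 i = 0.
  by have := g0 i; rewrite mxE eqxx mulf_eq0 (negbTE d0) => /eqP.
by move/eqP: y1; rewrite /rdot big1 ?(eq_sym 0) ?oner_eq0 // => i _; rewrite y0 mul0r.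
Qed.

Lemma generatorZ a y : `|a| = 1 -> generator (a *: y) = a *: generator y.
Proof.
move=> a1; apply/matrixP => k j; rewrite !mxE defectZ //.
by case: eqP => _ //; ring.
Qed.

Lemma prlZ a x w : a != 0 -> prl x (a *: w) <-> prl x w.
Proof.
move=> a0; have cZ i : col i (a *: w) = a *: col i w by apply/colP => k; rewrite !mxE.
split=> xw i j; last by rewrite !cZ !toepZ -!scalemxAl xw.
by have := xw i j; rewrite !cZ !toepZ -!scalemxAl => /(can_inj (scalerK a0)).
Qed.

Lemma prl_refl x : prl x x.
Proof. by move=> i j; rewrite toep_mulC. Qed.

(** Pairing with u kills every v_k and leaves the constant s. This turns an equation x = c w with an
    unknown polynomial c into a formula for c. *)
Lemma mul_conj_generator y : thom_coord y ->
  generator y *m (\col_j (y 0 j)^*) = defect y *: delta_mx 0 0.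
Proof.
move=> [y1 yo _]; apply/colP => k; rewrite !mxE.
have [->|k0] := eqVneq k 0.
  rewrite eqxx mulr1 -[RHS]mulr1 -y1 mulr_sumr; apply: eq_bigr => j _.
  by rewrite !mxE /= mulrA.
rewrite /= mulr0 -[RHS](yo k k0); apply: eq_bigr => j _.
by rewrite !mxE (negbTE k0).
Qed.

Lemma defect_le1 y : defect y <= 1.
Proof. by rewrite gerBl; apply: sumr_ge0 => k _; exact: rdot_ge0. Qed.

(* The radial equation (1-q)^2 q' = (1-q')^2 q factors as (q'-q)(1-qq') = 0. *)
Lemma generator_inj y y' : thom_coord y -> thom_coord y' -> defect y != 0 -> defect y' != 0 ->
  prl (generator y') (generator y) -> exists2 a, `|a| = 1 & y' = a *: y.
Proof.
move=> ty ty' d0 d0' gg; have [i0 g0] := generator_coeff0 ty d0.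
have [c gE] := prl_toep g0 gg.
case: (ty) => y1 yo dge; case: (ty') => y1' yo' dge'.
(* The constant coefficients of [gE] show that u' and u span the same line. *)
have xy0 : coeff0_prl y' y.
  move=> i j; have := congr1 (fun (v : 'M[C]_(N, 2)) => v 0 i) gE.
  have := congr1 (fun (v : 'M[C]_(N, 2)) => v 0 j) gE.
  rewrite /= !toep_row0 !mxE eqxx => Ej Ei.
  by apply: (mulfI d0'); rewrite mulrCA Ej [RHS]mulrCA Ei; ring.
have uE := coeff0_prlE y1 xy0; set z := \sum_i _ in uE.
have z1 : `|z| = 1.
  have : `|z| ^+ 2 = 1.
    rewrite -y1' -[LHS]mulr1 -{}y1 /rdot mulr_sumr; apply: eq_bigr => j _.
    by rewrite uE rmorphM /= normCK; ring.
  by move=> /eqP; rewrite sqrp_eq1 ?normr_ge0 // => /eqP.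
(* Pair [gE] with u. The right side becomes [defect y] times c; the left side keeps only its
   constant term, because u is a phase times u', to which the v'_k are orthogonal. So the polynomial
   c is a scalar. *)
have cE : c = (defect y' * z / defect y) *: delta_mx 0 0.
  apply: (@scalerI _ _ (defect y)) => //.
  rewrite scalerA mulrCA divff // mulr1 -[_ *: c]/(defect y *: c).
  have := congr1 (fun (v : 'M[C]_(N, 2)) => v *m (\col_j (y 0 j)^*)) gE.
  rewrite /= -mulmxA mul_conj_generator // -scalemxAr toep_e0 => <-.
  apply/colP => k; rewrite !mxE.
  have [->|k0] := eqVneq k 0.
    rewrite eqxx mulr1 /z mulr_sumr; apply: eq_bigr => j _.
    by rewrite !mxE /= mulrA.
  rewrite /= mulr0; transitivity (z * rdot y' k 0).
    rewrite /rdot mulr_sumr; apply: eq_bigr => j _; rewrite !mxE (negbTE k0) uE rmorphM.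
    have -> : z * (y' k j * (z^* * (y 0 j)^*)) = `|z| ^+ 2 * (y' k j * (y 0 j)^*).
      by rewrite normCK; ring.
    by rewrite z1 expr1n mul1r.
  by rewrite yo' ?mulr0.
set r := defect y' * z / defect y in cE.
have gr : generator y' = r *: generator y.
  by rewrite gE cE toepZ toep_e0id -scalemxAl mul1mx.
have yk k j : k != 0 -> y' k j = r * y k j.
  by move=> k0; have := congr1 (fun (v : 'M[C]_(N, 2)) => v k j) gr; rewrite !mxE (negbTE k0).
have q' : 1 - defect y' = `|r| ^+ 2 * (1 - defect y).
  rewrite /defect !subKr mulr_sumr; apply: eq_bigr => k k0.
  by rewrite /rdot mulr_sumr; apply: eq_bigr => j _; rewrite !yk // rmorphM /= normCK; ring.
have rE : `|r| ^+ 2 = (defect y') ^+ 2 / (defect y) ^+ 2.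
  by rewrite !normrM normfV z1 mulr1 !ger0_norm // expr_div_n.
have dd : defect y' = defect y.
  have := q'; rewrite rE => /(congr1 (fun t => t * (defect y) ^+ 2)).
  rewrite mulrAC divfK ?expf_neq0 // => E.
  have : (defect y - defect y') * (defect y + defect y' - defect y * defect y') = 0.
    have -> : (defect y - defect y') * (defect y + defect y' - defect y * defect y') =
       (1 - defect y') * defect y ^+ 2 - defect y' ^+ 2 * (1 - defect y) by ring.
    by rewrite E subrr.
  (* With s = 1 - q, the second factor s + s' - s s' is 1 - q q'. It is positive because s > 0, s'
     >= 0 and s <= 1. *)
  move/eqP; rewrite mulf_eq0 subr_eq0 => /orP[/eqP //|/eqP E0].
  have dp : 0 < defect y by rewrite lt_neqAle eq_sym d0.
  suff : 0 < defect y + defect y' - defect y * defect y' by rewrite E0 ltxx.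
  have -> : defect y + defect y' - defect y * defect y' =
    defect y + defect y' * (1 - defect y) by ring.
  by rewrite ltr_pwDl // mulr_ge0 // subr_ge0 defect_le1.
have rz : r = z by rewrite /r dd mulrAC divff // mul1r.
exists z => //; apply/matrixP => k j; rewrite mxE.
by have [->|k0] := eqVneq k 0; [exact: uE | rewrite yk // rz].
Qed.

(* With [a] the norm square of [sum w_k z^k], the point over [u + sum w_k z^k]
   has [v_k = s w_k], where [s = 1 - s^2 a]. *)
Lemma generator_onto p (A : 'M[C]_(p, N * 2)) x : stablemx A (zshiftV C n) ->
  (mxvec x <= A)%MS -> row 0 x != 0 ->
  exists y, [/\ thom_coord y, defect y != 0 & (mxvec (generator y) <= A)%MS].
Proof.
move=> sA xA x0.
pose m := sqrtC (rdot x 0 0).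
have m0 : m != 0.
  rewrite sqrtC_eq0; apply: contraNneq x0 => x00.
  by apply/eqP/rowP => j; rewrite !mxE (rdot_eq0 x00).
have mm : m * m^* = rdot x 0 0.
  by rewrite -normCK ger0_norm ?sqrtC_ge0 ?rdot_ge0 // sqrtCK.
(* The conjugate of u = x_0 / |x_0|, so that [x *m ub] is the polynomial <x, u>, with constant
   coefficient m = |x_0|. *)
pose ub : 'cV[C]_2 := \col_j (x 0 j / m)^*.
have a0 : (x *m ub) 0 0 = m.
  apply: (mulIf (_ : m^* != 0)); first by rewrite conjC_eq0.
  rewrite mm mxE mulr_suml; apply: eq_bigr => j _.
  by rewrite mxE rmorphM /= fmorphV /= mulrA divfK ?conjC_eq0.
(* Dividing x by the invertible polynomial <x, u> gives w with <w, u> = 1. Comparing coefficients,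
   w_0 = u and the other w_k are orthogonal to u. *)
have Tu : toep (x *m ub) \in unitmx by rewrite toep_unit // a0.
have [c cE] : exists c : 'cV[C]_N, toep (x *m ub) *m c = delta_mx 0 0.
  by exists (invmx (toep (x *m ub)) *m delta_mx 0 0); rewrite mulKVmx.
pose w := toep c *m x.
have wA : (mxvec w <= A)%MS by exact: stable_toep.
have wub : w *m ub = delta_mx 0 0 by rewrite -mulmxA toep_mulC.
have c0 : c 0 0 = m^-1.
  have := congr1 (fun (v : 'cV_N) => v 0 0) wub.
  rewrite /= -mulmxA toep_row0 a0 mxE eqxx => /(canRL (mulfK m0)) ->.
  by rewrite mul1r.
have w0 j : w 0 j = x 0 j / m by rewrite toep_row0 c0 mulrC.
have wo k : k != 0 -> rdot w k 0 = 0.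
  move=> k0; have := congr1 (fun (v : 'cV_N) => v k 0) wub.
  rewrite !mxE (negbTE k0) /= => H; rewrite -[RHS]H.
  by apply: eq_bigr => j _; rewrite w0 !mxE.
have w1 : rdot w 0 0 = 1.
  have := congr1 (fun (v : 'cV_N) => v 0 0) wub; rewrite !mxE eqxx => H; rewrite -[RHS]H.
  by apply: eq_bigr => j _; rewrite w0 [ub _ _]mxE.
pose a := \sum_(k < N | k != 0) rdot w k k.
have a_ge0 : 0 <= a by apply: sumr_ge0 => k _; exact: rdot_ge0.
pose b := sqrtC (1 + 4 * a).
have b_ge0 : 0 <= b by rewrite sqrtC_ge0 addr_ge0 ?ler01 ?mulr_ge0.
have bb : b ^+ 2 = 1 + 4 * a by rewrite sqrtCK.
have b1 : 1 + b != 0 by rewrite gt_eqF // ltr_pwDl.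
(* The positive root of a s^2 + s - 1 = 0, written so that it also makes sense for a = 0. *)
pose s := 2 / (1 + b).
have s_ge0 : 0 <= s by rewrite divr_ge0 ?addr_ge0 ?ler01.
have s0 : s != 0 by rewrite mulf_neq0 ?invr_eq0 // pnatr_eq0.
have sE : 1 - s ^+ 2 * a = s.
  have -> : a = (b ^+ 2 - 1) / 4 by rewrite bb; field.
  by rewrite /s; field.
pose y : 'M[C]_(N, 2) := \matrix_(k, j) if k == 0 then w 0 j else s * w k j.
have dE : defect y = s.
  rewrite -sE; congr (_ - _); rewrite mulr_sumr; apply: eq_bigr => k k0.
  rewrite /rdot mulr_sumr; apply: eq_bigr => j _.
  by rewrite mxE (negbTE k0) rmorphM /= (conj_Creal (ger0_real s_ge0)); ring.
exists y; split.
- split; last by rewrite dE.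
    by rewrite -w1; apply: eq_bigr => j _; rewrite !mxE.
  move=> k k0; rewrite -[RHS](mulr0 s) -(wo k k0) /rdot mulr_sumr.
  by apply: eq_bigr => j _; rewrite !mxE eqxx (negbTE k0) mulrA.
- by rewrite dE.
- have -> : generator y = s *: w.
    apply/matrixP => k j; rewrite !mxE dE eqxx.
    by case: eqP => [->|].
  by rewrite linearZ scalemx_sub.
Qed.

End ThomCoordinates.

(** * The spaces W as z-stable subspaces of finite dimension *)

Section CodimRank.
Local Open Scope classical_set_scope.
Local Open Scope ring_scope.
Variable C : numFieldType.

(** [L] induces an isomorphism from Y / X to the row space of B. Through it the dimensions entering
    the index become ranks of matrices. *)
Lemma has_codim_rank (V : lmodType C) (X Y : set V) d p (L : V -> 'rV[C]_d) (B : 'M[C]_(p, d)) k :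
  linear_op L -> linear_set Y ->
  (forall y, Y y -> X y <-> L y = 0) ->
  (forall y, Y y -> (L y <= B)%MS) ->
  (forall v, (v <= B)%MS -> exists2 y, Y y & L y = v) ->
  has_codim X Y k <-> \rank B = k.
Proof.
move=> lL linY XL YB BY; pose Y' := LinSub linY.
have Lsum m (c : 'I_m -> C) w : L (\sum_i c i *: w i) = (\row_i c i) *m (\matrix_i L (w i)).
  rewrite (linear_op_sum c w lL) mulmx_sum_row; apply: eq_bigr => i _.
  by rewrite rowK mxE.
have rowE m (v : 'rV[C]_m) : \row_i v 0 i = v by apply/rowP => i; rewrite mxE.
split=> [[w [Yw wi ws]]|<-].
  pose M := \matrix_i L (w i); suff [Mf BM] : row_free M /\ (B == M)%MS.
    by rewrite (eqmxP BM); exact/eqP.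
  split.
    apply: inj_row_free => v v0; apply/rowP => i; rewrite mxE.
    apply: (wi (fun i => v 0 i)); apply/XL.
      exact: (linsub_sum (W := Y') (w := w)).
    by rewrite Lsum rowE.
  apply/andP; split; apply/row_subP => i; last by rewrite rowK; exact: YB.
  have [y Yy <-] := BY (row i B) (row_sub i B).
  have [c Xc] := ws y Yy; apply/submxP; exists (\row_i c i); rewrite -Lsum.
  apply/eqP; rewrite -subr_eq0 -linear_opB //; apply/eqP/XL => //.
  by apply: (linsubB (W := Y')) => //; exact: (linsub_sum (W := Y') (w := w)).
have rb i : exists y, Y y /\ L y = row i (row_base B).
  by have [|y Yy yE] := BY (row i (row_base B)); [rewrite -(eq_row_base B) row_sub | exists y].
have [w wP] := choice rb.
have wM : \matrix_i L (w i) = row_base B by apply/row_matrixP => i; rewrite rowK (wP i).2.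
exists w; split=> [i|c|y Yy]; first by have [] := wP i.
  move=> /XL; rewrite Lsum wM => c0 i.
  have : (\row_i c i) *m row_base B = 0.
    by apply: c0; apply: (linsub_sum (W := Y') (w := w)) => j; have [] := wP j.
  rewrite -[X in _ = X](mul0mx _ (row_base B)) => /(row_free_inj (row_base_free B)).
  by move/rowP/(_ i); rewrite !mxE.
have : (L y <= row_base B)%MS by rewrite eq_row_base YB.
move=> /submxP [v yv]; exists (fun i => v 0 i); apply/XL.
  apply: (linsubB (W := Y')) => //.
  by apply: (linsub_sum (W := Y') (w := w)) => j; have [] := wP j.
by rewrite linear_opB // Lsum rowE wM yv subrr.
Qed.

(** Take a matrix of maximal rank among those with rows in S: adjoining a further v in S cannot
    raise the rank, so v already lies in the row space. *)
Lemma linear_set_mx d (S : set 'rV[C]_d) : linear_set S ->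
  exists A : 'M[C]_d, forall v, S v <-> (v <= A)%MS.
Proof.
move=> lS; pose S' := LinSub lS.
have Srow p (B : 'M[C]_(p, d)) v : (forall i, S (row i B)) -> (v <= B)%MS -> S v.
  move=> SB /submxP [c ->]; rewrite mulmx_sum_row.
  exact: (linsub_sum (W := S') (w := fun i => row i B)).
pose P k := `[< exists2 B : 'M[C]_d, (forall i, S (row i B)) & \rank B = k >].
have P0 : exists k, P k.
  exists 0%N; apply/asboolP; exists 0; last exact: mxrank0.
  by move=> i; rewrite row0; exact: (linsub0 S').
have Pd k : P k -> (k <= d)%N by move=> /asboolP [B _ <-]; exact: rank_leq_col.
case: (ex_maxnP P0 Pd) => k /asboolP [B SB rB] kmax.
exists B => v; split=> [Sv|]; last exact: Srow.
have SBv : forall i, S (row i (B + v)%MS).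
  move=> i; have /sub_addsmxP [[c e] /= ->] := row_sub i (B + v)%MS.
  apply: (linsubD (W := S')); first by apply: (Srow _ B) => //; exact: submxMl.
  by rewrite [e]mx11_scalar mul_scalar_mx; exact: (linsubZ (W := S')).
have : (\rank (B + v)%MS <= \rank B)%N.
  by rewrite rB; apply: kmax; apply/asboolP; exists (B + v)%MS.
move=> rBv; have /eqmxP BE : (B == B + v)%MS.
  by rewrite -mxrank_leqif_eq ?addsmxSl // eqn_leq rBv mxrankS // addsmxSl.
by rewrite BE addsmxSr.
Qed.

End CodimRank.

(** * The window of Fourier coefficients of W, and its index as a rank *)

Section LatticeCoordinates.
Local Open Scope classical_set_scope.
Local Open Scope ring_scope.
Variable R : realType.
Local Notation C := R[i].
Local Notation K := {ffun 'I_2 -> L2 R}.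
Local Notation Kdot := (@Kdot R).
Variables (n r : nat).
Hypothesis hN : n.+1 = (2 * r)%N.
Local Notation N := n.+1.
Local Notation mr := (- r%:Z).
Local Notation zblock := (@zblock R mr N).

(** Row k holds the coefficient of z^(k-r); row 0 is thus the lowest mode allowed in z^(-r) K_+, and
    the constant coefficient after multiplication by z^r. *)
Definition coef (f : K) : 'M[C]_(N, 2) := \matrix_(k, i) Kdot f (zblock (k, i)).

Definition vecK (x : 'M[C]_(N, 2)) : K := \sum_p x p.1 p.2 *: zblock p.

Lemma mrN : mr + N%:Z = r%:Z.
Proof. by rewrite hN; lia. Qed.

Lemma coefZD : linear_op coef.
Proof. by move=> a f g; apply/matrixP => k i; rewrite !mxE KdotZDl. Qed.

Lemma coef_subr f g : coef (f - g) = coef f - coef g.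
Proof. exact: linear_opB coefZD. Qed.

Lemma coef_vecK x : coef (vecK x) = x.
Proof.
by apply/matrixP => k i; rewrite mxE (Kdot_ortho_sum (@zblock_ortho R mr N) (fun p => x p.1 p.2)).
Qed.

Lemma vecK_in x : zKplus R mr (vecK x).
Proof.
apply: (linsub_sum (W := zKplus R mr) (w := zblock)) => p.
by apply: zKplus_zbasis; rewrite lerDl.
Qed.

Lemma coef_eq0 f : zKplus R mr f -> zKplus R r f <-> coef f = 0.
Proof.
move=> fr; rewrite -mrN zKplus_coefP //; split=> [f0|f0 k i].
  by apply/matrixP => k i; rewrite !mxE; exact: f0.
by have := congr1 (fun A : matrix _ _ _ => A k i) f0; rewrite !mxE.
Qed.

Lemma coef_row0 f : zKplus R mr f -> zKplus R (mr + 1) f <-> row 0 (coef f) = 0.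
Proof.
move=> fr; rewrite -[1]/(1%:Z) zKplus_coefP //; split=> [f0|f0 k i].
  by apply/rowP => i; rewrite !mxE; exact: f0 ord0 i.
by have := congr1 (fun A : matrix _ _ _ => A 0 i) f0; rewrite !mxE [k]ord1.
Qed.

Lemma coef_top f : zKplus R (r%:Z - 1) f -> zKplus R mr f /\ zshift C n *m coef f = 0.
Proof.
have -> : r%:Z - 1 = mr + n%:Z by move: mrN; lia.
move=> fs; have fr : zKplus R mr f by apply: zKplus_sub fs; rewrite lerDl.
split=> //; apply/matrixP => k i; have := (iffLR (zKplus_coefP n fr)) fs => f0.
rewrite [RHS]mxE; have [->|k0] := eqVneq k 0.
  by rewrite mxE big1 // => l _; rewrite mxE mul0r.
by case: (unliftP ord0 k) k0 => [l ->|->] // _; rewrite zshift_row0 mxE; exact: f0.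
Qed.

Lemma zKplus_zK1 m f : zKplus R m f -> zKplus R (m + 1) (zK 1 f).
Proof. by move/zKplusE => fm; apply/zKplusE; rewrite zKD opprD subrK. Qed.

Lemma zKplus_zK f : zKplus R mr f -> zKplus R mr (zK 1 f).
Proof. by move/zKplus_zK1; apply: zKplus_sub; rewrite lerDl. Qed.

Lemma coef_zK f : zKplus R mr f -> coef (zK 1 f) = zshift C n *m coef f.
Proof.
move=> fr; apply/matrixP => k i; rewrite mxE; case: (unliftP ord0 k) => [l ->|->].
  rewrite zshift_row0 mxE -(Kdot_zK 1 f); congr (Kdot _ _); rewrite zK_zbasis.
  by congr (zbasis R _ i); rewrite lift0 /=; lia.
rewrite [RHS]mxE big1; last by move=> l _; rewrite mxE mul0r.
by apply: zKplus_perp (zKplus_zK1 fr) _; rewrite /= addr0 ltrDl.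
Qed.

Lemma coef_gK g f : coef (gK g f) = coef f *m g^T.
Proof.
apply/matrixP => k i; rewrite !mxE Kdot_zbasis ffunE.
rewrite (form_suml (@L2dotZDl R)); apply: eq_bigr => j _.
by rewrite !mxE Kdot_zbasis mulrC.
Qed.

(** Membership in a row space becomes finitely many orthogonality conditions, which are closed in K
    by [Kclosed_perp]. The conjugate compensates for the conjugate-linear second argument of
    [Kdot]. *)
Lemma coef_memP p (A : 'M[C]_(p, N * 2)) f : (mxvec (coef f) <= A)%MS <->
  forall j, Kdot f (vecK (\matrix_(k, i) (cokermx A (mxvec_index k i) j)^*)) = 0.
Proof.
have E j : Kdot f (vecK (\matrix_(k, i) (cokermx A (mxvec_index k i) j)^*)) =
    (mxvec (coef f) *m cokermx A) 0 j.
  rewrite mxE Kdot_sumr (reindex _ (curry_mxvec_bij N 2)) /=.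
  by apply: eq_bigr => -[k i] _; rewrite mxvecE !mxE conjCK mulrC.
rewrite submxE; split=> [/eqP A0 j|A0]; first by rewrite E A0 mxE.
by apply/eqP/rowP => j; rewrite -E A0 mxE.
Qed.

Lemma hidx_subproof (l : 'I_r) : (r + l < N)%N.
Proof. by rewrite hN mul2n -addnn ltn_add2l. Qed.
(** Row [r + l] carries the mode z^l, so these are the rows of the window that belong to K_+. *)
Definition hidx (l : 'I_r) : 'I_N := Ordinal (hidx_subproof l).

Lemma hidx_inj : injective hidx.
Proof. by move=> k l /(congr1 val) /= /addnI /val_inj. Qed.

Definition himx : 'M[C]_(r, N) := rowsub hidx 1%:M.

Lemma himxE (x : 'M[C]_(N, 2)) l i : (himx *m x) l i = x (hidx l) i.
Proof. by rewrite -rowsubE mxE. Qed.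

Lemma himx_trK (x : 'M[C]_(r, 2)) : himx *m (himx^T *m x) = x.
Proof.
rewrite mulmxA (_ : himx *m himx^T = 1%:M) ?mul1mx //; apply/matrixP => k l.
rewrite -rowsubE !mxE (inj_eq hidx_inj); congr (_%:R).
by rewrite eq_sym.
Qed.

Lemma zblock_hidx l i : zblock (hidx l, i) = zbasis R l i.
Proof. by congr zbasis => /=; lia. Qed.

Lemma idx_cases (k : 'I_N) : (k < r)%N \/ exists l, k = hidx l.
Proof.
have [|rk] := ltnP k r; [by left | right].
have lr : (k - r < r)%N by have := ltn_ord k; rewrite {2}hN; lia.
by exists (Ordinal lr); apply: val_inj; rewrite /= subnKC.
Qed.

Lemma Kplus_zKplus f : Kplus R f <-> zKplus R 0 f.
Proof. by rewrite zKplusE oppr0 zK0. Qed.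

Lemma Kplus_zblock l i : Kplus R (zblock (hidx l, i)).
Proof. by apply/Kplus_zKplus; rewrite zblock_hidx; apply: zKplus_zbasis. Qed.

Lemma Kplus_low f (k : 'I_N) i : Kplus R f -> (k < r)%N -> coef f k i = 0.
Proof.
move=> /Kplus_zKplus f0 kr; rewrite mxE; apply: zKplus_perp f0 _ => /=.
by rewrite addrC subr_lt0 ltz_nat.
Qed.

Lemma Kplus_sub_mr f : Kplus R f -> zKplus R mr f.
Proof. by move=> /Kplus_zKplus; apply: zKplus_sub; rewrite oppr_le0. Qed.

Lemma vecK_Kplus (x : 'M[C]_(N, 2)) :
  (forall k : 'I_N, (k < r)%N -> forall i, x k i = 0) -> Kplus R (vecK x).
Proof.
move=> x0; apply/Kplus_zKplus; rewrite -(addNr r%:Z); apply/(zKplus_coefP r (vecK_in x)).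
move=> k i; have kN : (k < N)%N by rewrite hN; have := ltn_ord k; lia.
transitivity (coef (vecK x) (Ordinal kN) i); first by rewrite mxE.
by rewrite coef_vecK; apply: x0; exact: (ltn_ord k).
Qed.

Lemma Kdot_vecK_low (x : 'M[C]_(N, 2)) h : (forall l i, x (hidx l) i = 0) -> Kplus R h ->
  Kdot (vecK x) h = 0.
Proof.
move=> x0 Kh; rewrite Kdot_suml big1 // => -[k i] _ /=.
case: (idx_cases k) => [kr|[l ->]]; last by rewrite x0 mul0r.
have := Kplus_low i Kh kr; rewrite mxE => hk.
by rewrite [Kdot (zblock _) h]KdotC hk rmorph0 mulr0.
Qed.

Lemma vecKB x y : vecK (x - y) = vecK x - vecK y.
Proof. by rewrite /vecK -sumrB; apply: eq_bigr => p _; rewrite !mxE scalerBl. Qed.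

Section SubK.
Variables (p : nat) (A : 'M[C]_(p, N * 2)).

Lemma subK_linear : linear_set [set f | zKplus R mr f /\ (mxvec (coef f) <= A)%MS].
Proof.
split=> [|a u v [ur uA] [vr vA]].
  split; first exact: (linsub0 (zKplus R mr)).
  by rewrite (linear_op0 coefZD) linear0 sub0mx.
split; first exact: (linsubZD (W := zKplus R mr)).
by rewrite coefZD linearP addmx_sub // scalemx_sub.
Qed.

(** Only the N coefficients of the window are tested, so z^r K_+ is contained in it
    automatically. *)
Definition subK : linsub K := LinSub subK_linear.

Lemma subK_closed : Kclosed subK.
Proof.
move=> f fW; split.
  by apply: zKplus_closed => e e0; have [g [gr _] fg] := fW e e0; exists g.
apply/coef_memP => j; apply: Kclosed_perp => e e0.
by have [g [_ /coef_memP gA] fg] := fW e e0; exists g => //; exact: gA.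
Qed.

Let Hi : 'M[C]_(N * 2, r * 2) := lin_mulmx himx.

Lemma mxvec_hi (x : 'M[C]_(N, 2)) : mxvec x *m Hi = mxvec (himx *m x).
Proof. exact: mul_vec_lin. Qed.

Lemma subK_vecK x : (mxvec x <= A)%MS -> subK (vecK x).
Proof. by move=> xA; split; [exact: vecK_in | rewrite coef_vecK]. Qed.

Lemma proj_kerP f : proj_ker subK f <-> subK f /\ forall h, Kplus R h -> Kdot f h = 0.
Proof.
split=> [[Wf [_ fK]]|[Wf fK]]; first by split=> // h /fK; rewrite subr0.
by split=> //; split=> [|h Kh]; [exact: (linsub0 (Kplus R)) | rewrite subr0; exact: fK].
Qed.

Lemma dim_proj_ker m : has_dim (proj_ker subK) m <-> \rank (A :&: kermx Hi)%MS = m.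
Proof.
have cm f : mxvec (coef f) = 0 -> coef f = 0.
  by move=> /(congr1 vec_mx); rewrite mxvecK linear0.
apply: (has_codim_rank (L := fun f => mxvec (coef f))).
- by move=> a u v; rewrite coefZD linearP.
- split=> [|a u v /proj_kerP [uW u0] /proj_kerP [vW v0]].
    by apply/proj_kerP; split=> [|h _]; [exact: (linsub0 subK) | exact: Kdot0l].
  apply/proj_kerP; split=> [|h Kh]; first exact: (linsubZD (W := subK)).
  by rewrite KdotZDl u0 // v0 // mulr0 addr0.
- move=> f /proj_kerP [[fr fA] f0]; split=> [-> |/cm c0].
    by rewrite (linear_op0 coefZD) linear0.
  (* If all coefficients in the window vanish, f lies in z^r K_+, hence in K_+, to which it is
     orthogonal; so it is orthogonal to itself. *)
  apply: Kdot_eq0; apply: f0; apply/Kplus_zKplus.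
  by apply: zKplus_sub ((iffRL (coef_eq0 fr)) c0); lia.
- move=> f /proj_kerP [[fr fA] f0]; rewrite sub_capmx fA /=.
  apply/sub_kermxP; rewrite mxvec_hi (_ : _ *m _ = 0) ?linear0 //.
  by apply/matrixP => l i; rewrite himxE !mxE f0 //; exact: Kplus_zblock.
- move=> v; rewrite sub_capmx => /andP[vA /sub_kermxP vH].
  exists (vecK (vec_mx v)); last by rewrite coef_vecK vec_mxK.
  apply/proj_kerP; split; first by apply: subK_vecK; rewrite vec_mxK.
  move=> h; apply: Kdot_vecK_low => l i; rewrite -himxE.
  move: vH; rewrite -[v]vec_mxK mxvec_hi => /(congr1 vec_mx).
  by rewrite !mxvecK linear0 => ->; rewrite mxE.
Qed.

Lemma proj_imP g : Kplus R g -> proj_im subK g <-> (mxvec (himx *m coef g) <= A *m Hi)%MS.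
Proof.
move=> Kg; split=> [[f [fr fA] [_ fg]]|/submxP [c cE]].
  have -> : himx *m coef g = himx *m coef f.
    apply/matrixP => l i; rewrite !himxE !mxE; apply/esym/eqP.
    by rewrite -subr_eq0 -KdotBl fg //; exact: Kplus_zblock.
  by rewrite -mxvec_hi submxMr.
(* The element of W with the required coefficients in the window, completed by the tail of g, which
   lies in z^r K_+ and is therefore free. *)
exists (vecK (vec_mx (c *m A)) + (g - vecK (coef g))).
  split.
    apply: (linsubD (W := zKplus R mr)); first exact: vecK_in.
    by apply: (linsubB (W := zKplus R mr)); [exact: Kplus_sub_mr | exact: vecK_in].
  have -> : coef (vecK (vec_mx (c *m A)) + (g - vecK (coef g))) = vec_mx (c *m A).
    by rewrite -[vecK _]scale1r coefZD coef_subr !coef_vecK subrr addr0 scale1r.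
  by rewrite vec_mxK submxMl.
split=> // h Kh.
have -> : vecK (vec_mx (c *m A)) + (g - vecK (coef g)) - g = vecK (vec_mx (c *m A) - coef g).
  by rewrite vecKB addrCA addrAC subrr add0r.
apply: Kdot_vecK_low Kh => l i; rewrite mxE [X in _ + X]mxE -!himxE.
suff -> : himx *m coef g = himx *m vec_mx (c *m A) by rewrite subrr.
by apply: (can_inj mxvecK); rewrite cE -mxvec_hi vec_mxK mulmxA.
Qed.

Lemma codim_proj_im k : has_codim (proj_im subK) (Kplus R) k <-> (r * 2 - \rank (A *m Hi))%N = k.
Proof.
rewrite -mxrank_coker.
apply: (has_codim_rank (L := fun f => mxvec (himx *m coef f) *m cokermx (A *m Hi))).
- by move=> a u v; rewrite coefZD mulmxDr -scalemxAr linearP mulmxDl -scalemxAl.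
- exact: linsetP (Kplus R).
- move=> g Kg; rewrite proj_imP // submxE.
  by split=> [/eqP|->].
- by move=> g _; exact: submxMl.
- move=> v /submxP [c ->]; exists (vecK (himx^T *m vec_mx c)).
    apply: vecK_Kplus => k' kr i; rewrite mxE big1 // => l _.
    rewrite mxE [himx _ _]mxE mxE (_ : hidx l == k' = false) ?mul0r //.
    by apply/negbTE/eqP => e; move: kr; rewrite -e /= ltnNge leq_addr.
  by rewrite coef_vecK himx_trK vec_mxK.
Qed.

(** By rank-nullity for [Hi] on the row space, the kernel dimension minus the codimension 2r -
    rank(A Hi) is rank A - 2r. *)
Lemma has_index_subK : has_index subK 0 <-> \rank A = N.
Proof.
have rH : (\rank (A *m Hi) <= r * 2)%N by exact: rank_leq_col.
have rk := mxrank_mul_ker A Hi.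
split=> [[m [k [/dim_proj_ker mE /codim_proj_im kE mk]]]|rA].
  move: hN rH rk mk kE mE; move: (\rank (A *m Hi)) (\rank (A :&: kermx Hi)%MS) (\rank A).
  by lia.
exists (\rank (A :&: kermx Hi)%MS), (r * 2 - \rank (A *m Hi))%N.
split; [exact/dim_proj_ker | exact/codim_proj_im |].
move: hN rH rk rA; move: (\rank (A *m Hi)) (\rank (A :&: kermx Hi)%MS) (\rank A).
by lia.
Qed.

Lemma F_set_subK : \rank A = N -> stablemx A (zshiftV C n) -> F_set r subK.
Proof.
move=> rA sA; split.
- exact: subK_closed.
- move=> _ [f [fr fA] <-]; split; first exact: zKplus_zK.
  by rewrite coef_zK //; exact: stable_zshift.
- move=> f fr; have fm : zKplus R mr f by apply: zKplus_sub fr; lia.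
  by split=> //; rewrite ((iffLR (coef_eq0 fm)) fr) linear0 sub0mx.
- by move=> f [].
- exact/has_index_subK.
Qed.
End SubK.

Lemma subK_eqmx p q (A : 'M[C]_(p, N * 2)) (B : 'M[C]_(q, N * 2)) :
  (A :=: B)%MS -> subK A = subK B.
Proof.
move=> AB; apply: linsub_eq; apply/seteqP; split=> f [fr fA]; split=> //.
  by rewrite -AB.
by rewrite AB.
Qed.

Lemma subK_inj p q (A : 'M[C]_(p, N * 2)) (B : 'M[C]_(q, N * 2)) x :
  subK A = subK B -> (mxvec x <= A)%MS -> (mxvec x <= B)%MS.
Proof. by move=> AB /subK_vecK; rewrite AB => -[_]; rewrite coef_vecK. Qed.

Lemma F_set_mx W : F_set r W -> exists A : 'M[C]_(N, N * 2),
  [/\ A \is unitarymx, stablemx A (zshiftV C n) & W = subK A].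
Proof.
move=> FW; have [cW zW rW Wr iW] := FW.
pose S : set 'rV[C]_(N * 2) := [set v | exists2 f, W f & mxvec (coef f) = v].
have lS : linear_set S.
  split=> [|a _ _ [f Wf <-] [g Wg <-]].
    by exists 0; [exact: linsub0 | rewrite (linear_op0 coefZD) linear0].
  by exists (a *: f + g); [exact: linsubZD | rewrite coefZD linearP].
have [A0 A0P] := linear_set_mx lS.
have WE0 : W = subK A0.
  apply: linsub_eq; apply/seteqP; split=> f.
    by move=> Wf; split; [exact: Wr | apply/A0P; exists f].
  (* An element g of W with the same window differs from f by an element of z^r K_+, which is inside
     W. *)
  move=> [fr /A0P [g Wg /(can_inj mxvecK) gf]]; rewrite -(subrK g f); apply: linsubD => //.
  apply/rW/coef_eq0; first by apply: (linsubB (W := zKplus R mr)) => //; exact: Wr.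
  by rewrite coef_subr gf subrr.
have rA0 : \rank A0 = N by apply/has_index_subK; rewrite -WE0.
have [A1 A1f A1E] : exists2 A1 : 'M[C]_(N, N * 2), row_free A1 & (A1 :=: A0)%MS.
  have := row_base_free A0; have := eq_row_base A0; move: (row_base A0); rewrite rA0 => A1.
  by exists A1.
(* Orthonormalising the frame is what makes the space of incident pairs bounded later on. *)
have AE : (schmidt A1 :=: A0)%MS by exact: eqmx_trans (eqmx_schmidt_free A1f) A1E.
have WE : W = subK (schmidt A1) by rewrite WE0; apply: subK_eqmx; exact: eqmx_sym.
exists (schmidt A1).
split=> //; first by apply: schmidt_unitarymx; rewrite muln2 -addnn leq_addr.
apply/row_subP => i; rewrite row_mul -[row i _]vec_mxK mxvec_zshift.
set x := vec_mx _; have : subK (schmidt A1) (vecK x) by apply: subK_vecK; rewrite vec_mxK row_sub.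
rewrite -WE => Wx; have : W (zK 1 (vecK x)) by apply: zW; exists (vecK x).
by rewrite WE => -[_]; rewrite coef_zK ?coef_vecK //; exact: vecK_in.
Qed.

(** The index condition does not involve r, so only the two inclusions change. The upper one is the
    vanishing of row 0. The lower one follows from it by [top_mem], since an element of z^s K_+ has
    only the top coefficient of the window. *)
Lemma F_set_pred s W : r = s.+1 -> F_set r W ->
  F_set s W <-> forall f, W f -> row 0 (coef f) = 0.
Proof.
move=> rs FW; have [cW zW rW Wr iW] := FW; have sE : - s%:Z = mr + 1 by rewrite rs; lia.
split=> [[_ _ _ Ws _] f Wf|W0].
  by apply/coef_row0; [exact: Wr | rewrite -sE; exact: Ws].
split=> // f fs; last by rewrite sE; apply/coef_row0; [exact: Wr | exact: W0].
have [A [uA sA WE]] := F_set_mx FW.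
have [fr f0] : zKplus R mr f /\ zshift C n *m coef f = 0.
  by apply: coef_top; rewrite rs (_ : s.+1%:Z - 1 = s%:Z) //; lia.
rewrite WE; split=> //; apply: top_mem sA _ f0; first by rewrite mxrank_unitary.
by move=> x xA; rewrite -(coef_vecK x); apply: W0; rewrite WE; exact: subK_vecK.
Qed.

End LatticeCoordinates.

(** * Topological preliminaries *)

Section TopologyFacts.
Local Open Scope classical_set_scope.
Local Open Scope ring_scope.

Lemma hausdorff_separated (T U : topologicalType) (I : Type) (f : I -> T -> U) :
  hausdorff_space U -> (forall i, continuous (f i)) ->
  (forall x y, (forall i, f i x = f i y) -> x = y) -> hausdorff_space T.
Proof.
move=> hU cf inj p q cpq; apply: inj => i; apply: hU => A B pA qB.
have [z [Az Bz]] := cpq _ _ (cf i p A pA) (cf i q B qB).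
by exists (f i z).
Qed.

(** A continuous surjection from a compact space to a Hausdorff one is closed, hence a quotient map.
    Each of p and q therefore factors continuously through the other, and the two factors are
    mutually inverse. *)
Lemma compact_common_quotient (X A B : topologicalType) (p : X -> A) (q : X -> B) :
  compact [set: X] -> hausdorff_space A -> hausdorff_space B ->
  continuous p -> continuous q -> (forall a, exists x, p x = a) -> (forall b, exists x, q x = b) ->
  (forall x y, p x = p y <-> q x = q y) ->
  exists2 h : A -> B, homeomorphism h & forall x, h (p x) = q x.
Proof.
move=> cX hA hB cp cq sp sq pq.
have factor (Y Z : topologicalType) (f : X -> Y) (g : X -> Z) : hausdorff_space Y ->
    continuous f -> continuous g -> (forall a, exists x, f x = a) ->
    (forall x y, f x = f y -> g x = g y) ->
    exists2 h : Y -> Z, continuous h & forall x, h (f x) = g x.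
  move=> hY cf cg sf fg; have [s sK] := choice sf.
  have hf x : g (s (f x)) = g x by apply: fg.
  exists (g \o s) => //=; apply/continuous_closedP => D cD.
  suff -> : (g \o s) @^-1` D = f @` (g @^-1` D).
    apply: compact_closed => //; apply: continuous_compact.
      exact: continuous_subspaceT.
    by apply: (@subclosed_compact _ _ setT) => //; exact: (iffLR (continuous_closedP g)).
  apply/seteqP; split=> [a Da|_ [x Dx <-]] /=; first by exists (s a).
  by rewrite hf.
have [h ch hE] := factor _ _ p q hA cp cq sp (fun x y => iffLR (pq x y)).
have [k ck kE] := factor _ _ q p hB cq cp sq (fun x y => iffRL (pq x y)).
exists h => //; split=> //; exists k; split=> //.
  by move=> a; have [x <-] := sp a; rewrite hE kE.
by move=> b; have [x <-] := sq b; rewrite kE hE.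
Qed.

Lemma continuous_set_type (X Y : topologicalType) (A : set Y) (f : X -> A) :
  continuous (fun x => set_val (f x)) -> continuous f.
Proof. exact: (@continuous_comp_initial _ _ _ (set_val : A -> Y) f). Qed.

Lemma set_val_continuous (Y : topologicalType) (A : set Y) : continuous (set_val : A -> Y).
Proof. exact: initial_continuous. Qed.

Lemma compact_set_type (Y : topologicalType) (A : set Y) : compact A -> compact [set: A].
Proof.
move=> cA F FF _.
have [|y [Ay cy]] := cA (set_val @ F) (fmap_proper_filter set_val FF).
  by apply: (@filterS _ F _ setT); [move=> x _; exact: set_valP | exact: filterT].
exists (exist _ y (mem_set Ay)); split=> // D E FD [E' [[B oB <-] By] BE].
have [] := cy (set_val @` D) B.
  change (F (set_val @^-1` (set_val @` D))).
  by apply: filterS FD => x Dx; exists x.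
  exact: open_nbhs_nbhs.
by move=> _ [[x Dx <-] Bx]; exists x; split=> //; exact: BE.
Qed.

Lemma continuous_pairing (X Y Z : topologicalType) (f : X -> Y) (g : X -> Z) :
  continuous f -> continuous g -> continuous (fun x => (f x, g x)).
Proof. by move=> cf cg x; apply: cvg_pair; [exact: cf | exact: cg]. Qed.

Lemma continuous_compose (X Y Z : topologicalType) (f : X -> Y) (g : Y -> Z) :
  continuous f -> continuous g -> continuous (fun x => g (f x)).
Proof. by move=> cf cg x; apply: continuous_comp; [exact: cf | exact: cg]. Qed.

Lemma continuous_prod_topology (X : topologicalType) (I : Type) (T : I -> topologicalType)
  (f : X -> prod_topology T) : (forall i, continuous (fun x => f x i)) -> continuous f.
Proof.
move=> cf x; apply/cvg_sup => i.
exact: (@continuous_comp_initial _ _ _ (fun g : prod_topology T => g i) f (cf i)).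
Qed.

Lemma continuous_mx (X T : topologicalType) m n (f : X -> 'M[T]_(m, n)) :
  (forall i j, continuous (fun x => f x i j)) -> continuous f.
Proof.
move=> cf x A [P /= xP PA].
have : \forall y \near x, forall ij : 'I_m * 'I_n, P ij.1 ij.2 (f y ij.1 ij.2).
  by apply: filter_forall => -[i j]; exact: (cf i j x _ (xP i j)).
by apply: filterS => y Py; apply: PA => i j; exact: (Py (i, j)).
Qed.

Lemma compact_mx (T : topologicalType) m n (D : set T) : compact D ->
  compact [set M : 'M[T]_(m, n) | forall i j, D (M i j)].
Proof.
move=> cD.
have := @tychonoff ('I_m * 'I_n)%type (fun=> T) (fun=> D) (fun=> cD).
pose f (g : prod_topology (fun _ : 'I_m * 'I_n => T)) : 'M[T]_(m, n) := \matrix_(i, j) g (i, j).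
move=> cP; have := @continuous_compact _ _ f _ _ cP.
have -> : [set M : 'M[T]_(m, n) | forall i j, D (M i j)] =
    f @` [set g | forall i, D (g i)].
  apply/seteqP; split=> [M DM|_ [g Dg <-] i j] /=; last by rewrite mxE; exact: Dg.
  exists (fun ij => M ij.1 ij.2); first by move=> [i j]; exact: DM.
  by apply/matrixP => i j; rewrite mxE.
apply; apply: continuous_subspaceT; apply: continuous_mx => i j.
rewrite (_ : (fun x => _) = fun x => x (i, j)); first exact: proj_continuous.
by apply/funext => x; rewrite mxE.
Qed.

Section Scalars.
Variables (C : numFieldType) (X : topologicalType).
Implicit Types f g : X -> C.

Lemma continuous_addf f g : continuous f -> continuous g -> continuous (fun x => f x + g x).
Proof. by move=> cf cg x; apply: cvgD; [exact: cf | exact: cg]. Qed.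

Lemma continuous_oppf f : continuous f -> continuous (fun x => - f x).
Proof. by move=> cf x; apply: cvgN; exact: cf. Qed.

Lemma continuous_mulf f g : continuous f -> continuous g -> continuous (fun x => f x * g x).
Proof. by move=> cf cg x; apply: cvgM; [exact: cf | exact: cg]. Qed.

Lemma continuous_constant (c : C) : continuous (fun _ : X => c).
Proof. by move=> x; exact: cvg_cst. Qed.

Lemma continuous_sum (I : Type) (r : seq I) (P : pred I) (f : I -> X -> C) :
  (forall i, continuous (f i)) -> continuous (fun x => \sum_(i <- r | P i) f i x).
Proof.
move=> cf x; apply: (@cvg_big _ _ +%R) => [|i _]; first exact: add_continuous.
exact: cf.
Qed.

Lemma continuous_prod (I : Type) (r : seq I) (P : pred I) (f : I -> X -> C) :
  (forall i, continuous (f i)) -> continuous (fun x => \prod_(i <- r | P i) f i x).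
Proof.
by move=> cf x; exact: (@cvg_big C I *%R 1 P (@mul_continuous C) X (nbhs x) r f
  (fun i => f i x) _ (fun i _ => cf i x)).
Qed.

Definition mx_cont m n (F : X -> 'M[C]_(m, n)) := forall i j, continuous (fun x => F x i j).

Lemma mx_cont_cst m n (A : 'M[C]_(m, n)) : mx_cont (fun=> A).
Proof. by move=> i j; exact: continuous_constant. Qed.

Lemma mx_cont_mul m n p (F : X -> 'M[C]_(m, n)) (G : X -> 'M[C]_(n, p)) :
  mx_cont F -> mx_cont G -> mx_cont (fun x => F x *m G x).
Proof.
move=> cF cG i j; rewrite (_ : (fun x => _) = fun x => \sum_k F x i k * G x k j).
  by apply: continuous_sum => k; exact: continuous_mulf.
by apply/funext => x; rewrite mxE.
Qed.

Lemma continuous_det n (F : X -> 'M[C]_n) : mx_cont F -> continuous (fun x => \det (F x)).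
Proof.
move=> cF; apply: continuous_sum => s; apply: continuous_mulf; first exact: continuous_constant.
by apply: continuous_prod => i; exact: cF.
Qed.

(** Cramer's rule: the entries are cofactors divided by the determinant. *)
Lemma mx_cont_invmx n (F : X -> 'M[C]_n) : mx_cont F -> (forall x, F x \in unitmx) ->
  mx_cont (fun x => invmx (F x)).
Proof.
move=> cF uF i j.
rewrite (_ : (fun x => _) = fun x => (\det (F x))^-1 * cofactor (F x) j i); last first.
  by apply/funext => x; rewrite /invmx uF !mxE.
apply: continuous_mulf.
  move=> x; apply: cvgV; last exact: continuous_det.
  by have := uF x; rewrite unitmxE unitfE.
apply: continuous_mulf; first exact: continuous_constant.
apply: continuous_det => k l.
rewrite (_ : (fun x => _) = fun x => F x (lift j k) (lift i l)) //.
by apply/funext => x; rewrite !mxE.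
Qed.

Lemma closed_eq_scalar f g : continuous f -> continuous g -> closed [set x | f x = g x].
Proof.
move=> cf cg; rewrite (_ : [set x | _] = (fun x => f x - g x) @^-1` [set 0]).
  apply: (iffLR (continuous_closedP _)); last first.
    apply: compact_closed; last exact: compact_set1.
    exact: norm_hausdorff.
  by apply: continuous_addf => //; exact: continuous_oppf.
by apply/seteqP; split=> x /=; [move=> ->; rewrite subrr | move/eqP; rewrite subr_eq0 => /eqP].
Qed.

Lemma closed_eq_mx m n (F G : X -> 'M[C]_(m, n)) : mx_cont F -> mx_cont G ->
  closed [set x | F x = G x].
Proof.
move=> cF cG; rewrite (_ : [set x | _] = \bigcap_(ij : 'I_m * 'I_n)
    [set x | F x ij.1 ij.2 = G x ij.1 ij.2]).
  by apply: closed_bigI => ij _; exact: closed_eq_scalar.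
apply/seteqP; split=> x /=; first by move=> FG ij _ /=; rewrite FG.
by move=> FG; apply/matrixP => i j; exact: (FG (i, j)).
Qed.

Lemma closed_forall (J : Type) (P : J -> X -> Prop) :
  (forall i, closed [set x | P i x]) -> closed [set x | forall i, P i x].
Proof.
move=> cP; rewrite (_ : [set x | _] = \bigcap_i [set x | P i x]).
  by apply: closed_bigI => i _; exact: cP.
by apply/seteqP; split=> x H i; [move=> _; exact: H | exact: (H i I)].
Qed.

End Scalars.

Section Conj.
Variables (C : numClosedFieldType) (X : topologicalType).

Lemma continuous_conj (f : X -> C) : continuous f -> continuous (fun x => (f x)^*%R).
Proof.
move=> cf; apply: (continuous_compose cf) => z.
apply/(@cvgrPdist_lt C C^o _ (nbhs z) (nbhs_filter z)) => e e0.
apply/nbhs_normP; exists e => // w /= zw.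
by rewrite -rmorphB norm_conjC.
Qed.

Lemma mx_cont_adj m n (F : X -> 'M[C]_(m, n)) : mx_cont F ->
  mx_cont (fun x => (F x)^t*%sesqui).
Proof.
move=> cF i j; rewrite (_ : (fun x => _) = fun x => (F x j i)^*%R).
  exact: continuous_conj.
by apply/funext => x; rewrite !mxE.
Qed.

(** In the partial order of a complex field, being nonnegative is the equation |z| = z, which makes
    it a closed condition. *)
Lemma closed_ge0 (f : X -> C) : continuous f -> closed [set x | 0 <= f x].
Proof.
move=> cf; rewrite (_ : [set x | _] = [set x | `|f x| = f x]).
  by apply: closed_eq_scalar => //; exact: (continuous_compose cf (@norm_continuous _ _)).
by apply/seteqP; split=> x /=; rewrite ger0_def => /eqP.
Qed.

End Conj.

Section ComplexCompact.
Variable R : realType.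
(* The topology is attached to the carrier of a [numClosedFieldType]. *)
Local Notation C := (R[i] : numClosedFieldType).

Lemma continuous_real_complex : continuous ((fun a => a%:C%C) : R -> C).
Proof.
move=> a; apply/(@cvgrPdist_lt C C^o _ (nbhs a) (nbhs_filter a)) => -[e e'].
rewrite ltcE /= => /andP[/eqP -> e0].
apply/nbhs_normP; exists e => // b /= ab.
by rewrite -rmorphB normc_def /= expr0n addr0 sqrtr_sqr ltcE /= eqxx.
Qed.

Lemma compact_unit_disc : compact [set z : C | `|z| <= 1].
Proof.
pose f (p : R * R) : C := (p.1)%:C%C + (p.2)%:C%C * 'i%C.
have fE (p : R * R) : f p = Complex p.1 p.2.
  case: p => a b; rewrite /f; apply/eqP.
  by rewrite eq_complex /= !mul0r !mulr0 mulr1 subr0 !addr0 add0r !eqxx.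
apply: (@subclosed_compact _ _ (f @` (`[(-1 : R), 1] `*` `[(-1 : R), 1]))).
- rewrite (_ : [set z | _] = [set z : C | 0 <= 1 - `|z|]).
    apply: closed_ge0; apply: continuous_addf; first exact: continuous_constant.
    apply: continuous_oppf; exact: (@norm_continuous C C^o).
  by apply/seteqP; split=> z /=; rewrite subr_ge0.
- apply: continuous_compact; last by apply: compact_setX; exact: segment_compact.
  apply: continuous_subspaceT; apply: continuous_addf.
    by apply: (@continuous_compose _ _ _ fst _ _ continuous_real_complex) => x; exact: cvg_fst.
  apply: continuous_mulf; last exact: continuous_constant.
  by apply: (@continuous_compose _ _ _ snd _ _ continuous_real_complex) => x; exact: cvg_snd.
- move=> [a b] /=; rewrite normc_def lecE /= => /andP[_ s1].
  have a2 := sqr_ge0 a; have b2 := sqr_ge0 b.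
  have ab : a ^+ 2 + b ^+ 2 <= 1.
    rewrite -[leLHS]sqr_sqrtr ?addr_ge0 //.
    by rewrite -[leRHS](expr1n _ 2); apply: lerXn2r; rewrite ?nnegrE ?sqrtr_ge0 ?ler01.
  exists (a, b); last exact: fE.
  by split; rewrite /= in_itv /=; apply/andP; split; nra.
Qed.

End ComplexCompact.
End TopologyFacts.

(** * Continuity of the orthogonal projector on the Grassmannian *)

Section OrthogonalProjector.
Local Open Scope ring_scope.
Local Open Scope sesquilinear_scope.
Variable C : numClosedFieldType.

Lemma mulmx_adj_eq0 m n (A : 'M[C]_(m, n)) : A *m A^t* = 0 -> A = 0.
Proof.
move=> A0; apply/matrixP => i j; rewrite mxE.
have := congr1 (fun (M : 'M[C]_m) => M i i) A0; rewrite !mxE => /eqP.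
rewrite psumr_eq0 => [|k _]; last by rewrite !mxE -normCK exprn_ge0.
move=> /allP /(_ j (mem_index_enum j)); rewrite /= !mxE -normCK.
by rewrite expf_eq0 /= normr_eq0 => /eqP.
Qed.

Lemma gram_unit m n (A : 'M[C]_(m, n)) : row_free A -> A *m A^t* \in unitmx.
Proof.
move=> fA; rewrite -row_free_unit; apply: inj_row_free => v v0.
apply: (row_free_inj fA); rewrite mul0mx; apply: mulmx_adj_eq0.
by rewrite trmx_mul map_mxM mulmxA -[v *m A *m _]mulmxA v0 mul0mx.
Qed.

(** The Gram matrix inverse allows frames that are not orthonormal, as the Stiefel spaces of the
    Grassmannian do, and keeps the entries continuous in A. *)
Definition orthoproj m n (A : 'M[C]_(m, n)) : 'M[C]_n :=
  A^t* *m invmx (A *m A^t*) *m A.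

Section Orthoproj.
Variables (m n : nat) (A : 'M[C]_(m, n)).
Hypothesis fA : row_free A.

Lemma mul_orthoproj : A *m orthoproj A = A.
Proof. by rewrite /orthoproj !mulmxA mulmxV ?mul1mx // gram_unit. Qed.

Lemma sub_orthoproj p (x : 'M[C]_(p, n)) : (x <= A)%MS -> x *m orthoproj A = x.
Proof. by move=> /submxP [c ->]; rewrite -mulmxA mul_orthoproj. Qed.

Lemma orthoproj_sub : (orthoproj A <= A)%MS.
Proof. exact: submxMl. Qed.

Lemma orthoproj_adj : (orthoproj A)^t* = orthoproj A.
Proof.
rewrite /orthoproj !trmx_mul !map_mxM /= map_trmx -!map_mx_comp.
have -> (k l : nat) (M : 'M[C]_(k, l)) : map_mx (Num.conj \o Num.conj) M = M.
  by apply/matrixP => i j; rewrite mxE /= conjCK.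
rewrite trmxK mulmxA trmx_inv map_invmx; congr (_ *m invmx _ *m _).
by rewrite trmx_mul map_mxM /= map_trmx trmxK -map_mx_comp; congr (_ *m _);
  apply/matrixP => i j; rewrite !mxE /= conjCK.
Qed.

Lemma orthoproj_idem : orthoproj A *m orthoproj A = orthoproj A.
Proof. by rewrite sub_orthoproj // orthoproj_sub. Qed.

End Orthoproj.

(** Each projector absorbs the other, P Q = P and Q P = Q; taking the adjoint of the second gives P
    Q = Q. *)
Lemma orthoproj_eqmx m p n (A : 'M[C]_(m, n)) (B : 'M[C]_(p, n)) :
  row_free A -> row_free B -> (A :=: B)%MS -> orthoproj A = orthoproj B.
Proof.
move=> fA fB AB.
have PQ : orthoproj A *m orthoproj B = orthoproj A.
  by rewrite sub_orthoproj // -AB orthoproj_sub.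
have QP : orthoproj B *m orthoproj A = orthoproj B.
  by rewrite sub_orthoproj // AB orthoproj_sub.
rewrite -[RHS](orthoproj_adj B) -QP trmx_mul map_mxM !orthoproj_adj.
by rewrite PQ.
Qed.

(** Idempotency leaves no freedom of scale. Used where the separating functions determine a
    projector only up to a scalar. *)
Lemma idempotent_scale_eq n (P Q : 'M[C]_n) a b : P *m P = P -> Q *m Q = Q -> P != 0 ->
  a != 0 -> a *: P = b *: Q -> P = Q.
Proof.
move=> PP QQ P0 a0 aPbQ; pose l := b / a.
have PE : P = l *: Q.
  by rewrite /l mulrC -scalerA -aPbQ scalerA mulVf // scale1r.
have l1 : (l - 1) *: P = 0.
  rewrite scalerBl scale1r -{2}PP {2 3}PE -scalemxAl -scalemxAr QQ PE.
  by rewrite subrr.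
move/eqP: l1; rewrite scaler_eq0 (negbTE P0) orbF subr_eq0 => /eqP l1.
by rewrite PE l1 scale1r.
Qed.

End OrthogonalProjector.

(** * Coordinates on the Grassmannian of z^(-r) K_+ / z^r K_+ *)

Section GrassmannianCoordinates.
Local Open Scope classical_set_scope.
Local Open Scope ring_scope.
Variable R : realType.
Local Notation C := (R[i] : numClosedFieldType).
Local Notation K := {ffun 'I_2 -> L2 R}.
Variables (n r : nat).
Hypothesis hN : n.+1 = (2 * r)%N.
Local Notation N := n.+1.
Local Notation mr := (- r%:Z).
Local Notation FQ := (F_quot R r).
Local Notation coef := (@coef R n r).
Local Notation vecK := (@vecK R n r).

Definition qcoord (q : FQ) : 'rV[C]_(N * 2) := mxvec (coef (qrep q)).

Definition qvec (v : 'rV[C]_(N * 2)) : FQ := qclass (zKplus R r) (vecK_in r (vec_mx v)).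

Lemma coef_congr (f g : K) : zKplus R r (f - g) -> coef f = coef g.
Proof.
move=> fg; apply/eqP; rewrite -subr_eq0 -coef_subr; apply/eqP.
by apply/(coef_eq0 hN) => //; apply: zKplus_sub fg; lia.
Qed.

Lemma qcoord_class f (fr : zKplus R mr f) : qcoord (qclass (zKplus R r) fr) = mxvec (coef f).
Proof. by congr mxvec; apply: coef_congr; exact: qrep_class. Qed.

Lemma qvecK : cancel qvec qcoord.
Proof. by move=> v; rewrite qcoord_class coef_vecK vec_mxK. Qed.

Lemma qcoord_inj : injective qcoord.
Proof.
move=> p q /(can_inj mxvecK) pq; rewrite -(qrepK p) -(qrepK q); apply: qclass_eq.
apply/(coef_eq0 hN); first by apply: (linsubB (W := zKplus R mr)); exact: qrepP.
by rewrite coef_subr pq subrr.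
Qed.

Lemma qcoordK : cancel qcoord qvec.
Proof. by move=> q; apply: qcoord_inj; rewrite qvecK. Qed.

Lemma qcoordZD : linear_op qcoord.
Proof.
move=> a p q; rewrite /qcoord -linearP -coefZD; congr mxvec; apply: coef_congr.
have := qrep_class (zKplus R r) (linsubZD a (qrepP p) (qrepP q)).
by rewrite (qclassZD _ (qrepP p) (qrepP q)) !qrepK.
Qed.

Lemma qcoord_sum (I : finType) (c : I -> C) (w : I -> FQ) :
  qcoord (\sum_i c i *: w i) = \sum_i c i *: qcoord (w i).
Proof. exact: linear_op_sum c w qcoordZD. Qed.

Definition qbasis (j : 'I_(N * 2)) : FQ := qvec (delta_mx 0 j).

Lemma qcoord_frame m d (b : 'I_d -> FQ) (A : 'M[C]_(m, d)) i :
  qcoord (frame b A i) = row i A *m (\matrix_j qcoord (b j)).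
Proof.
rewrite qcoord_sum mulmx_sum_row; apply: eq_bigr => j _.
by rewrite rowK mxE.
Qed.

Lemma qbasis_mx : \matrix_j qcoord (qbasis j) = 1%:M.
Proof. by apply/row_matrixP => j; rewrite rowK qvecK row1. Qed.

Lemma qbasis_basis : lin_basis qbasis.
Proof.
split=> [c c0 i|].
  have := congr1 qcoord c0; rewrite qcoord_sum (linear_op0 qcoordZD).
  under eq_bigr => j _ do rewrite qvecK.
  move=> c0'; have : \row_j c j = 0.
    by rewrite -[RHS]c0' [LHS]row_sum_delta; apply: eq_bigr => j _; rewrite mxE.
  by move=> /rowP /(_ i); rewrite !mxE.
apply/seteqP; split=> // q _; exists (fun j => qcoord q 0 j).
apply: qcoord_inj; rewrite qcoord_sum {1}[qcoord q]row_sum_delta.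
by apply: eq_bigr => j _; rewrite qvecK.
Qed.

Definition spans (G : linsub FQ) p (A : 'M[C]_(p, N * 2)) :=
  forall q, G q <-> (qcoord q <= A)%MS.

Lemma spans_ex (G : linsub FQ) : exists A : 'M[C]_(N * 2), spans G A.
Proof.
have [|A AP] := @linear_set_mx R[i] (N * 2) [set v | G (qvec v)].
  split=> [|a u v Gu Gv] /=.
    rewrite (_ : qvec 0 = 0); first exact: linsub0.
    by apply: qcoord_inj; rewrite qvecK (linear_op0 qcoordZD).
  rewrite (_ : qvec _ = a *: qvec u + qvec v); first exact: linsubZD.
  by apply: qcoord_inj; rewrite qcoordZD !qvecK.
by exists A => q; rewrite -(AP (qcoord q)) /= qcoordK.
Qed.

(** An arbitrary choice; the projector [grass_proj] built from it depends on the subspace alone. *)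
Definition grass_mx (G : linsub FQ) : 'M[C]_(N * 2) := projT1 (cid (spans_ex G)).

Lemma grass_mxP G : spans G (grass_mx G).
Proof. exact: projT2 (cid (spans_ex G)). Qed.

Definition grass_proj (G : grass FQ) : 'M[C]_(N * 2) := orthoproj (row_base (grass_mx G)).

Lemma grass_projE (G : linsub FQ) p (A : 'M[C]_(p, N * 2)) :
  row_free A -> spans G A -> grass_proj G = orthoproj A.
Proof.
move=> fA GA; apply: orthoproj_eqmx => //; first exact: row_base_free.
apply: eqmx_trans (eq_row_base _) _; apply/eqmxP/rV_eqP => v.
have GE := grass_mxP G; apply/idP/idP; rewrite -[v]qvecK => vA.
  by apply: (iffLR (GA _)); exact: (iffRL (GE _)).
by apply: (iffLR (GE _)); exact: (iffRL (GA _)).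
Qed.

Lemma span_spans k (w : 'I_k -> FQ) : spans (span_sub w) (\matrix_i qcoord (w i)).
Proof.
move=> q; split=> [[c ->]|/submxP [c qE]].
  rewrite qcoord_sum; apply: summx_sub => i _; apply: scalemx_sub.
  by rewrite -[qcoord (w i)](rowK (fun i => qcoord (w i))) row_sub.
exists (fun i => c 0 i); apply: qcoord_inj; rewrite qE qcoord_sum mulmx_sum_row.
by apply: eq_bigr => i _; rewrite rowK.
Qed.

Lemma qcoord_indep k (w : 'I_k -> FQ) : lin_indep w -> row_free (\matrix_i qcoord (w i)).
Proof.
move=> wi; apply: inj_row_free => v v0; apply/rowP => i; rewrite mxE.
apply: (wi (fun i => v 0 i)); apply: qcoord_inj; rewrite qcoord_sum (linear_op0 qcoordZD) -[RHS]v0.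
by rewrite mulmx_sum_row; apply: eq_bigr => j _; rewrite rowK.
Qed.

(** The Grassmannian carries a final topology, so continuity is tested on frames, where the
    projector is a formula in the frame. *)
Lemma grass_proj_continuous i j :
  continuous ((fun G => grass_proj G i j) : grass FQ -> C).
Proof.
apply/continuousP => U oU.
change (grass_open ((fun G : grass FQ => grass_proj G i j) @^-1` U)) => d b _ k.
rewrite -comp_preimage; apply: (iffLR (continuousP _)) oU.
(* Frames are given in an arbitrary basis b; B converts them to Fourier coefficients. *)
pose B := \matrix_j qcoord (b j) : 'M[C]_(d, N * 2).
have E (t : stiefel k b) : \matrix_i qcoord (frame b (set_val t) i) = set_val t *m B.
  by apply/row_matrixP => l; rewrite rowK qcoord_frame row_mul.
have ft (t : stiefel k b) : row_free (set_val t *m B).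
  by rewrite -E; apply: qcoord_indep; exact: (set_valP t).
rewrite (_ : _ \o _ = fun t : stiefel k b => orthoproj (set_val t *m B) i j); last first.
  apply/funext => t /=; rewrite (grass_projE (ft t)) // -E.
  exact: span_spans.
have cA : mx_cont (fun t : stiefel k b => set_val t *m B).
  apply: mx_cont_mul; last exact: mx_cont_cst.
  move=> k' l; apply: (@continuous_compose _ _ _ (fun t : stiefel k b => set_val t)
    (fun (M : 'M[C]__) => M k' l)).
    exact: set_val_continuous.
  exact: coord_continuous.
apply: mx_cont_mul => //; apply: mx_cont_mul; first exact: mx_cont_adj.
apply: mx_cont_invmx; last by move=> t; exact: gram_unit.
by apply: mx_cont_mul => //; exact: mx_cont_adj.
Qed.

Lemma quot_sub_spans p (A : 'M[C]_(p, N * 2)) :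
  spans (quot_sub (zKplus R mr) (zKplus R r) (subK r A)) A.
Proof.
move=> q; split=> [[w [wr wA] /qset_rep wq]|qA].
  by rewrite /qcoord -(coef_congr wq).
exists (qrep q); first by split; [exact: qrepP | exact: qA].
by apply: rep_qset; rewrite subrr; exact: (linsub0 (zKplus R r)).
Qed.

Lemma frame_indep p (A : 'M[C]_(p, N * 2)) : row_free A -> lin_indep (frame qbasis A).
Proof.
move=> fA c c0; have := congr1 qcoord c0; rewrite qcoord_sum (linear_op0 qcoordZD).
under eq_bigr => i _ do rewrite qcoord_frame qbasis_mx mulmx1.
move=> cA i; have : (\row_i c i) *m A = 0.
  by rewrite mulmx_sum_row -[RHS]cA; apply: eq_bigr => j _; rewrite mxE.
by rewrite -(mul0mx _ A) => /(row_free_inj fA) /rowP /(_ i); rewrite !mxE.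
Qed.

Lemma span_frame_subK p (A : 'M[C]_(p, N * 2)) :
  span_sub (frame qbasis A) = quot_sub (zKplus R mr) (zKplus R r) (subK r A).
Proof.
have AE : \matrix_i qcoord (frame qbasis A i) = A.
  by apply/row_matrixP => l; rewrite rowK qcoord_frame qbasis_mx mulmx1.
apply: linsub_eq; apply/seteqP; split=> q.
  by move=> /span_spans; rewrite AE => /quot_sub_spans.
by move=> /quot_sub_spans qA; apply/span_spans; rewrite AE.
Qed.

Lemma grass_proj_subK p (A : 'M[C]_(p, N * 2)) (W : F R r) : row_free A ->
  val W = subK r A -> grass_proj (F_to_grass W) = orthoproj A.
Proof.
move=> fA WA; apply: grass_projE => //; rewrite /F_to_grass set_valE WA.
exact: quot_sub_spans.
Qed.

End GrassmannianCoordinates.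

(** * Incident pairs *)

Section CollapseFacts.
Local Open Scope classical_set_scope.
Local Open Scope quotient_scope.
Variables (T : topologicalType) (A : set T).

Lemma collapse_piP x y : collapse_pi A x = collapse_pi A y <-> x = y \/ (A x /\ A y).
Proof.
split=> [/eqmodP/orP[/eqP ->|/andP[/set_mem Ax /set_mem Ay]]|]; [by left|by right|].
move=> xy; apply/eqmodP; apply/orP; case: xy => [->|[Ax Ay]]; first by left.
by right; apply/andP; split; exact: mem_set.
Qed.

Lemma collapse_pi_repr (q : collapse A) :
  collapse_pi A (repr (q : {eq_quot collapse_rel A})) = q.
Proof. exact: (@reprK _ {eq_quot collapse_rel A} q). Qed.

Lemma collapse_pi_continuous : continuous (collapse_pi A).
Proof. exact: (@pi_continuous T {eq_quot collapse_rel A}). Qed.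

Lemma collapse_mapE (f : T -> T) x : (forall x, A x -> A (f x)) ->
  collapse_map f (collapse_pi A x) = collapse_pi A (f x).
Proof.
move=> fA; apply/collapse_piP.
have /collapse_piP [->|[Ax Ay]] := collapse_pi_repr (collapse_pi A x); first by left.
by right; split; exact: fA.
Qed.

Section Lift.
Variables (U : topologicalType) (f : T -> U).
Hypothesis fA : forall x y, A x -> A y -> f x = f y.

Definition collapse_lift (q : collapse A) : U := f (repr (q : {eq_quot collapse_rel A})).

Lemma collapse_liftE x : collapse_lift (collapse_pi A x) = f x.
Proof.
rewrite /collapse_lift.
by have /collapse_piP [->|[Ax Ay]] := collapse_pi_repr (collapse_pi A x); last exact: fA.
Qed.

Lemma collapse_lift_continuous : continuous f -> continuous collapse_lift.
Proof.
move=> cf; apply/(@quotient_continuous T {eq_quot collapse_rel A}).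
rewrite (_ : _ \o _ = f) //; apply/funext => x; exact: collapse_liftE.
Qed.
End Lift.

End CollapseFacts.

(** * The compact set of incident pairs *)

Section Incidence.
Local Open Scope classical_set_scope.
Local Open Scope ring_scope.
Local Open Scope sesquilinear_scope.
Variables (C : numClosedFieldType) (n : nat).
Local Notation N := n.+1.
Local Notation T := ('M[C]_(N, N * 2) * 'M[C]_(N, 2))%type.

Definition incident p (A : 'M[C]_(p, N * 2)) (y : 'M[C]_(N, 2)) : Prop :=
  forall x, (mxvec x <= A)%MS -> coeff0_prl x y /\ prl x (generator y).

(** Written with equations and one inequality, so that closedness is visible. For orthonormal rows,
    A* A is the projector on the row space, and the second equation says that this space is stable
    under z. *)
Definition incidence : set T := [set x |
  [/\ x.1 *m x.1^t* = 1%:M,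
      x.1 *m zshiftV C n *m x.1^t* *m x.1 = x.1 *m zshiftV C n,
      thom_coord x.2 &
      forall i, coeff0_prl (vec_mx (row i x.1)) x.2 /\
                prl (vec_mx (row i x.1)) (generator x.2)]].

Lemma incident_rows p (A : 'M[C]_(p, N * 2)) y :
  (forall i, coeff0_prl (vec_mx (row i A)) y /\ prl (vec_mx (row i A)) (generator y)) ->
  incident A y.
Proof.
move=> Ay x /submxP [c xE].
have -> : x = \sum_i c 0 i *: vec_mx (row i A).
  apply: (can_inj mxvecK); rewrite xE mulmx_sum_row linear_sum; apply: eq_bigr => i _.
  by rewrite linearZ /= vec_mxK.
split=> i j.
  rewrite !summxE !mulr_sumr; apply: eq_bigr => k _; have xy := (Ay k).1 i j.
  have cE l : (c 0 k *: vec_mx (row k A)) 0 l = c 0 k * vec_mx (row k A) 0 l by rewrite [LHS]mxE.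
  by rewrite !cE mulrCA xy mulrCA.
have colS l : col l (\sum_i c 0 i *: vec_mx (row i A)) = \sum_i c 0 i *: col l (vec_mx (row i A)).
  by rewrite linear_sum; apply: eq_bigr => k _; rewrite linearZ.
rewrite !colS !mulmx_sumr; apply: eq_bigr => k _.
by rewrite -!scalemxAr (Ay k).2.
Qed.

Lemma incidenceP (A : 'M[C]_(N, N * 2)) y : incidence (A, y) <->
  [/\ A \is unitarymx, stablemx A (zshiftV C n), thom_coord y & incident A y].
Proof.
split=> [[/= uA sA ty Ay]|[uA sA ty Ay]]; split=> //.
- exact/unitarymxP.
- by apply/submxP; exists (A *m zshiftV C n *m A^t*).
- exact: incident_rows.
- exact/unitarymxP.
- by move: sA => /= /submxP [D ->]; rewrite -(mulmxA D) (unitarymxP uA) mulmx1.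
- by move=> i /=; apply: Ay; rewrite vec_mxK row_sub.
Qed.

Let mc1 : mx_cont (fun x : T => x.1).
Proof.
move=> i j; apply: (@continuous_compose _ _ _ fst (fun (M : 'M[C]_(N, N * 2)) => M i j)).
  by move=> x; exact: cvg_fst.
exact: coord_continuous.
Qed.

Let mc2 : mx_cont (fun x : T => x.2).
Proof.
move=> i j; apply: (@continuous_compose _ _ _ snd (fun (M : 'M[C]_(N, 2)) => M i j)).
  by move=> x; exact: cvg_snd.
exact: coord_continuous.
Qed.

Section Cont.
Variable X : topologicalType.

Lemma continuous_rdot (F : X -> 'M[C]_(N, 2)) k l : mx_cont F ->
  continuous (fun x => rdot (F x) k l).
Proof.
move=> cF; apply: (@continuous_sum _ _ _ _ _ (fun j x => F x k j * (F x l j)^*)) => j.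
by apply: continuous_mulf; [exact: cF | exact: continuous_conj].
Qed.

Lemma continuous_defect (F : X -> 'M[C]_(N, 2)) : mx_cont F ->
  continuous (fun x => defect (F x)).
Proof.
move=> cF; apply: continuous_addf; first exact: continuous_constant.
by apply: continuous_oppf; apply: continuous_sum => k; exact: continuous_rdot.
Qed.

Lemma mx_cont_generator (F : X -> 'M[C]_(N, 2)) : mx_cont F ->
  mx_cont (fun x => generator (F x)).
Proof.
move=> cF k j; rewrite (_ : (fun x => _) =
    fun x => if k == 0 then defect (F x) * F x 0 j else F x k j); last first.
  by apply/funext => x; rewrite mxE.
have [_|_] := eqVneq k 0; last exact: cF.
by apply: continuous_mulf; [exact: continuous_defect | exact: cF].
Qed.

Lemma mx_cont_toep (F : X -> 'cV[C]_N) : mx_cont F -> mx_cont (fun x => toep (F x)).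
Proof.
move=> cF i j; rewrite (_ : (fun x => _) =
    fun x => \sum_(b < N) F x b 0 * (i == (j + b)%N :> nat)%:R); last first.
  by apply/funext => x; rewrite toepE.
by apply: continuous_sum => b; apply: continuous_mulf; [exact: cF | exact: continuous_constant].
Qed.

Lemma mx_cont_col m p (F : X -> 'M[C]_(m, p)) j : mx_cont F -> mx_cont (fun x => col j (F x)).
Proof.
move=> cF k l; rewrite (_ : (fun x => _) = fun x => F x k j); first exact: cF.
by apply/funext => x; rewrite mxE.
Qed.

End Cont.

Lemma incidence_closed : closed incidence.
Proof.
have cr i : mx_cont (fun x : T => vec_mx (row i x.1) : 'M[C]_(N, 2)).
  move=> k j; rewrite (_ : (fun x : T => _) = fun x : T => x.1 i (mxvec_index k j)).
    exact: mc1.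
  by apply/funext => x; rewrite !mxE.
have -> : incidence = [set x : T | x.1 *m x.1^t* = 1%:M] `&`
   [set x : T | x.1 *m zshiftV C n *m x.1^t* *m x.1 = x.1 *m zshiftV C n] `&`
   ([set x : T | rdot x.2 0 0 = 1] `&` [set x : T | forall k, k != 0 -> rdot x.2 k 0 = 0] `&`
     [set x : T | 0 <= defect x.2]) `&`
   ([set x : T | forall i, coeff0_prl (vec_mx (row i x.1)) x.2] `&`
    [set x : T | forall i, prl (vec_mx (row i x.1)) (generator x.2)]).
  apply/seteqP; split=> x.
    by case=> a b [c d e] f; split; [split; [split|split; [split|]]|split=> i; have [] := f i].
  by case=> [[[a b] [[c d] e]] [f g]].
apply: closedI; last first.
  apply: closedI.
    do 3!apply: closed_forall => ?; apply: closed_eq_scalar; apply: continuous_mulf; try exact: mc2;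
      exact: cr.
  do 3!apply: closed_forall => ?; apply: closed_eq_mx; apply: mx_cont_mul;
    try (apply: mx_cont_toep; apply: mx_cont_col; exact: mx_cont_generator);
    apply: mx_cont_col; exact: cr.
apply: closedI.
  apply: closedI; first apply: closed_eq_mx.
  - by apply: mx_cont_mul => //; exact: mx_cont_adj.
  - exact: mx_cont_cst.
  - have cz : mx_cont (fun x : T => x.1 *m zshiftV C n).
      by apply: mx_cont_mul => //; exact: mx_cont_cst.
    apply: closed_eq_mx => //; apply: mx_cont_mul => //; apply: mx_cont_mul => //.
    exact: mx_cont_adj.
apply: closedI; last by apply: closed_ge0; exact: continuous_defect.
apply: closedI.
  by apply: closed_eq_scalar; [exact: continuous_rdot | exact: continuous_constant].
apply: closed_forall => k; have [->|k0] := eqVneq k 0.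
  by rewrite (_ : [set x | _] = setT); [exact: closedT | apply/seteqP; split].
rewrite (_ : [set x | _] = [set x : T | rdot x.2 k 0 = 0]).
  by apply: closed_eq_scalar; [exact: continuous_rdot | exact: continuous_constant].
by apply/seteqP; split=> x /= H; [exact: H | move=> _; exact: H].
Qed.

Lemma norm_le1_sum (I : finType) (f : I -> C) i : \sum_j f j * (f j)^* <= 1 -> `|f i| <= 1.
Proof.
move=> f1; rewrite -(@ler_pXn2r _ 2) ?nnegrE ?ler01 ?normr_ge0 // expr1n normCK.
apply: le_trans f1; rewrite (bigD1 i) //= lerDl; apply: sumr_ge0 => j _.
by rewrite -normCK exprn_ge0.
Qed.

Lemma incidence_compact : compact [set z : C | `|z| <= 1] -> compact incidence.
Proof.
move=> cC; apply: (@subclosed_compact _ _ (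
  [set M : 'M[C]_(N, N * 2) | forall i j, `|M i j| <= 1] `*`
  [set M : 'M[C]_(N, 2) | forall i j, `|M i j| <= 1])).
- exact: incidence_closed.
- by apply: compact_setX; exact: (@compact_mx C _ _ [set z : C | `|z| <= 1]).
move=> [A y] [/= uA _ [y1 _ dy] _]; split=> /= i j.
  apply: (@norm_le1_sum _ (fun j => A i j)); have := congr1 (fun (M : 'M[C]_N) => M i i) uA.
  rewrite !mxE eqxx mulr1n => aE; rewrite -[leRHS]aE.
  by apply: ler_sum => k _; rewrite !mxE.
apply: (@norm_le1_sum _ (fun j => y i j)); rewrite -/(rdot y i i).
have [->|i0] := eqVneq i 0; first by rewrite y1.
(* Nonnegativity of the defect bounds the sum of all |v_k|^2 by 1. *)
move: dy; rewrite subr_ge0; apply: le_trans; rewrite (bigD1 i) //= lerDl.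
by apply: sumr_ge0 => k _; exact: rdot_ge0.
Qed.

End Incidence.

(** * The Thom space *)

Section ThomParametrization.
Local Open Scope classical_set_scope.
Local Open Scope ring_scope.
Local Open Scope quotient_scope.
Variables (C : numClosedFieldType) (n : nat).
Local Notation N := n.+1.

(** A global object rather than a local chart: with a unit vector u chosen in the line, it covers
    the whole disc bundle, which is its quotient by the circle of phases. *)
Definition thom_chart_set : set 'M[C]_(N, 2) := [set y | thom_coord y].
Definition thom_chart : Type := thom_chart_set.
HB.instance Definition _ := Topological.on thom_chart.

Implicit Types y : thom_chart.

Lemma thom_chartP y : thom_coord (val y).
Proof. exact: set_valP y. Qed.

Definition rowc (y : 'M[C]_(N, 2)) (k : 'I_N) : 'cV[C]_2 := \col_j y k j.

Lemma hdot_rowc (y : 'M[C]_(N, 2)) k l : hdot (rowc y k) (rowc y l) = rdot y k l.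
Proof. by apply: eq_bigr => j _; rewrite !mxE. Qed.

Lemma chart_S3_subproof y : rowc (val y) 0 \in @S3_set C.
Proof. by apply: mem_set; rewrite /S3_set /= hdot_rowc; have [] := thom_chartP y. Qed.
Definition chart_S3 y : S3 C := exist _ (rowc (val y) 0) (chart_S3_subproof y).

Lemma chart_pair_subproof (i : 'I_n) y :
  (rowc (val y) 0, rowc (val y) (lift ord0 i)) \in @tau_pair_set C.
Proof.
apply: mem_set; rewrite /tau_pair_set /= !hdot_rowc; have [y1 yo _] := thom_chartP y.
by split=> //; exact: yo.
Qed.
Definition chart_pair (i : 'I_n) y : tau_pair C :=
  exist _ (rowc (val y) 0, rowc (val y) (lift ord0 i)) (chart_pair_subproof i y).

Lemma chart_sum_subproof y :
  ((P1_pi (chart_S3 y), fun i => tau_pi (chart_pair i y)) :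
    P1 C * prod_topology (fun (_ : 'I_n) => tau C)) \in @tau_sum_set C n.
Proof.
apply: mem_set => i /=; rewrite tau_projE; congr P1_pi; exact: val_inj.
Qed.
Definition chart_sum y : tau_sum C n :=
  exist (fun x => x \in @tau_sum_set C n) _ (chart_sum_subproof y).

Lemma chart_normsq y : tau_sum_normsq (chart_sum y) = 1 - defect (val y).
Proof.
rewrite /defect subKr big_mkcond big_ord_recl /= add0r; apply: eq_bigr => i _.
by rewrite tau_normsqE hdot_rowc.
Qed.

Lemma chart_disc_subproof y : chart_sum y \in [set x : tau_sum C n | tau_sum_normsq x <= 1].
Proof.
by apply: mem_set; rewrite /= chart_normsq gerBl; have [] := thom_chartP y.
Qed.
Definition chart_disc y : disc (@tau_sum_normsq C n) :=
  exist _ (chart_sum y) (chart_disc_subproof y).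

Definition chart_thom y : thom_tau C n := collapse_pi _ (chart_disc y).

Lemma chart_sphere y : sphere (chart_disc y) <-> defect (val y) = 0.
Proof.
rewrite /sphere /= chart_normsq; split=> [/eqP|->]; last by rewrite subr0.
by rewrite subr_eq addrC -subr_eq subrr => /eqP <-.
Qed.

Lemma chart_sum_eq y y' : chart_sum y = chart_sum y' <->
  exists2 a, `|a| = 1 & val y' = a *: val y.
Proof.
split=> [yy'|[a a1 yy']]; last first.
  have rE k : rowc (val y') k = a *: rowc (val y) k.
    by rewrite yy'; apply/colP => j; rewrite !mxE.
  apply: val_inj; rewrite /=; congr pair.
    by apply/P1_piP/asboolP; exists a => //=; rewrite rE.
  by apply/funext => i; apply/tau_piP/asboolP; exists a => //=; rewrite !rE.
have yy1 : P1_pi (chart_S3 y) = P1_pi (chart_S3 y') by rewrite -[LHS]/((val (chart_sum y)).1) yy'.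
have yy2 i : tau_pi (chart_pair i y) = tau_pi (chart_pair i y').
  by rewrite -[LHS]/((val (chart_sum y)).2 i) yy'.
have /P1_piP/asboolP [a a1 /= u'] := yy1.
exists a => //; apply/matrixP => k j; rewrite mxE.
have u'j l : val y' 0 l = a * val y 0 l.
  by have /colP/(_ l) := u'; rewrite !mxE.
case: (unliftP ord0 k) => [i ->|->]; last exact: u'j.
(* Each summand provides its own phase b; it agrees with the phase a from the base because both
   carry the nonzero vector u to u'. *)
have /tau_piP/asboolP [b b1 /= [bu bv]] := yy2 i.
have bvj : val y' (lift ord0 i) j = b * val y (lift ord0 i) j.
  by have /colP/(_ j) := bv; rewrite !mxE.
rewrite bvj; congr (_ * _).
have buj l : a * val y 0 l = b * val y 0 l.
  by rewrite -u'j; have /colP/(_ l) := bu; rewrite !mxE.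
have [y1 _ _] := thom_chartP y.
rewrite -[LHS]mulr1 -[RHS]mulr1 -y1 !mulr_sumr; apply: eq_bigr => l _.
by rewrite !mulrA buj.
Qed.

Lemma chart_thom_eq y y' : chart_thom y = chart_thom y' <->
  (defect (val y) = 0 /\ defect (val y') = 0) \/ exists2 a, `|a| = 1 & val y' = a *: val y.
Proof.
rewrite collapse_piP !chart_sphere; split=> [] [yy'|yy']; [right|by left|by right|left].
  by apply/chart_sum_eq; exact: (congr1 val yy').
by apply: val_inj; exact/chart_sum_eq.
Qed.

Lemma chart_thom_surj (t : thom_tau C n) : exists y, chart_thom y = t.
Proof.
have [d <-] : exists d, collapse_pi (@sphere _ _ (@tau_sum_normsq C n)) d = t.
  by exists (repr (t : {eq_quot _})); exact: collapse_pi_repr.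
suff [y yd] : exists y, chart_sum y = val d.
  by exists y; congr collapse_pi; exact: val_inj.
case: d => x /= /set_mem /= x1.
pose u : S3 C := repr ((val x).1 : {eq_quot @phase_rel C}).
have uE : P1_pi u = (val x).1 by exact: (@reprK _ {eq_quot @phase_rel C}).
(* The representatives chosen in the summands sit over different unit vectors of the same line; each
   is rotated to sit over the common u. *)
have wex (i : 'I_n) : exists v : 'cV[C]_2, exists z (p : tau_pair C),
    [/\ `|z| = 1, tau_pi p = (val x).2 i, val u = z *: (val p).1 & v = z *: (val p).2].
  pose p := tau_repr ((val x).2 i).
  have pE : tau_pi p = (val x).2 i by exact: tau_reprK.
  have : P1_pi (base p) = P1_pi u.
    by rewrite uE -(set_valP x i) -pE tau_projE.
  move=> /P1_piP/asboolP [z z1 zE].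
  by exists (z *: (val p).2), z, p.
have [w wP] := choice wex.
pose y : 'M[C]_(N, 2) := \matrix_(k, j) (if unlift ord0 k is Some i then w i j 0 else val u j 0).
have y0 : rowc y 0 = val u by apply/colP => j; rewrite !mxE unlift_none.
have yl i : rowc y (lift ord0 i) = w i by apply/colP => j; rewrite !mxE liftK.
have ty : thom_coord y.
  split.
  - by rewrite -hdot_rowc y0; exact: (set_valP u).
  - move=> k k0; case: (unliftP ord0 k) k0 => [i ->|->] // _.
    rewrite -hdot_rowc y0 yl; have [z [p [z1 _ -> ->]]] := wP i.
    by rewrite hdot_phase //; have [] := set_valP p.
  - move: x1; rewrite /defect big_mkcond big_ord_recl /= add0r subr_ge0.
    apply: le_trans; rewrite le_eqVlt; apply/orP; left; apply/eqP; apply: eq_bigr => i _.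
    rewrite -hdot_rowc yl; have [z [p [z1 <- _ ->]]] := wP i.
    by rewrite tau_normsqE hdot_phase.
exists (exist _ y (mem_set ty)); apply: val_inj => /=.
rewrite [RHS]surjective_pairing; congr pair.
  by rewrite -uE; congr P1_pi; apply: val_inj.
apply/funext => i; have [z [p [z1 <- uz wz]]] := wP i.
apply/esym/tau_piP/asboolP; exists z => //=.
by rewrite y0 yl uz wz.
Qed.

Lemma mx_cont_chart : mx_cont (fun y : thom_chart => val y).
Proof.
move=> k j; apply: (@continuous_compose _ _ _ (fun y : thom_chart => val y)
  (fun (M : 'M[C]_(N, 2)) => M k j)).
  exact: set_val_continuous.
exact: coord_continuous.
Qed.

Lemma continuous_rowc k : continuous (fun y : thom_chart => rowc (val y) k).
Proof.
apply: continuous_mx => i j; rewrite (_ : (fun y => _) = fun y : thom_chart => val y k i).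
  exact: mx_cont_chart.
by apply/funext => y; rewrite mxE.
Qed.

Lemma chart_thom_continuous : continuous chart_thom.
Proof.
apply: (continuous_compose _ (@collapse_pi_continuous _ _)).
apply: continuous_set_type; apply: continuous_set_type => /=.
apply: continuous_pairing.
  apply: (@continuous_compose _ _ _ chart_S3 (@P1_pi C)).
    by apply: continuous_set_type; exact: continuous_rowc.
  exact: (@pi_continuous _ {eq_quot @phase_rel C}).
apply: continuous_prod_topology => i.
apply: (@continuous_compose _ _ _ (chart_pair i) (@tau_pi C)).
  by apply: continuous_set_type; apply: continuous_pairing; exact: continuous_rowc.
exact: (@pi_continuous _ {eq_quot @tau_rel C}).
Qed.

(** The entries of u u*, the orthogonal projector on the line, which do not depend on the phase of
    u; [tau_tensor] is v u* for the same reason. *)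
Definition P1_proj (i j : 'I_2) (b : P1 C) : C :=
  (val (repr (b : {eq_quot @phase_rel C})) : 'cV[C]_2) i 0 *
  ((val (repr (b : {eq_quot @phase_rel C})) : 'cV[C]_2) j 0)^*.

Definition tau_tensor (i j : 'I_2) (e : tau C) : C :=
  (val (tau_repr e)).2 i 0 * ((val (tau_repr e)).1 j 0)^*.

Lemma phaseM (z a b : C) : `|z| = 1 -> z * a * (z * b)^* = a * b^*.
Proof. by move=> z1; rewrite rmorphM mulrACA -normCK z1 expr1n mul1r. Qed.

Lemma P1_projE i j u : P1_proj i j (P1_pi u) = val u i 0 * (val u j 0)^*.
Proof.
have /P1_piP/asboolP[z z1 e] : P1_pi (repr (P1_pi u : {eq_quot @phase_rel C})) = P1_pi u.
  exact: (@reprK _ {eq_quot @phase_rel C}).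
by rewrite /P1_proj e !mxE phaseM.
Qed.

Lemma tau_tensorE i j p : tau_tensor i j (tau_pi p) = (val p).2 i 0 * ((val p).1 j 0)^*.
Proof.
rewrite /tau_tensor; have /tau_piP/asboolP[z z1 e] := tau_reprK (tau_pi p).
by rewrite e /= !mxE phaseM.
Qed.

Lemma continuous_mul_conj (X : topologicalType) (f g : X -> 'cV[C]_2) i j :
  continuous f -> continuous g -> continuous (fun x => f x i 0 * (g x j 0)^*).
Proof.
move=> cf cg; apply: continuous_mulf.
  exact: (continuous_compose cf (@coord_continuous _ _ _ i 0)).
by apply: continuous_conj; exact: (continuous_compose cg (@coord_continuous _ _ _ j 0)).
Qed.

Lemma P1_proj_continuous i j : continuous (P1_proj i j).
Proof.
apply/(@quotient_continuous _ {eq_quot @phase_rel C}).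
rewrite (_ : _ \o _ = fun u : S3 C => val u i 0 * (val u j 0)^*); last first.
  by apply/funext => u; exact: P1_projE.
by apply: continuous_mul_conj; exact: set_val_continuous.
Qed.

Let cont_fst : continuous (fun p : tau_pair C => (val p).1).
Proof.
apply: (@continuous_compose _ _ _ (fun p : tau_pair C => val p) fst).
  exact: set_val_continuous.
by move=> p; exact: cvg_fst.
Qed.
Let cont_snd : continuous (fun p : tau_pair C => (val p).2).
Proof.
apply: (@continuous_compose _ _ _ (fun p : tau_pair C => val p) snd).
  exact: set_val_continuous.
by move=> p; exact: cvg_snd.
Qed.

Lemma tau_tensor_continuous i j : continuous (tau_tensor i j).
Proof.
apply/(@quotient_continuous _ {eq_quot @tau_rel C}).
rewrite (_ : _ \o _ = fun p : tau_pair C => (val p).2 i 0 * ((val p).1 j 0)^*); last first.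
  by apply/funext => p; exact: tau_tensorE.
by apply: continuous_mul_conj; [exact: cont_snd | exact: cont_fst].
Qed.

Lemma tau_normsq_continuous : continuous (@tau_normsq C).
Proof.
apply/(@quotient_continuous _ {eq_quot @tau_rel C}).
rewrite (_ : _ \o _ = fun p : tau_pair C => \sum_i (val p).2 i 0 * ((val p).2 i 0)^*); last first.
  by apply/funext => p; exact: tau_normsqE.
apply: continuous_sum => i; by apply: continuous_mul_conj; exact: cont_snd.
Qed.

Definition disc_defect (d : disc (@tau_sum_normsq C n)) : C := 1 - tau_sum_normsq (val d).

(** The factor [disc_defect] vanishes on the sphere, so these phase-invariant functions descend to
    the Thom space. *)
Definition disc_tensor (k : 'I_N) (i j : 'I_2) (d : disc (@tau_sum_normsq C n)) : C :=
  disc_defect d * if unlift ord0 k is Some l then tau_tensor i j ((val (val d)).2 l)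
                  else P1_proj i j (val (val d)).1.

Lemma disc_tensorE k i j y :
  disc_tensor k i j (chart_disc y) = defect (val y) * (val y k i * (val y 0 j)^*).
Proof.
rewrite /disc_tensor /disc_defect [X in 1 - X]chart_normsq subKr; congr (_ * _).
case: (unliftP ord0 k) => [l ->|->] /=.
  by rewrite tau_tensorE /= !mxE.
by rewrite P1_projE /= !mxE.
Qed.

Lemma disc_tensor_continuous k i j : continuous (disc_tensor k i j).
Proof.
have cd : continuous (fun d : disc (@tau_sum_normsq C n) => val (val d)).
  by apply: (@continuous_compose _ _ _ (fun d : disc (@tau_sum_normsq C n) => val d)
    (fun x : tau_sum C n => val x)); exact: set_val_continuous.
have c1 : continuous (fun d : disc (@tau_sum_normsq C n) => (val (val d)).1).
  by apply: (continuous_compose cd) => p; exact: cvg_fst.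
have c2 l : continuous (fun d : disc (@tau_sum_normsq C n) => (val (val d)).2 l).
  apply: (@continuous_compose _ _ _ (fun d : disc (@tau_sum_normsq C n) => (val (val d)).2)
    (fun f : prod_topology (fun (_ : 'I_n) => tau C) => f l)).
    by apply: (continuous_compose cd) => p; exact: cvg_snd.
  exact: (@proj_continuous _ (fun (_ : 'I_n) => tau C) l).
apply: continuous_mulf.
  apply: continuous_addf; first exact: continuous_constant.
  apply: continuous_oppf; apply: continuous_sum => l.
  exact: (continuous_compose (c2 l) tau_normsq_continuous).
case: (unliftP ord0 k) => [l _|_].
  exact: (continuous_compose (c2 l) (@tau_tensor_continuous i j)).
exact: (continuous_compose c1 (@P1_proj_continuous i j)).
Qed.

Lemma disc_tensor_sphere k i j d d' : sphere d -> sphere d' ->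
  disc_tensor k i j d = disc_tensor k i j d'.
Proof.
by rewrite /disc_tensor /disc_defect /sphere /= => -> ->; rewrite subrr !mul0r.
Qed.

(** The trace of the block k = 0 recovers s, since |u| = 1. If s is zero the point is the base
    point; otherwise s can be divided out, and the v_k u* and u u* determine (u, v) up to phase. *)
Lemma thom_hausdorff : hausdorff_space (thom_tau C n).
Proof.
pose f (kij : 'I_N * ('I_2 * 'I_2)) : thom_tau C n -> C :=
  collapse_lift (disc_tensor kij.1 kij.2.1 kij.2.2).
have fE kij y : f kij (chart_thom y) =
    defect (val y) * (val y kij.1 kij.2.1 * (val y 0 kij.2.2)^*).
  by rewrite /f collapse_liftE ?disc_tensorE //; exact: disc_tensor_sphere.
apply: (@hausdorff_separated _ C^o _ f).
- exact: norm_hausdorff.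
- move=> kij; exact: (collapse_lift_continuous (@disc_tensor_sphere _ _ _)
    (@disc_tensor_continuous _ _ _)).
move=> t t'; have [y <-] := chart_thom_surj t; have [y' <-] := chart_thom_surj t' => ff.
have E k i j : defect (val y) * (val y k i * (val y 0 j)^*) =
    defect (val y') * (val y' k i * (val y' 0 j)^*).
  by have := ff (k, (i, j)); rewrite !fE.
have [y1 _ _] := thom_chartP y; have [y1' _ _] := thom_chartP y'.
have dE : defect (val y) = defect (val y').
  by rewrite -[LHS]mulr1 -y1 -[RHS]mulr1 -y1' !mulr_sumr; apply: eq_bigr => j _.
apply/chart_thom_eq; have [d0|d0] := eqVneq (defect (val y)) 0.
  by left; rewrite -dE.
(* a = <u', u>: multiplying y' u'* = y u* by u' on the right gives y' = a y. *)
right; pose a := \sum_j val y' 0 j * (val y 0 j)^*.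
have yE : val y' = a *: val y.
  apply/matrixP => k i; rewrite mxE -[LHS]mulr1 -y1' mulr_sumr mulr_suml.
  apply: eq_bigr => j _; have := E k i j; rewrite -dE => /(mulfI d0) e.
  transitivity (val y' k i * (val y' 0 j)^* * val y' 0 j); first by ring.
  by rewrite -e; ring.
exists a => //.
have : `|a| ^+ 2 = 1 by rewrite -y1' yE rdotZ y1 mulr1.
by move=> /eqP; rewrite sqrp_eq1 ?normr_ge0 // => /eqP.
Qed.

Lemma act_chart_thom (g : SU2 C) y y' : val y' = val y *m (val g)^T ->
  act_thom g (chart_thom y) = chart_thom y'.
Proof.
move=> yg; rewrite /act_thom /thom_map collapse_mapE; last first.
  by move=> d; rewrite /sphere /= act_sum_normsq.
congr collapse_pi; apply: val_inj; apply: val_inj => /=.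
have rE k : rowc (val y') k = val g *m rowc (val y) k.
  by apply/colP => j; rewrite yg !mxE; apply: eq_bigr => l _; rewrite !mxE mulrC.
rewrite /act_sum_val /=; congr pair.
  by rewrite actP1E; congr P1_pi; apply: val_inj; rewrite /= rE.
apply/funext => i; rewrite act_tauE; congr tau_pi; apply: val_inj.
by rewrite /= !rE.
Qed.

End ThomParametrization.

(** * The homeomorphism *)

Section IncidenceAction.
Local Open Scope ring_scope.
Variables (C : numClosedFieldType) (n : nat).
Local Notation N := n.+1.
Implicit Types x y w : 'M[C]_(N, 2).

Lemma coeff0_prl_mulmx (g : 'M[C]_2) x y : coeff0_prl x y -> coeff0_prl (x *m g) (y *m g).
Proof.
move=> xy i j; rewrite !mxE !mulr_suml.
under eq_bigr => k _ do rewrite mulr_sumr.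
under [RHS]eq_bigr => k _ do rewrite mulr_sumr.
rewrite exchange_big; apply: eq_bigr => k _; apply: eq_bigr => l _.
by rewrite mulrACA xy; ring.
Qed.

Lemma col_mulmx_sum (g : 'M[C]_2) x i : col i (x *m g) = \sum_k g k i *: col k x.
Proof.
by apply/colP => l; rewrite summxE !mxE; apply: eq_bigr => k _; rewrite !mxE mulrC.
Qed.

Lemma prl_mulmx (g : 'M[C]_2) x w : prl x w -> prl (x *m g) (w *m g).
Proof.
move=> xw i j; rewrite !col_mulmx_sum !toep_sum !mulmx_suml.
under eq_bigr => k _ do rewrite mulmx_sumr.
under [RHS]eq_bigr => k _ do rewrite mulmx_sumr.
rewrite exchange_big; apply: eq_bigr => k _; apply: eq_bigr => l _.
by rewrite -!scalemxAl -!scalemxAr !scalerA xw mulrC.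
Qed.

Lemma rdot_unitary (g : 'M[C]_2) y k l : g \is unitarymx -> rdot (y *m g^T) k l = rdot y k l.
Proof.
move=> Ug; have rE i : rowc (y *m g^T) i = g *m rowc y i.
  by apply/colP => j; rewrite !mxE; apply: eq_bigr => m _; rewrite !mxE mulrC.
by rewrite -!hdot_rowc !rE hdot_unitary.
Qed.

Lemma defect_unitary (g : 'M[C]_2) y : g \is unitarymx -> defect (y *m g^T) = defect y.
Proof. by move=> Ug; congr (_ - _); apply: eq_bigr => k _; rewrite rdot_unitary. Qed.

Lemma thom_coord_unitary (g : 'M[C]_2) y : g \is unitarymx -> thom_coord y -> thom_coord (y *m g^T).
Proof.
move=> Ug [y1 yo dy]; split; first by rewrite rdot_unitary.
  by move=> k k0; rewrite rdot_unitary // yo.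
by rewrite defect_unitary.
Qed.

Lemma generator_unitary (g : 'M[C]_2) y : g \is unitarymx ->
  generator (y *m g^T) = generator y *m g^T.
Proof.
move=> Ug; apply/matrixP => k j; rewrite mxE defect_unitary // ![(_ *m _) _ _]mxE.
case: eqVneq => [->|k0]; last by apply: eq_bigr => i _; rewrite [generator _ _ _]mxE (negbTE k0).
by rewrite mulr_sumr; apply: eq_bigr => i _; rewrite [generator _ _ _]mxE eqxx mulrA.
Qed.

(** The constant coefficient of the generator is s u, and s can be cancelled. *)
Lemma prl_coeff0 x y : defect y != 0 -> prl x (generator y) -> coeff0_prl x y.
Proof.
move=> d0 xy i j; have := congr1 (fun (v : 'cV_N) => v 0 0) (xy i j).
rewrite /= !toep_row0 !mxE eqxx -!mulrA => e.
by apply: (mulfI d0).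
Qed.

Lemma zshift_toep : zshift C n = toep (zshift C n *m delta_mx 0 0).
Proof. by apply: comm_zshift_eq; rewrite ?toep_comm_zshift // toep_e0. Qed.

Lemma cycmx_stable w : stablemx (cycmx w) (zshiftV C n).
Proof.
apply/row_subP => i; rewrite row_mul -[row i _]vec_mxK mxvec_zshift; apply/cycmxP.
have /cycmxP [c ->] : (mxvec (vec_mx (row i (cycmx w))) <= cycmx w)%MS by rewrite vec_mxK row_sub.
by exists (toep (zshift C n *m delta_mx 0 0) *m c); rewrite mulmxA toepM -zshift_toep.
Qed.

(** Here x is divisible by z and w by z^(N-1), so their products vanish modulo z^N. *)
Lemma prl_top x w : row 0 x = 0 -> (forall k : 'I_N, (k < n)%N -> forall j, w k j = 0) -> prl x w.
Proof.
move=> /rowP x0 wk; have x0j j : x 0 j = 0 by have := x0 j; rewrite !mxE.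
have H i j : toep (col i w) *m col j x = 0.
  apply/colP => k; rewrite toep_mulC [RHS]mxE mxE big1 // => l _; rewrite mxE.
  have [ln|nl] := ltnP l n; first by rewrite wk // mulr0.
  have [kl|lk] := ltnP k l.
    by have /is_trig_mxP -> := toep_trig (col j x); rewrite ?mul0r.
  have -> : k = l.
    apply: val_inj; apply/eqP; rewrite eqn_leq lk andbT.
    by apply: leq_trans nl; rewrite -ltnS; exact: ltn_ord.
  by rewrite toep_diag mxE x0j mul0r.
by move=> i j; rewrite !H.
Qed.

Lemma boundary_point : (0 < n)%N -> exists y, [/\ thom_coord y, defect y = 0 &
  forall k : 'I_N, (0 < k < n)%N -> forall j, y k j = 0].
Proof.
move=> n0; have m0 : (ord_max : 'I_N) != 0 by rewrite -(inj_eq val_inj) /= -lt0n.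
(* u is the first basis vector of C^2, v_n the second, all other v_k are zero. With v in the top
   degree only, this sphere point is incident to every W in F_{2r-2}. *)
pose y : 'M[C]_(N, 2) := delta_mx 0 0 + delta_mx ord_max 1.
have y0 j : y 0 j = (j == 0)%:R.
  by rewrite !mxE eqxx (eq_sym 0) (negbTE m0) addr0.
have ym j : y ord_max j = (j == 1)%:R by rewrite !mxE eqxx (negbTE m0) add0r.
have [y00 y01 ym0 ym1] : [/\ y 0 0 = 1, y 0 1 = 0, y ord_max 0 = 0 & y ord_max 1 = 1].
  by split; rewrite ?y0 ?ym.
have yk (k : 'I_N) j : k != 0 -> k != ord_max -> y k j = 0.
  by move=> /negbTE k0 /negbTE km; rewrite !mxE k0 km addr0.
have I2 (f : 'I_2 -> C) : \sum_j f j = f 0 + f 1.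
  by rewrite big_ord_recl big_ord1; congr (_ + f _); apply: val_inj.
have d0 : defect y = 0.
  rewrite /defect (bigD1 ord_max) //= big1 ?addr0.
    by rewrite /rdot I2 ym0 ym1 rmorph0 rmorph1 mul0r mulr1 add0r subrr.
  by move=> k /andP[k0 km]; rewrite /rdot big1 // => j _; rewrite yk ?mul0r.
exists y; split=> //.
  split; last by rewrite d0.
    by rewrite /rdot I2 y00 y01 rmorph0 rmorph1 mul0r mulr1 addr0.
  move=> k k0; rewrite /rdot I2 y00 y01 rmorph0 mulr0 addr0 rmorph1 mulr1.
  by have [->|km] := eqVneq k ord_max; [rewrite ym0 | rewrite yk].
move=> k /andP[k0 kn] j; apply: yk; rewrite -(inj_eq val_inj) /=.
  by rewrite -lt0n.
by rewrite ltn_eqF.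
Qed.

End IncidenceAction.

(** * The space of incident pairs as a common compact cover *)

Section IncidencePoints.
Local Open Scope classical_set_scope.
Local Open Scope ring_scope.
Variables (C : numClosedFieldType) (n : nat).
Local Notation N := n.+1.

Definition point : Type := @incidence C n.
HB.instance Definition _ := Topological.on point.
Implicit Types x : point.

Lemma pointP x : [/\ (val x).1 \is unitarymx, stablemx (val x).1 (zshiftV C n),
  thom_coord (val x).2 & incident (val x).1 (val x).2].
Proof. by apply/incidenceP; rewrite -surjective_pairing; exact: set_valP x. Qed.

Lemma point_rank x : \rank (val x).1 = N.
Proof. by have [u _ _ _] := pointP x; rewrite mxrank_unitary. Qed.

Lemma point_free x : row_free (val x).1.
Proof. by rewrite /row_free point_rank. Qed.

Lemma point_chart_subproof x : (val x).2 \in @thom_chart_set C n.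
Proof. by apply: mem_set; have [] := pointP x. Qed.
Definition point_chart x : thom_chart C n := exist _ (val x).2 (point_chart_subproof x).

Lemma point_compact : compact [set z : C | `|z| <= 1] -> compact [set: point].
Proof. by move=> cC; exact: compact_set_type (incidence_compact cC). Qed.

Lemma point_mx_continuous : continuous (fun x => (val x).1).
Proof.
apply: (@continuous_compose _ _ _ (fun x : point => val x) fst); first exact: set_val_continuous.
by move=> p; exact: cvg_fst.
Qed.

Lemma point_chart_continuous : continuous point_chart.
Proof.
apply: continuous_set_type.
apply: (@continuous_compose _ _ _ (fun x : point => val x) snd); first exact: set_val_continuous.
by move=> p; exact: cvg_snd.
Qed.

Lemma point_chart_thom_continuous : continuous (fun x => chart_thom (point_chart x)).
Proof. exact: (continuous_compose point_chart_continuous (@chart_thom_continuous C n)). Qed.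

(** Off the boundary, W is recovered from (u, v) as the cyclic module of the generator. *)
Lemma point_mem x z : defect (val x).2 != 0 ->
  (mxvec z <= (val x).1)%MS <-> prl z (generator (val x).2).
Proof.
move=> d0; have [_ _ ty inc] := pointP x; have [i0 g0] := generator_coeff0 ty d0.
by apply: (prl_mem _ (point_rank x) g0) => t /inc [].
Qed.

End IncidencePoints.

(** * The two quotient maps and the equivariant homeomorphism *)

Section ThomHomeomorphism.
Local Open Scope classical_set_scope.
Local Open Scope ring_scope.
Local Open Scope quotient_scope.
Variable R : realType.
Local Notation C := (R[i] : numClosedFieldType).
Local Notation K := {ffun 'I_2 -> L2 R}.
Variables (n s : nat).
Local Notation r := s.+1.
Hypothesis hN : n.+1 = (2 * r)%N.
Local Notation N := n.+1.
Local Notation coef := (@coef R n r).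
Local Notation vecK := (@vecK R n r).

Local Notation point := (point C n).
Implicit Types x : point.

Lemma point_F_set x : F_set r (subK r (val x).1).
Proof. by have [_ st _ _] := pointP x; apply: (F_set_subK hN (point_rank x)). Qed.

Definition point_F x : F R r := exist _ (subK r (val x).1) (mem_set (point_F_set x)).

Lemma point_stiefel_subproof x :
  (val x).1 \in [set A : 'M[C]_(N, N * 2) | lin_indep (frame (@qbasis R n r) A)].
Proof. by apply: mem_set; apply: (frame_indep hN); exact: point_free. Qed.
Definition point_stiefel x : stiefel N (@qbasis R n r) :=
  exist _ (val x).1 (point_stiefel_subproof x).

(** The topology of [F] is initial for the map to the Grassmannian, and the map from frames to the
    Grassmannian is continuous, so a continuous choice of frames suffices. *)
Lemma F_continuous (X : topologicalType) (f : X -> F R r)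
    (A : X -> stiefel N (@qbasis R n r)) :
  continuous A -> (forall t, F_to_grass (f t) = stiefel_span (A t)) -> continuous f.
Proof.
move=> cA fA; apply: continuous_comp_initial.
rewrite (_ : _ \o _ = fun t => stiefel_span (A t)); last by apply/funext => t; exact: fA.
apply: (@continuous_compose _ _ _ A
  ((fun A => stiefel_span A) : stiefel N (@qbasis R n r) -> grass (F_quot R r)) cA).
by apply/continuousP => U oU; exact: oU (qbasis_basis R hN) N.
Qed.

Lemma point_F_continuous : continuous point_F.
Proof.
apply: (@F_continuous _ _ point_stiefel).
  by apply: continuous_set_type; exact: point_mx_continuous.
move=> x; rewrite /F_to_grass /stiefel_span set_valE /=.
by rewrite (span_frame_subK hN).
Qed.

Lemma subK_coefP p (A : 'M[C]_(p, N * 2)) (P : 'M[C]_(N, 2) -> Prop) :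
  (forall f, subK r A f -> P (coef f)) <-> (forall z, (mxvec z <= A)%MS -> P z).
Proof.
split=> [H z zA|H f [fr fA]]; last exact: H.
by rewrite -(coef_vecK r z); apply: H; exact: subK_vecK.
Qed.

Lemma point_lift W y : F_set r W -> thom_coord y ->
  (forall f, W f -> coeff0_prl (coef f) y /\ prl (coef f) (generator y)) ->
  exists x, val (point_F x) = W /\ (val x).2 = y.
Proof.
move=> FW ty Wy; have [A [uA sA WE]] := F_set_mx hN FW.
have iA : incident A y.
  move=> z zA; rewrite -(coef_vecK r z); apply: Wy; rewrite WE; exact: subK_vecK.
have xP : @incidence C n (A, y) by apply/incidenceP.
by exists (exist _ (A, y) (mem_set xP)).
Qed.

(** Off the sphere, W contains the generator, whose constant coefficient s u is nonzero; on the
    sphere, [boundary_coeff0] applies. *)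
Lemma point_boundary x : F_set s (val (point_F x)) <-> defect (val x).2 = 0.
Proof.
have [_ _ ty inc] := pointP x.
rewrite (F_set_pred hN erefl (point_F_set x)).
rewrite (subK_coefP _ (fun z => row 0 z = 0)); split=> [W0|d0 z /inc [c0 pz]]; last first.
  exact: boundary_coeff0 ty d0 c0 pz.
apply/eqP/negPn/negP => d0; have [i0] := generator_coeff0 ty d0.
have := W0 _ (iffRL (point_mem _ d0) (prl_refl _)) => /rowP /(_ i0).
by rewrite mxE [RHS]mxE => ->; rewrite eqxx.
Qed.

Local Notation Fpi := (@collapse_pi (F R r) [set W : F R r | F_set s (val W)]).

Lemma point_F_chart x x' : Fpi (point_F x) = Fpi (point_F x') <->
  chart_thom (point_chart x) = chart_thom (point_chart x').
Proof.
rewrite collapse_piP chart_thom_eq /= !point_boundary.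
have [_ _ ty _] := pointP x; have [_ _ ty' _] := pointP x'.
split=> -[xx'|xx']; try by left.
- have [d0|d0] := eqVneq (defect (val x).2) 0; [left | right].
    by split=> //; apply/point_boundary; rewrite -xx'; apply/point_boundary.
  have d0' : defect (val x').2 != 0.
    by apply: contra_neq d0 => d0'; apply/point_boundary; rewrite xx'; apply/point_boundary.
  apply: generator_inj => //; apply/(point_mem _ d0).
  (* The generator for [x'] lies in its own module, which is also the module of [x], hence is
     parallel to the generator for [x]. *)
  have e : subK r (val x').1 = subK r (val x).1 by exact: (congr1 val (esym xx')).
  by apply: (subK_inj e); apply/(point_mem _ d0'); exact: prl_refl.
- by right.
have [a a1 yE] := xx'; have [d0|d0] := eqVneq (defect (val x).2) 0; [right | left].
  by split=> //; rewrite yE defectZ.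
have d0' : defect (val x').2 != 0 by rewrite yE defectZ.
have a0 : a != 0 by rewrite -normr_gt0 a1.
apply: val_inj => /=; apply: subK_eqmx; apply/eqmxP/rV_eqP => v; rewrite -[v]vec_mxK.
have M := point_mem (vec_mx v) d0; have M' := point_mem (vec_mx v) d0'.
have H : prl (vec_mx v) (generator (val x').2) <-> prl (vec_mx v) (generator (val x).2).
  by rewrite yE (generatorZ _ a1); exact: prlZ.
apply/idP/idP => vA.
  by apply: (iffRL M'); apply: (iffRL H); exact: (iffLR M).
by apply: (iffRL M); apply: (iffLR H); exact: (iffLR M').
Qed.

(** The witness is K_+ itself, cut out in the window by the vanishing of the first r rows. *)
Lemma Kplus_point : exists W, F_set r W /\ forall f, W f -> row 0 (coef f) = 0.
Proof.
pose U : 'M[C]_(N, r) := (himx R hN)^T.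
pose A : 'M[C]_(r * 2, N * 2) := lin_mulmx U.
have memA (x : 'M[C]_(N, 2)) :
      (mxvec x <= A)%MS <-> forall k : 'I_N, (k < r)%N -> forall j, x k j = 0.
  split=> [/submxP [c xE] k kr j|x0].
    have -> : x = U *m vec_mx c.
      by apply: (can_inj mxvecK); rewrite xE -[c in LHS]vec_mxK mul_vec_lin.
    rewrite mxE big1 // => l _; rewrite mxE [himx _ _ _ _]mxE mxE.
    rewrite (_ : hidx hN l == k = false) ?mul0r //.
    by apply/negbTE/eqP => e; move: kr; rewrite -e /= ltnNge leq_addr.
  suff -> : x = U *m (himx R hN *m x) by rewrite -mul_vec_lin submxMl.
  apply/matrixP => k j; rewrite mxE.
  have [kr|[l ->]] := idx_cases hN k.
    rewrite x0 // big1 // => l _; rewrite himxE mxE [himx _ _ _ _]mxE mxE.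
    rewrite (_ : hidx hN l == k = false) ?mul0r //.
    by apply/negbTE/eqP => e; move: kr; rewrite -e /= ltnNge leq_addr.
  rewrite (bigD1 l) //= himxE !mxE eqxx mul1r big1 ?addr0 // => m ml.
  by rewrite !mxE (inj_eq (@hidx_inj _ _ hN)) (negbTE ml) mul0r.
have rA : \rank A = N.
  have fA : row_free A.
    apply/row_freeP; exists (lin_mulmx (himx R hN)); apply/row_matrixP => i.
    rewrite !rowE mulmx1 mulmxA -[delta_mx 0 i]vec_mxK !mul_vec_lin /=.
    by rewrite himx_trK.
  by rewrite (eqP fA) hN mulnC.
exists (subK r A); split.
  apply: (F_set_subK hN rA); apply/row_subP => i.
  rewrite row_mul -[row i _]vec_mxK mxvec_zshift; apply/memA => k kr j.
  have := iffLR (memA (vec_mx (row i A))); rewrite vec_mxK row_sub => /(_ isT) x0.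
  case: (unliftP ord0 k) kr => [l ->|->] kr; last by rewrite mxE big1 // => l _; rewrite mxE mul0r.
  by rewrite zshift_row0 x0 //= -ltnS; apply: ltnW; move: kr; rewrite lift0.
by apply/(subK_coefP A (fun z => row 0 z = 0)) => z /memA z0; apply/rowP => j; rewrite !mxE z0.
Qed.

(** One incident pair over the boundary is enough for both surjectivity proofs, because F_{2r-2} and
    the sphere are each collapsed to a point. *)
Lemma boundary_in_image : exists x, F_set s (val (point_F x)).
Proof.
have [W [FW W0]] := Kplus_point.
have n0 : (0 < n)%N by move: hN; lia.
have [y [ty d0 yk]] := boundary_point C n0.
have [|x [xW xy]] := point_lift FW ty.
  move=> f Wf; have /rowP f0 := W0 f Wf.
  have f0' j : coef f 0 j = 0 by have := f0 j; rewrite [LHS]mxE [RHS]mxE.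
  split; first by move=> i j; rewrite !f0' !mulr0.
  apply: prl_top; first exact: W0.
  move=> k kn j; rewrite generator0 // mxE; case: eqVneq => // k0.
  by apply: yk; rewrite kn andbT lt0n.
by exists x; apply/point_boundary; rewrite xy.
Qed.

Lemma point_F_surj (q : F_mod R r s) : exists x, Fpi (point_F x) = q.
Proof.
have [W <-] : exists W, Fpi W = q.
  by exists (repr (q : {eq_quot _})); exact: collapse_pi_repr.
have FW : F_set r (val W) by exact: (set_valP W).
have [WB|WB] := pselect (F_set s (val W)).
  by have [x xB] := boundary_in_image; exists x; apply/collapse_piP; right.
have [A [uA sA WE]] := F_set_mx hN FW.
have rA : \rank A = N by rewrite mxrank_unitary.
have [z0 [z0A z00]] : exists z0 : 'M[C]_(N, 2), (mxvec z0 <= A)%MS /\ row 0 z0 != 0.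
  apply: contrapT => H; apply: WB; apply/(F_set_pred hN erefl FW); rewrite WE.
  apply/(subK_coefP A (fun z => row 0 z = 0)) => z zA.
  by apply/eqP/negPn/negP => nz; apply: H; exists z.
have [y [ty d0 gA]] := generator_onto sA z0A z00.
have [i0 g0] := generator_coeff0 ty d0.
have [|x [xW xy]] := point_lift FW ty.
  rewrite WE; apply/(subK_coefP A (fun z => coeff0_prl z y /\ prl z (generator y))) => z zA.
  have pz := mem_prl rA sA g0 gA zA; split=> //; exact: prl_coeff0 d0 pz.
by exists x; congr Fpi; exact: val_inj.
Qed.

Lemma point_chart_surj (t : thom_tau R[i] n) : exists x, chart_thom (point_chart x) = t.
Proof.
have [y <-] := chart_thom_surj t; have ty := thom_chartP y.
have [d0|d0] := eqVneq (defect (val y)) 0.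
  have [x /point_boundary xB] := boundary_in_image.
  by exists x; apply/chart_thom_eq; left.
have [i0 g0] := generator_coeff0 ty d0.
have rc : \rank (cycmx (generator (val y))) = N by apply/eqP; exact: cycmx_free g0.
have FW := F_set_subK hN rc (cycmx_stable _).
have [|x [xW xy]] := point_lift FW ty.
  apply/(subK_coefP _ (fun z => coeff0_prl z (val y) /\ prl z (generator (val y)))).
  move=> z /cycmxP [c ->]; have pz := toep_prl c (generator (val y)).
  by split=> //; exact: prl_coeff0 d0 pz.
by exists x; congr chart_thom; exact: val_inj.
Qed.

(** An existence statement suffices, since the maps to the two quotients forget the frame: a fresh
    frame of gW is taken instead of transporting the old one. *)
Lemma point_act (g : SU2 R[i]) x : exists x', point_F x' = actF g (point_F x) /\
  val (point_chart x') = val (point_chart x) *m (val g)^T.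
Proof.
have Ug := SU2_unitary g; have [_ _ ty inc] := pointP x.
have FW := gsub_F Ug (point_F_set x).
have [|x' [xW xy]] := point_lift FW (thom_coord_unitary Ug ty).
  move=> f /(gsub_mem _ _ Ug) Wf.
  have -> : coef f = coef (gK (adj (val g)) f) *m (val g)^T.
    by rewrite -coef_gK (gKVK Ug).
  have [c0 pz] := iffRL (subK_coefP _
    (fun z => coeff0_prl z (val x).2 /\ prl z (generator (val x).2))) inc _ Wf.
  rewrite (generator_unitary _ Ug).
  by split; [exact: coeff0_prl_mulmx | exact: prl_mulmx].
by exists x'; split=> //; exact: val_inj.
Qed.

(** The separating functions are products of two entries of the projector P of W, the first in a
    column of the constant coefficient. Such columns vanish exactly on F_{2r-2}, so the products
    descend to the quotient. *)
Lemma F_mod_hausdorff : hausdorff_space (F_mod R r s).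
Proof.
pose P (W : F R r) := grass_proj hN (F_to_grass W) : 'M[C]_(N * 2).
have PE (W : F R r) : exists A : 'M[C]_(N, N * 2),
    [/\ row_free A, val W = subK r A & P W = orthoproj A].
  have [A [uA sA WE]] := F_set_mx hN (set_valP W).
  have fA : row_free A by rewrite /row_free mxrank_unitary.
  by exists A; split=> //; exact: grass_proj_subK.
pose e0 i : 'I_(N * 2) := mxvec_index 0 i.
have e0P (W : F R r) : F_set s (val W) <-> forall j i, P W j (e0 i) = 0.
  have [A [fA WE ->]] := PE W.
  rewrite (F_set_pred hN erefl (set_valP W)) WE (subK_coefP A (fun z => row 0 z = 0)).
  have e0E (z : 'M[C]_(N, 2)) i : z 0 i = mxvec z 0 (e0 i) by rewrite mxvecE.
  split=> [A0 j i|P0 z zA].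
    have := A0 (vec_mx (row j (orthoproj A))); rewrite vec_mxK.
    move=> /(_ (submx_trans (row_sub _ _) (orthoproj_sub _))) /rowP /(_ i).
    by rewrite mxE e0E vec_mxK mxE [RHS]mxE.
  apply/rowP => i; rewrite mxE e0E -(sub_orthoproj fA zA) [RHS]mxE mxE big1 // => j _.
  by rewrite P0 mulr0.
pose f (t : ('I_(N * 2) * 'I_2) * ('I_(N * 2) * 'I_(N * 2))) (W : F R r) : C :=
  P W t.1.1 (e0 t.1.2) * P W t.2.1 t.2.2.
have fA t W W' : F_set s (val W) -> F_set s (val W') -> f t W = f t W'.
  by move=> /e0P W0 /e0P W0'; rewrite /f W0 W0' !mul0r.
have cP i j : continuous (fun W : F R r => P W i j).
  apply: (@continuous_compose _ _ _ (@F_to_grass R r : F R r -> grass (F_quot R r))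
    (fun G => grass_proj hN G i j)).
    exact: initial_continuous.
  exact: grass_proj_continuous.
have cf t : continuous (f t) by exact: (continuous_mulf (cP _ _) (cP _ _)).
have cl t := collapse_lift_continuous (A := [set W : F R r | F_set s (val W)]) (fA t) (cf t).
apply: (hausdorff_separated (@norm_hausdorff C C^o) cl).
move=> q q'; have [x <-] := point_F_surj q; have [x' <-] := point_F_surj q' => ff.
have E t : f t (point_F x) = f t (point_F x').
  by have := ff t; rewrite !(collapse_liftE (A := [set W : F R r | F_set s (val W)]) (fA t)).
move: E; move: (point_F x) (point_F x') => W W' E; apply/collapse_piP.
(* The products include the squares of the entries in the columns [e0 i], so equal values detect
   F_{2r-2}. *)
have sym (V V' : F R r) : (forall t, f t V = f t V') -> F_set s (val V) -> F_set s (val V').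
  move=> VV' /e0P V0; apply/e0P => j i; have := VV' ((j, i), (j, e0 i)).
  by rewrite /f /= V0 mul0r => /esym/eqP; rewrite mulf_eq0 orbb => /eqP.
have [WB|WB] := pselect (F_set s (val W)); first by right; split=> //; exact: sym E WB.
left; have [j [i ji]] : exists j i, P W j (e0 i) != 0.
  apply: contrapT => H; apply: WB; apply/e0P => j i.
  by apply/eqP/negPn/negP => ji; apply: H; exists j, i.
have [A [fA0 WE PA]] := PE W; have [A' [fA0' WE' PA']] := PE W'.
(* A fixed nonzero first factor makes the two projectors proportional, and idempotents that are
   proportional and nonzero are equal. *)
have PP : P W = P W'.
  apply: (@idempotent_scale_eq _ _ _ _ (P W j (e0 i)) (P W' j (e0 i))) => //.
  - by rewrite PA orthoproj_idem.
  - by rewrite PA' orthoproj_idem.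
  - by apply: contraNneq ji => ->; rewrite mxE.
  by apply/matrixP => k l; rewrite [LHS]mxE [RHS]mxE; exact: (E ((j, i), (k, l))).
apply: val_inj; rewrite WE WE'; apply: subK_eqmx; apply/eqmxP.
have sub B B' : row_free B -> row_free B' -> orthoproj B = orthoproj B' -> (B <= B')%MS.
  move=> fB fB' e; rewrite -(mul_orthoproj fB) e.
  by apply: submx_trans (submxMl _ _) (orthoproj_sub _).
by rewrite !sub // -?PA -?PA'.
Qed.

Lemma F_mod_thom_homeomorphism : exists h : F_mod R r s -> thom_tau R[i] n,
  homeomorphism h /\ forall (g : SU2 R[i]) (q : F_mod R r s),
    h (act_F_mod g q) = act_thom g (h q).
Proof.
have [|||||h hh hE] := @compact_common_quotient point (F_mod R r s) (thom_tau R[i] n)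
    (fun x => Fpi (point_F x)) (fun x => chart_thom (point_chart x))
    (point_compact (@compact_unit_disc R)) F_mod_hausdorff (@thom_hausdorff _ n).
- exact: (continuous_compose point_F_continuous (@collapse_pi_continuous _ _)).
- exact: point_chart_thom_continuous.
- exact: point_F_surj.
- exact: point_chart_surj.
- exact: point_F_chart.
exists h; split=> // g q; have [x <-] := point_F_surj q.
have [x' [xF xc]] := point_act g x.
rewrite hE (act_chart_thom xc) -hE xF; congr h; apply: collapse_mapE => W WB.
exact: (gsub_F (SU2_unitary g) WB).
Qed.

End ThomHomeomorphism.

Theorem proposition4p4 (R : realType) (r : nat) (r_ge1 : (1 <= r)%N) :
  exists h : F_mod R r (r - 1) -> thom_tau R[i] (2 * r - 1),
    homeomorphism h /\
    forall (g : SU2 R[i]) (x : F_mod R r (r - 1)),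
      h (act_F_mod g x) = act_thom g (h x).
Proof.
case: r r_ge1 => // s _; rewrite subn1 /=.
by apply: F_mod_thom_homeomorphism; rewrite subn1 prednK.
Qed.
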